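(* Let $V$ be a lightlike hypersurface of a pseudo-Riemannian manifold $(M,g)$ of Lorentzian signature, and let $I=I(x)$ be a nonvanishing relative invariant of weight $1$ of $V$, intrinsically connected with the geometry of $V$ and defined in a second-order neighborhood of a point $x\in V$. Let $K$ and $K_a$ ($a=2,\dots,n-1$) be the coefficients in the equation $$d\ln|I|-\omega_1^1=-K\omega^1-K_a\omega^a .$$ If $K$ is not a root of the characteristic equation $\det(\lambda^a_b-\lambda\delta^a_b)=0$ of the affinor $(\lambda^a_b)$, then the coefficients $K_a$ allow one to construct an object $L_a$ defining an invariant normalization of $V$ (that is, functions $L_a$, expressed through $K_a$, $K$ and $\lambda^a_b$, such that the subspaces $S_x=\mathrm{span}(e_a+L_ae_1)_{a=2,\dots,n-1}$ form an invariant screen distribution on $V$). This normalization is intrinsically connected with the geometry of $V$ and is defined in a third-order neighborhood of a point $x\in V$.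
   Context: $(M,g)$ has dimension $n$ and signature $(n-1,1)$, with Levi-Civita connection $D$. A lightlike hypersurface $V$ is a hypersurface ($\dim V=n-1$) on which $g$ has rank $n-2$. A first-order isotropic frame at $x\in V$ is a basis $(e_1,\dots,e_n)$ of $T_xM$ with $e_1$ isotropic, $T_xV=\mathrm{span}(e_1,\dots,e_{n-1})$, $e_a$ ($a=2,\dots,n-1$) spacelike and orthogonal to $e_1$, $g_{ab}=(e_a,e_b)$ positive definite with inverse $g^{ab}$, $e_n$ isotropic, $(e_1,e_n)=-1$, $(e_a,e_n)=0$. Write $dx=\omega^ie_i$, $De_i=\omega_i^je_j$. On $V$: $\omega^n=0$, $\omega^1,\omega^a$ form a coframe, $\omega_a^n=\lambda_{ab}\omega^b$ with $\lambda_{ab}=\lambda_{ba}$, and $\lambda^a_b=g^{ac}\lambda_{cb}$ (so $\omega^a_1=\lambda^a_b\omega^b$). A relative invariant of weight $1$ is a function $I$ of the frame, depending on the frame only through the scale of $e_1$, with $I\mapsto cI$ when $e_1\mapsto ce_1$; infinitesimally $\delta I=I\pi^1_1$, where $\delta$ is differentiation with respect to fiber parameters and $\pi_1^1=\omega_1^1(\delta)$. Examples are the trace or an eigenvalue of $(\lambda^a_b)$. Hence $d\ln|I|-\omega_1^1$ is a combination of $\omega^1,\omega^a$. A screen subspace $S_x\subset T_xV$ is an $(n-2)$-dimensional subspace complementary to $\mathbb{R}e_1$; a screen distribution is a smooth field of such subspaces; it is invariant if $S_x$ does not depend on the choice of first-order isotropic frame. It is equivalent to a normalization of $V$, $N_x$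 being the unique isotropic direction orthogonal to $S_x$ and not in $T_xV$. An object is intrinsically connected with the geometry of $V$ if it is determined by $(M,g)$ and $V$ alone, without auxiliary choices. Order of neighborhood: the components $g_{ij}$ are of first order, the forms $\omega^i_j$ and $\lambda_{ab}$ of second order, the curvature tensor of $(M,g)$ of third order (order $p$ involves the $p$-jet of $V$ and the $(p-1)$-jet of $g$), each further differentiation raising the order by one. *)

(* Defs.v *)
From HB Require Import structures.
From mathcomp Require Import all_boot all_order all_algebra.
From mathcomp Require Import all_classical all_reals all_analysis.

Set Implicit Arguments.
Unset Strict Implicit.
Unset Printing Implicit Defensive.

Import Order.TTheory GRing.Theory Num.Theory.
Import numFieldNormedType.Exports.

Local Open Scope classical_set_scope.
Local Open Scope ring_scope.

(* Vectors are row vectors, so a linear map acts on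
   the right: 'd f x v = v *m jacobian f x.  Throughout, m stands for n - 2:
   the ambient manifold has dimension n = 1 + m + 1, the hypersurface n - 1 =
   1 + m, and a screen subspace n - 2 = m.  The shape 1 + m + 1 is the block
   structure (e_1; e_2, ..., e_{n-1}; e_n) of an isotropic frame. *)

Section Smooth.
Context {R : realType}.

(* For open U and finite-dimensional V this is the usual class C^k. *)
Fixpoint Ck (V W : normedModType R) (k : nat) (U : set V) (f : V -> W) : Prop :=
  if k is k'.+1 then
    (forall x, U x -> differentiable f x) /\
    (forall v, Ck k' U (fun x => 'D_v f x))
  else forall x, U x -> {for x, continuous f}.

Definition smooth (V W : normedModType R) (U : set V) (f : V -> W) : Prop :=
  forall k, Ck k U f.

Fixpoint jdim (p q k : nat) : nat :=
  if k is k'.+1 then (jdim p q k' + p * jdim p q k')%N else q.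

(* The k-jet of f at x, as the iterated 1-jet j^1 (... (j^1 f)); it lists,
   with repetitions, all partial derivatives of f at x of order at most k. *)
Fixpoint jet (p q k : nat) (f : 'rV[R]_p -> 'rV[R]_q) :
    'rV[R]_p -> 'rV[R]_(jdim p q k) :=
  if k is k'.+1 return 'rV[R]_p -> 'rV[R]_(jdim p q k) then
    fun x => row_mx (jet k' f x) (mxvec (jacobian (jet k' f) x))
  else f.

End Smooth.

Section Manifolds.
Context {R : realType}.

(* cmap and cinv are meaningful only on cdom and cmap @` cdom. *)
Record chart (T : topologicalType) (n : nat) := Chart {
  cdom : set T;
  cmap : T -> 'rV[R]_n;
  cinv : 'rV[R]_n -> T;
  cdom_open : open cdom;
  cimg_open : open (cmap @` cdom);
  cmapK : forall x, cdom x -> cinv (cmap x) = x;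
  cmap_continuous : forall x, cdom x -> {for x, continuous cmap};
  cinv_continuous : forall x, cdom x -> {for cmap x, continuous cinv} }.

Definition transition (T : topologicalType) (n : nat) (c c' : chart T n) :=
  cmap c' \o cinv c.

Definition compatible (T : topologicalType) (n : nat) (c c' : chart T n) :=
  smooth (cmap c @` (cdom c `&` cdom c')) (transition c c') /\
  smooth (cmap c' @` (cdom c' `&` cdom c)) (transition c' c).

Record manifold (n : nat) := Manifold {
  points :> topologicalType;
  _ : hausdorff_space points;
  _ : @second_countable points;
  atlas : set (chart points n);
  atlas_cover : forall x, exists2 c, atlas c & cdom c x;
  atlas_compatible : forall c c', atlas c -> atlas c' -> compatible c c';
  atlas_maximal :
    forall c, (forall c', atlas c' -> compatible c c') -> atlas c }.

Definition chart_at (n : nat) (M : manifold n) (x : M) (c : chart M n) :=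
  atlas c /\ cdom c x.

Definition local_rep (p q : nat) (M : manifold p) (N : manifold q) (f : M -> N)
    (b : chart M p) (c : chart N q) : 'rV[R]_p -> 'rV[R]_q :=
  cmap c \o f \o cinv b.

Definition local_dom (p q : nat) (M : manifold p) (N : manifold q) (f : M -> N)
    (b : chart M p) (c : chart N q) : set 'rV[R]_p :=
  cmap b @` (cdom b `&` f @^-1` cdom c).

Definition smooth_map (p q : nat) (M : manifold p) (N : manifold q)
    (f : M -> N) : Prop :=
  continuous f /\
  forall b c, atlas b -> atlas c -> smooth (local_dom f b c) (local_rep f b c).

Definition diffeomorphism (p q : nat) (M : manifold p) (N : manifold q)
    (f : M -> N) : Prop :=
  smooth_map f /\
  exists g : N -> M, [/\ cancel f g, cancel g f & smooth_map g].

End Manifolds.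

Arguments chart R T n : clear implicits.
Arguments manifold R n : clear implicits.

Section Lightlike.
Context {R : realType} {m : nat}.

Definition ip (k : nat) (G : 'M[R]_k) (v w : 'rV[R]_k) : R :=
  (v *m G *m w^T) 0 0.

Definition lorentzian (G : 'M[R]_(1 + m + 1)) : Prop :=
  exists2 P, P \in unitmx
           & P *m G *m P^T = block_mx (1%:M : 'M[R]_(1 + m)) 0 0 (-1)%:M.

(* A metric is given by its component matrices in the charts. *)
Record metric (M : manifold R (1 + m + 1)) := Metric {
  gmx : chart R M (1 + m + 1) -> 'rV[R]_(1 + m + 1) -> 'M[R]_(1 + m + 1);
  gmx_smooth : forall c, atlas c -> smooth (cmap c @` cdom c) (gmx c);
  gmx_sym : forall c y, chart_at y c -> (gmx c (cmap c y))^T = gmx c (cmap c y);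
  gmx_lorentz : forall c y, chart_at y c -> lorentzian (gmx c (cmap c y));
  gmx_tensor : forall c c' y, chart_at y c -> chart_at y c' ->
    let P := jacobian (transition c c') (cmap c y) in
    gmx c (cmap c y) = P *m gmx c' (cmap c' y) *m P^T }.

(* A Lorentzian manifold (amb, met) with an immersed hypersurface hyp on which
   the metric has rank n - 2. *)
Record lightlike := Lightlike {
  amb : manifold R (1 + m + 1);
  met : metric amb;
  hyp : manifold R (1 + m);
  imm : hyp -> amb;
  imm_smooth : smooth_map imm;
  imm_immersion : forall x b c, chart_at x b -> chart_at (imm x) c ->
    \rank (jacobian (local_rep imm b c) (cmap b x)) = (1 + m)%N;
  imm_lightlike : forall x b c, chart_at x b -> chart_at (imm x) c ->
    let J := jacobian (local_rep imm b c) (cmap b x) in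
    \rank (J *m gmx met c (cmap c (imm x)) *m J^T) = m }.

Notation hchart H := (chart R (hyp H) (1 + m)).
Notation achart H := (chart R (amb H) (1 + m + 1)).

Definition coords (H : lightlike) (x : hyp H) (b : hchart H) (c : achart H) :=
  chart_at x b /\ chart_at (imm x) c.

(* The hypersurface as the parametrized hypersurface u |-> r u of R^n. *)
Definition param (H : lightlike) (b : hchart H) (c : achart H) :=
  local_rep (@imm H) b c.

(* The row space of tanmx is T_x V, in the chart c. *)
Definition tanmx (H : lightlike) (b : hchart H) (c : achart H)
    (u : 'rV[R]_(1 + m)) : 'M[R]_(1 + m, 1 + m + 1) := jacobian (param b c) u.

Definition gram (H : lightlike) (b : hchart H) (c : achart H)
    (u : 'rV[R]_(1 + m)) : 'M[R]_(1 + m + 1) := gmx (met H) c (param b c u).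

Definition isotropic_tangent (H : lightlike) (b : hchart H) (c : achart H)
    (u : 'rV[R]_(1 + m)) (e : 'rV[R]_(1 + m + 1)) : Prop :=
  [/\ e != 0, (e <= tanmx b c u)%MS & ip (gram b c u) e e = 0].

Definition frame1 (E : 'M[R]_(1 + m + 1)) : 'rV[R]_(1 + m + 1) :=
  usubmx (usubmx E).
Definition frames (E : 'M[R]_(1 + m + 1)) : 'M[R]_(m, 1 + m + 1) :=
  dsubmx (usubmx E).
Definition framen (E : 'M[R]_(1 + m + 1)) : 'rV[R]_(1 + m + 1) := dsubmx E.

Definition screen_gram (H : lightlike) (b : hchart H) (c : achart H)
    (u : 'rV[R]_(1 + m)) (E : 'M[R]_(1 + m + 1)) : 'M[R]_m :=
  frames E *m gram b c u *m (frames E)^T.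

(* The rows of E are the components of a first-order isotropic frame. *)
Definition isotropic_frame (H : lightlike) (b : hchart H) (c : achart H)
    (u : 'rV[R]_(1 + m)) (E : 'M[R]_(1 + m + 1)) : Prop :=
  let G := gram b c u in
  (E \in unitmx /\ (usubmx E == tanmx b c u)%MS) /\
  [/\ ip G (frame1 E) (frame1 E) = 0,
      frames E *m G *m (frame1 E)^T = 0
    & forall v : 'rV[R]_m, v != 0 -> 0 < ip (screen_gram b c u E) v v] /\
  [/\ ip G (framen E) (framen E) = 0,
      ip G (frame1 E) (framen E) = -1
    & frames E *m G *m (framen E)^T = 0].

Definition isotropic_frame_field (H : lightlike) (b : hchart H) (c : achart H)
    (U : set 'rV[R]_(1 + m)) (E : 'rV[R]_(1 + m) -> 'M[R]_(1 + m + 1)) : Prop :=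
  [/\ open U, U `<=` local_dom (@imm H) b c, smooth U E
    & forall u, U u -> isotropic_frame b c u (E u)].

(* The Christoffel symbol Gamma^k_ij of the Levi-Civita connection of G. *)
Definition christoffel (G : 'rV[R]_(1 + m + 1) -> 'M[R]_(1 + m + 1))
    (y : 'rV[R]_(1 + m + 1)) (k i j : 'I_(1 + m + 1)) : R :=
  let dG l i j := 'D_(delta_mx 0 l) (fun z => G z i j : R^o) y in
  2^-1 * \sum_l invmx (G y) k l * (dG i j l + dG j i l - dG l i j).

(* D_v w - v(w) = w *m connection_mx G y v. *)
Definition connection_mx (G : 'rV[R]_(1 + m + 1) -> 'M[R]_(1 + m + 1))
    (y v : 'rV[R]_(1 + m + 1)) : 'M[R]_(1 + m + 1) :=
  \matrix_(j, k) \sum_i v 0 i * christoffel G y k i j.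

(* In the next two definitions a is a tangent vector of the hypersurface, in
   the chart b.  coframe lists the omega^i (a), where dx = omega^i e_i, and
   the (i, j) entry of connection_form is omega_i^j (a), where
   D e_i = omega_i^j e_j. *)
Definition coframe (H : lightlike) (b : hchart H) (c : achart H)
    (E : 'rV[R]_(1 + m) -> 'M[R]_(1 + m + 1)) (u a : 'rV[R]_(1 + m)) :
    'rV[R]_(1 + m + 1) :=
  'd (param b c) u a *m invmx (E u).

Definition connection_form (H : lightlike) (b : hchart H) (c : achart H)
    (E : 'rV[R]_(1 + m) -> 'M[R]_(1 + m + 1)) (u a : 'rV[R]_(1 + m)) :
    'M[R]_(1 + m + 1) :=
  ('D_a E u
   + E u *m connection_mx (gmx (met H) c) (param b c u) ('d (param b c) u a))
  *m invmx (E u).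

Definition omega1 (H : lightlike) (b : hchart H) (c : achart H)
    (E : 'rV[R]_(1 + m) -> 'M[R]_(1 + m + 1)) (u a : 'rV[R]_(1 + m)) : R :=
  (lsubmx (lsubmx (coframe b c E u a) : 'rV[R]_(1 + m))) 0 0.

Definition omegas (H : lightlike) (b : hchart H) (c : achart H)
    (E : 'rV[R]_(1 + m) -> 'M[R]_(1 + m + 1)) (u a : 'rV[R]_(1 + m)) :
    'rV[R]_m :=
  rsubmx (lsubmx (coframe b c E u a) : 'rV[R]_(1 + m)).

Definition omega11 (H : lightlike) (b : hchart H) (c : achart H)
    (E : 'rV[R]_(1 + m) -> 'M[R]_(1 + m + 1)) (u a : 'rV[R]_(1 + m)) : R :=
  (ulsubmx (ulsubmx (connection_form b c E u a) : 'M[R]_(1 + m))) 0 0.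

(* The column of the omega_a^n (a). *)
Definition omegasn (H : lightlike) (b : hchart H) (c : achart H)
    (E : 'rV[R]_(1 + m) -> 'M[R]_(1 + m + 1)) (u a : 'rV[R]_(1 + m)) :
    'cV[R]_m :=
  dsubmx (ursubmx (connection_form b c E u a) : 'cV[R]_(1 + m)).

Definition second_form (H : lightlike) (b : hchart H) (c : achart H)
    (E : 'rV[R]_(1 + m) -> 'M[R]_(1 + m + 1)) (u : 'rV[R]_(1 + m))
    (lam : 'M[R]_m) : Prop :=
  forall a, omegasn b c E u a = lam *m (omegas b c E u a)^T.

(* The matrix (lambda^a_b), with a the row index. *)
Definition affinor (H : lightlike) (b : hchart H) (c : achart H)
    (E : 'rV[R]_(1 + m) -> 'M[R]_(1 + m + 1)) (u : 'rV[R]_(1 + m))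
    (lam : 'M[R]_m) : 'M[R]_m :=
  invmx (screen_gram b c u (E u)) *m lam.

(* I H x c e is the value of the invariant of H at the point x for the frames
   whose vector e_1 has components e in the chart c.  Only the values for c a
   chart at x and e a nonzero isotropic tangent vector are meaningful. *)
Definition scalar_rule :=
  forall H : lightlike, hyp H -> achart H -> 'rV[R]_(1 + m + 1) -> R.

(* S H x c is the set of the components in the chart c of the elements of a
   set of tangent vectors of the ambient manifold at the point x of H. *)
Definition distribution_rule :=
  forall H : lightlike, hyp H -> achart H -> set 'rV[R]_(1 + m + 1).

Definition relative_invariant1 (I : scalar_rule) : Prop :=
  forall H x b c e (k : R), coords x b c ->
    isotropic_tangent b c (cmap b x) e -> k != 0 ->
    I H x c (k *: e) = k * I H x c e.

Definition nonvanishing (I : scalar_rule) (H : lightlike) : Prop :=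
  forall (x : hyp H) b c e, coords x b c ->
    isotropic_tangent b c (cmap b x) e -> I H x c e != 0.

Definition isomorphism (H H' : lightlike)
    (phi : amb H -> amb H') (psi : hyp H -> hyp H') : Prop :=
  [/\ diffeomorphism phi, diffeomorphism psi,
      forall x, phi (imm x) = imm (psi x)
    & forall y c c', chart_at y c -> chart_at (phi y) c' ->
      let P := jacobian (local_rep phi c c') (cmap c y) in
      gmx (met H) c (cmap c y) = P *m gmx (met H') c' (cmap c' (phi y)) *m P^T].

(* "Determined by (M, g) and V alone": invariance under all isomorphisms.  For
   the identity of H this says that the value does not depend on the chart c,
   and for phi the identity and psi arbitrary, that it does not depend on the
   parametrization of the hypersurface. *)
Definition intrinsic_scalar (I : scalar_rule) : Prop :=
  forall H H' phi psi, @isomorphism H H' phi psi ->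
  forall x b c c' e, coords x b c -> chart_at (phi (imm x)) c' ->
    isotropic_tangent b c (cmap b x) e ->
    I H x c e
    = I H' (psi x) c' (e *m jacobian (local_rep phi c c') (cmap c (imm x))).

Definition intrinsic_distribution (D : lightlike -> Prop) (S : distribution_rule) :=
  forall H H' phi psi, D H -> D H' -> @isomorphism H H' phi psi ->
  forall x c c', chart_at (imm x) c -> chart_at (phi (imm x)) c' ->
    S H' (psi x) c'
    = [set v *m jacobian (local_rep phi c c') (cmap c (imm x)) | v in S H x c].

(* "Defined in a neighborhood of order p": locally, the object is a smooth
   function F of the p-jet of the hypersurface and the (p-1)-jet of the metric,
   the same F for all members of D whose jet lies in some neighborhood O of the
   jet of H.  A H x b c z means that z : X represents the object at the point x
   of H in the charts b and c. *)
Definition defined_in_order (p : nat) (D : lightlike -> Prop) (X : normedModType R)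
    (A : forall H : lightlike, hyp H -> hchart H -> achart H -> X -> Prop)
    (H : lightlike) : Prop :=
  let J (H : lightlike) (b : hchart H) (c : achart H) u :=
    (jet p (param b c) u,
     jet p.-1 (fun y => mxvec (gmx (met H) c y)) (param b c u)) in
  forall x b c, coords x b c ->
  exists (O : set _) (F : _ -> X),
    [/\ open O, O (J H b c (cmap b x)), smooth O F
      & forall (H' : lightlike) x' b' c', D H' -> coords x' b' c' ->
        O (J H' b' c' (cmap b' x')) ->
        A H' x' b' c' (F (J H' b' c' (cmap b' x')))].

(* An invariant of weight 1 is represented by its value for one e_1. *)
Definition scalar_order (p : nat) (I : scalar_rule) : lightlike -> Prop :=
  @defined_in_order p (fun=> True) ('rV[R]_(1 + m + 1) * R^o)%type
    (fun H x b c z =>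
      isotropic_tangent b c (cmap b x) z.1 /\ I H x c z.1 = z.2).

Definition distribution_order (p : nat) (D : lightlike -> Prop)
    (S : distribution_rule) : lightlike -> Prop :=
  @defined_in_order p D 'M[R]_(m, 1 + m + 1)
    (fun H x b c B => S H x c = [set v | (v <= B)%MS]).

(* d ln|I| - omega_1^1 = - K omega^1 - K_a omega^a at the point u. *)
Definition invariant_coefficients (I : scalar_rule) (H : lightlike)
    (b : hchart H) (c : achart H)
    (E : 'rV[R]_(1 + m) -> 'M[R]_(1 + m + 1)) (u : 'rV[R]_(1 + m))
    (K : R) (Ks : 'rV[R]_m) : Prop :=
  forall a,
    'D_a (fun w => ln `|I H (cinv b w) c (frame1 (E w))| : R^o) u
      - omega11 b c E u a
    = - (K * omega1 b c E u a) - (Ks *m (omegas b c E u a)^T) 0 0.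

Definition not_characteristic_root (I : scalar_rule) (H : lightlike) : Prop :=
  forall b c U E u K Ks lam, @atlas _ _ (hyp H) b -> atlas c ->
    isotropic_frame_field b c U E -> U u ->
    invariant_coefficients I b c E u K Ks -> second_form b c E u lam ->
    \det (affinor b c E u lam - K%:M) <> 0.

Definition screen_distribution (H : lightlike)
    (S : hyp H -> achart H -> set 'rV[R]_(1 + m + 1)) : Prop :=
  (forall x c c', chart_at (imm x) c -> chart_at (imm x) c' ->
    S x c' = [set v *m jacobian (transition c c') (cmap c (imm x)) | v in S x c])
  /\
  (forall x b c, coords x b c ->
    exists (U : set 'rV[R]_(1 + m)) (B : 'rV[R]_(1 + m) -> 'M[R]_(m, 1 + m + 1)),
      [/\ open U, U (cmap b x), U `<=` local_dom (@imm H) b c, smooth U B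
        & forall u, U u ->
          [/\ S (cinv b u) c = [set v | (v <= B u)%MS],
              \rank (B u) = m
            & forall e, isotropic_tangent b c u e ->
                (e + B u == tanmx b c u)%MS]]).

End Lightlike.

Arguments lightlike R m : clear implicits.
Arguments scalar_rule R m : clear implicits.
Arguments distribution_rule R m : clear implicits.

(* Main.v *)
From HB Require Import structures.
Require Import Defs.
From mathcomp Require Import all_boot all_order all_algebra.
From mathcomp Require Import all_classical all_reals all_analysis.
From mathcomp Require Import ring lra.
Import Order.TTheory GRing.Theory Num.Theory.
Import numFieldNormedType.Exports.
Local Open Scope classical_set_scope.
Local Open Scope ring_scope.

(** The invariant turns the null direction of the hypersurface [V] into a
    canonical null vector field: [xi = e / I e] is the same for all null tangent
    vectors [e], because [I] has weight 1 ([null_field]). Let [W v = D_v xi] for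
    [v] tangent to [V]. As [xi] is null and orthogonal to [V], the vector [W v]
    is again tangent to [V]. Moreover [(D_v xi, w)] is symmetric in [v] and [w],
    since the connection has no torsion, so [(W xi, w) = (W w, xi) = 0] and
    [W xi = kappa xi] for a function [kappa] ([shape_null]). The screen is the
    image of [W - kappa], an operator that kills [xi] ([screen_field]). No frame
    enters in this construction.

    In a frame with [e_1 = k xi], that is with [k = I e_1], the equation defining
    [K] and [K_a] gives the [e_1] component of [W] ([dln_invariant]), and
    [[
      k W = (K omega^1 + K_a omega^a) e_1 + lambda^a_b omega^b e_a.
    ]]
    Evaluating on [xi] gives [K = k kappa]. Hence the image of [W - kappa] is
    spanned by the vectors [K_b e_1 + (lambda^a_b - K delta^a_b) e_a]
    ([screen_field_frame]). If [K] is not a root of the characteristic equation,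
    then [lambda - K] is invertible and the same space is spanned by the vectors
    [e_a + L_a e_1], where [L (lambda - K) = (K_a)] ([normalization],
    [screen_field_normalized]).

    The screen is intrinsic because an isometry carries the Levi-Civita
    connection of one metric to that of the other ([connection_mx_isometry],
    which rests on the uniqueness argument [koszul_unique]); therefore an
    isomorphism of hypersurfaces carries [xi], [W] and the screen to each other
    ([screen_field_isomorphism]). The identity isomorphism, seen in different
    charts, gives the independence of the charts.

    As for the order, [xi] is a smooth function of the 2-jet
    ([null_field_order]), so the chain rule expresses [W] and the screen by the
    3-jet ([jet_screenE]). The screen has dimension [m] everywhere
    ([screen_field_complement]); so [m] combinations of the [1 + m] rows of
    [screen_field] that are independent for one jet form a basis of the screen
    for all neighbouring jets, and this basis is a smooth function of the jet.
    That the screen distribution is smooth follows from this. *)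
Set Implicit Arguments.
Unset Strict Implicit.
Unset Printing Implicit Defensive.

(** * Calculus of functions of class C^k *)

Section FiniteDimension.
Context {R : realType}.

(** The coordinates are asked to be continuous, since then all linear and
    bilinear maps on [V] are. *)
Definition finite_dim (V : normedModType R) := exists (n : nat) (e : 'I_n -> V)
    (c : 'I_n -> {linear V -> R^o}),
  (forall i, continuous (c i)) /\ forall v, v = \sum_i c i v *: e i.

Definition mx_coord (p q : nat) (i : 'I_p) (j : 'I_q) (A : 'M[R]_(p, q)) : R^o :=
  A i j.

Fact mx_coord_linear p q i j : linear (@mx_coord p q i j).
Proof. by move=> k A B; rewrite /mx_coord !mxE. Qed.

HB.instance Definition _ p q i j :=
  GRing.isLinear.Build R 'M[R]_(p, q) R^o _ (@mx_coord p q i j)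
    (@mx_coord_linear p q i j).

Lemma mx_coord_continuous p q i j : continuous (@mx_coord p q i j).
Proof. exact: coord_continuous. Qed.

Lemma finite_dim_mx p q : finite_dim 'M[R]_(p, q).
Proof.
exists #|{: 'I_p * 'I_q}|, (fun k => delta_mx (enum_val k).1 (enum_val k).2),
  (fun k => mx_coord (enum_val k).1 (enum_val k).2).
split=> [k|A]; first exact: mx_coord_continuous.
rewrite [LHS]matrix_sum_delta pair_big /=.
by rewrite -(@big_enum_val _ _ _ _ (fun=> true) (fun k => A k.1 k.2 *: delta_mx k.1 k.2)) /=.
Qed.

Lemma finite_dim_prod (V W : normedModType R) :
  finite_dim V -> finite_dim W -> finite_dim (V * W)%type.
Proof.
move=> [n [e [c [cc ce]]]] [n' [e' [c' [cc' ce']]]].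
exists (n + n')%N,
  (fun k : 'I_(n + n') => match fintype.split k with inl i => (e i, 0) | inr j => (0, e' j) end),
  (fun k : 'I_(n + n') => match fintype.split k with
     | inl i => (c i \o fst)%FUN : {linear (V * W)%type -> R^o}
     | inr j => (c' j \o snd)%FUN end).
split=> [k|[v w]].
  case: (fintype.split k) => i p; apply: continuous_comp; rewrite /=.
  - exact: cvg_fst. - exact: cc. - exact: cvg_snd. - exact: cc'.
rewrite big_split_ord /=.
under eq_bigr do rewrite (unsplitK (inl _)) /=.
under [X in _ + X]eq_bigr do rewrite (unsplitK (inr _)) /=.
have sumfst (I : finType) (F : I -> V) : \sum_i (F i, 0 : W) = (\sum_i F i, 0).
  by apply: (big_ind2 (fun (a : V * W) (b : V) => a = (b, 0))) => // ? ? ? ? -> ->;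
    rewrite /GRing.add /= /add_pair /= addr0.
have sumsnd (I : finType) (F : I -> W) : \sum_i (0 : V, F i) = (0, \sum_i F i).
  by apply: (big_ind2 (fun (a : V * W) (b : W) => a = (0, b))) => // ? ? ? ? -> ->;
    rewrite /GRing.add /= /add_pair /= addr0.
under eq_bigr => i _ do rewrite /GRing.scale /= /scale_pair /= scaler0.
under [X in _ + X]eq_bigr => i _ do rewrite /GRing.scale /= /scale_pair /= scaler0.
by rewrite sumfst sumsnd {1}(ce v) {1}(ce' w) /GRing.add /= /add_pair /= addr0 add0r.
Qed.

Lemma finite_dim_continuous (V W : normedModType R) (f : {linear V -> W}) :
  finite_dim V -> continuous f.
Proof.
move=> [n [e [c [cc ce]]]].
have -> : (f : V -> W) = fun v => \sum_i c i v *: f (e i).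
  by apply/funext => v; rewrite {1}(ce v) linear_sum; apply: eq_bigr => i _; rewrite linearZ.
move=> v; apply: cvg_big => [|i _]; first exact: add_continuous.
by apply: cvgZr_tmp; exact: cc.
Qed.

End FiniteDimension.

Section CkCalculus.
Context {R : realType}.
Implicit Types (U V W : normedModType R).

Lemma Ck_sub V W k (A B : set V) (f : V -> W) : B `<=` A -> Ck k A f -> Ck k B f.
Proof.
move=> BA; elim: k f => [|k IH] f /=; first by move=> fA x /BA/fA.
by case=> df Df; split=> [x /BA/df|v] //; apply: IH.
Qed.

Lemma open_eq_near V W (A : set V) (f g : V -> W) x : open A -> A x ->
  {in A, f =1 g} -> \near x, f x = g x.
Proof.
move=> oA Ax fg; near=> y; apply: fg; rewrite inE.
by near: y; apply: open_nbhs_nbhs.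
Unshelve. all: by end_near.
Qed.

Lemma near_eq_differentiable V W (f g : V -> W) x :
  (\near x, f x = g x) -> differentiable f x -> differentiable g x.
Proof.
move=> fg /diff_locallyP[df fE].
have gE : g \o shift x = cst (g x) + 'd f x +o_ 0 id.
  apply/eqaddoP => e e0; move/eqaddoP: fE => /(_ e e0).
  have fg0 : \forall h \near 0, f (h + x) = g (h + x).
    by move: fg; rewrite (near_shift 0 x) /=; under [X in X _ -> _]eq_fun do rewrite subr0.
  move=> fE; near=> h; rewrite !fctE /= -(nbhs_singleton fg).
  have <- : f (h + x) = g (h + x) by near: h.
  by near: h.
by apply/diff_locallyP; split; rewrite (diff_unique df gE).
Unshelve. all: by end_near.
Qed.

(** In the inductions on [k] below, the derivative of a compound function is
    known on [A] only; this lemma lets the rules of differentiation apply. *)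
Lemma Ck_eq V W k (A : set V) (f g : V -> W) : open A -> {in A, f =1 g} ->
  Ck k A f -> Ck k A g.
Proof.
move=> oA; elim: k f g => [|k IH] f g fg /=.
  move=> fc x Ax; rewrite /prop_for /continuous_at -fg ?inE //.
  apply: cvg_trans (fc x Ax); apply: near_eq_cvg.
  exact: open_eq_near oA Ax fg.
case=> df Df; split=> [x Ax|v].
  exact: near_eq_differentiable (open_eq_near oA Ax fg) (df x Ax).
apply: IH (Df v) => x; rewrite inE => Ax.
by apply: near_eq_derive; exact: open_eq_near oA Ax fg.
Qed.

Lemma Ck_pred V W k (A : set V) (f : V -> W) : Ck k.+1 A f -> Ck k A f.
Proof.
elim: k f => [|k IH] f [df Df] /=.
  by move=> x Ax; apply: differentiable_continuous; exact: df.
by split=> // v; apply: IH; exact: Df.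
Qed.

Lemma Ck_cst V W k (A : set V) (a : W) : Ck k A (cst a : V -> W).
Proof.
elim: k a => [|k IH] a /=; first by move=> x _; exact: cst_continuous.
split=> [x _|v]; first exact: differentiable_cst.
have -> : 'D_v (cst a : V -> W) = cst 0 by apply/funext => x; rewrite derive_cst.
exact: IH.
Qed.

Lemma Ck_linear V W k (A : set V) (f : {linear V -> W}) :
  continuous f -> Ck k A f.
Proof.
move=> cf; case: k => [|k] /=; first by move=> x _; exact: cf.
split=> [x _|v]; first exact: linear_differentiable.
have -> : 'D_v (f : V -> W) = cst (f v).
  by apply/funext => x; rewrite deriveE ?diff_lin//; exact: linear_differentiable.
exact: Ck_cst.
Qed.

Lemma derive_linear_comp U V W (f : {linear V -> W}) (g : U -> V) x v :
  continuous f -> differentiable g x -> 'D_v (f \o g) x = f ('D_v g x).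
Proof.
move=> cf dg; have df := @linear_differentiable _ _ _ f (g x) cf.
rewrite deriveE; last exact: differentiable_comp.
by rewrite diff_comp //= diff_lin // deriveE.
Qed.

Lemma Ck_linear_comp U V W k (A : set U) (f : {linear V -> W}) (g : U -> V) :
  open A -> continuous f -> Ck k A g -> Ck k A (f \o g).
Proof.
move=> oA cf; elim: k g => [|k IH] g /=.
  by move=> cg x Ax; apply: continuous_comp; [exact: cg|exact: cf].
case=> dg Dg; split=> [x Ax|v].
  by apply: differentiable_comp; [exact: dg|exact: linear_differentiable].
apply: Ck_eq (IH _ (Dg v)) => // x; rewrite inE => Ax /=.
by rewrite derive_linear_comp //; exact: dg.
Qed.

Lemma Ck_add V W k (A : set V) (f g : V -> W) : open A ->
  Ck k A f -> Ck k A g -> Ck k A (fun x => f x + g x).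
Proof.
move=> oA; elim: k f g => [|k IH] f g /=.
  by move=> cf cg x Ax; apply: cvgD; [exact: cf|exact: cg].
case=> df Df [dg Dg]; split=> [x Ax|v].
  by apply: differentiableD; [exact: df|exact: dg].
apply: Ck_eq (IH _ _ (Df v) (Dg v)) => // x; rewrite inE => Ax.
by rewrite deriveD //; apply: diff_derivable; [exact: df|exact: dg].
Qed.

Lemma Ck_sum V W k (A : set V) (I : Type) (r : seq I) (P : pred I)
    (F : I -> V -> W) : open A ->
  (forall i, P i -> Ck k A (F i)) -> Ck k A (fun x => \sum_(i <- r | P i) F i x).
Proof.
move=> oA FC; elim: r => [|i r IH].
  by under eq_fun do rewrite big_nil; exact: Ck_cst.
under eq_fun do rewrite big_cons.
by case: (boolP (P i)) => // Pi; apply: Ck_add => //; exact: FC.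
Qed.

Lemma derive_bilin (T U V W : normedModType R) (b : {bilinear U -> V -> W})
    (f : T -> U) (g : T -> V) x v :
  continuous (fun p => b p.1 p.2) -> differentiable f x -> differentiable g x ->
  'D_v (fun x => b (f x) (g x)) x = b ('D_v f x) (g x) + b (f x) ('D_v g x).
Proof.
move=> cb df dg.
have db := @differentiable_bilin _ _ _ _ b (f x, g x) cb.
have dfg := differentiable_pair df dg.
rewrite -[fun x => b (f x) (g x)]/((fun p => b p.1 p.2) \o (fun x => (f x, g x))).
rewrite deriveE; last exact: differentiable_comp.
by rewrite diff_comp //= diff_bilin // diff_pair //= addrC !deriveE.
Qed.

Lemma Ck_bilin (T U V W : normedModType R) k (A : set T) (b : {bilinear U -> V -> W})
    (f : T -> U) (g : T -> V) :
  continuous (fun p => b p.1 p.2) -> open A ->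
  Ck k A f -> Ck k A g -> Ck k A (fun x => b (f x) (g x)).
Proof.
move=> cb oA; elim: k f g => [|k IH] f g.
  move=> cf cg x Ax.
  apply: (@continuous_comp _ _ _ (fun x => (f x, g x)) (fun p => b p.1 p.2)).
    by apply: cvg_pair; [exact: cf|exact: cg].
  exact: cb.
move=> Cf Cg; have [df Df] := Cf; have [dg Dg] := Cg; split=> [x Ax|v].
  apply: (@differentiable_comp _ _ _ _ (fun x => (f x, g x)) (fun p => b p.1 p.2)).
    by apply: differentiable_pair; [exact: df|exact: dg].
  exact: differentiable_bilin.
have Ck' := Ck_add oA (IH _ _ (Df v) (Ck_pred Cg)) (IH _ _ (Ck_pred Cf) (Dg v)).
apply: Ck_eq Ck' => // x; rewrite inE => Ax.
by rewrite derive_bilin //; [exact: df|exact: dg].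
Qed.

Lemma finite_dim_bilin_continuous (U V W : normedModType R)
    (b : {bilinear U -> V -> W}) : finite_dim U -> finite_dim V ->
  continuous (fun p => b p.1 p.2).
Proof.
move=> [n [e [c [cc ce]]]] [n' [e' [c' [cc' ce']]]].
have -> : (fun p => b p.1 p.2) =
    fun p => \sum_i \sum_j (c i p.1 * c' j p.2 : R^o) *: b (e i) (e' j).
  apply/funext => -[u v] /=; rewrite {1}(ce u) linear_sumlz.
  apply: eq_bigr => i _; rewrite {1}(ce' v) linear_sumr; apply: eq_bigr => j _.
  by rewrite linearZl_LR linearZr_LR /= scalerA.
move=> p; apply: cvg_big => [|i _]; first exact: add_continuous.
apply: cvg_big => [|j _]; first exact: add_continuous.
apply: cvgZr_tmp; apply: cvgM.
  by apply: continuous_comp; [exact: cvg_fst|exact: cc].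
by apply: continuous_comp; [exact: cvg_snd|exact: cc'].
Qed.

Fact scale_is_bilinear V : bilinear_for
  (GRing.Scale.Law.clone _ _ *:%R _) (GRing.Scale.Law.clone _ _ *:%R _)
  (fun (a : R^o) (v : V) => a *: v).
Proof.
split=> [v|a] k x y /=; first by rewrite scalerDl scalerA.
by rewrite scalerDr !scalerA mulrC.
Qed.

(** A function of its own, to carry the structure of a bilinear map. *)
Definition scale_fun V (a : R^o) (v : V) : V := a *: v.

HB.instance Definition _ V := bilinear_isBilinear.Build R R^o V V _ _ (@scale_fun V)
  (@scale_is_bilinear V).

Lemma scale_fun_continuous V : continuous (fun p : R^o * V => scale_fun p.1 p.2).
Proof. exact: scale_continuous. Qed.

Lemma derive_scale V W (a : V -> R^o) (f : V -> W) x v :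
  differentiable a x -> differentiable f x ->
  'D_v (fun x => a x *: f x) x = 'D_v a x *: f x + a x *: 'D_v f x.
Proof. exact: (derive_bilin v (@scale_fun_continuous W)). Qed.

Lemma Ck_scale V W k (A : set V) (a : V -> R^o) (f : V -> W) : open A ->
  Ck k A a -> Ck k A f -> Ck k A (fun x => a x *: f x).
Proof. exact: (Ck_bilin (@scale_fun_continuous W)). Qed.

Lemma Ck_mul V k (A : set V) (a b : V -> R^o) : open A ->
  Ck k A a -> Ck k A b -> Ck k A (fun x => a x * b x : R^o).
Proof. exact: Ck_scale. Qed.

Lemma mulmx_continuous p q r :
  continuous (fun z : 'M[R]_(p, q) * 'M[R]_(q, r) => z.1 *m z.2).
Proof. by apply: finite_dim_bilin_continuous; exact: finite_dim_mx. Qed.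

Lemma derive_mulmx V p q r (A : V -> 'M[R]_(p, q)) (B : V -> 'M[R]_(q, r)) x v :
  differentiable A x -> differentiable B x ->
  'D_v (fun x => A x *m B x) x = 'D_v A x *m B x + A x *m 'D_v B x.
Proof. exact/derive_bilin/mulmx_continuous. Qed.

Lemma differentiable_mulmx V p q r (A : V -> 'M[R]_(p, q)) (B : V -> 'M[R]_(q, r)) x :
  differentiable A x -> differentiable B x ->
  differentiable (fun x => A x *m B x) x.
Proof.
move=> dA dB.
apply: (@differentiable_comp _ _ _ _ (fun x => (A x, B x)) (fun p => p.1 *m p.2)).
  exact: differentiable_pair.
exact/differentiable_bilin/mulmx_continuous.
Qed.

Lemma Ck_mulmx V p q r k (U : set V) (A : V -> 'M[R]_(p, q)) (B : V -> 'M[R]_(q, r)) :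
  open U -> Ck k U A -> Ck k U B -> Ck k U (fun x => A x *m B x).
Proof. exact/Ck_bilin/mulmx_continuous. Qed.

Lemma Ck_opp V W k (A : set V) (f : V -> W) : open A ->
  Ck k A f -> Ck k A (fun x => - f x).
Proof.
move=> oA Cf; under eq_fun do rewrite -scaleN1r.
by apply: Ck_scale => //; exact: (@Ck_cst _ R^o).
Qed.

Lemma Ck_sub_fun V W k (A : set V) (f g : V -> W) : open A ->
  Ck k A f -> Ck k A g -> Ck k A (fun x => f x - g x).
Proof. by move=> oA Cf Cg; apply: Ck_add => //; exact: Ck_opp. Qed.

Lemma Ck_coord V p q k (A : set V) (M : V -> 'M[R]_(p, q)) i j : open A ->
  Ck k A M -> Ck k A (fun x => M x i j : R^o).
Proof. by move=> oA; apply: (Ck_linear_comp oA (@mx_coord_continuous _ p q i j)). Qed.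

Lemma Ck_mx V p q k (A : set V) (M : V -> 'M[R]_(p, q)) : open A ->
  (forall i j, Ck k A (fun x => M x i j : R^o)) -> Ck k A M.
Proof.
move=> oA CM.
have -> : M = fun x => \sum_i \sum_j (M x i j : R^o) *: delta_mx i j.
  by apply/funext => x; rewrite {1}(matrix_sum_delta (M x)).
apply: Ck_sum => // i _; apply: Ck_sum => // j _.
by apply: Ck_scale; [|exact: CM|exact: Ck_cst].
Qed.

Lemma Ck_prod V k (A : set V) (I : Type) (r : seq I) (F : I -> V -> R^o) : open A ->
  (forall i, Ck k A (F i)) -> Ck k A (fun x => \prod_(i <- r) F i x : R^o).
Proof.
move=> oA FC; elim: r => [|i r IH].
  by under eq_fun do rewrite big_nil; exact: Ck_cst.
by under eq_fun do rewrite big_cons; apply: Ck_mul.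
Qed.

Lemma Ck_det V n k (A : set V) (M : V -> 'M[R]_n) : open A ->
  Ck k A M -> Ck k A (fun x => \det (M x) : R^o).
Proof.
move=> oA CM; apply: Ck_sum => // s _; apply: Ck_mul => //; first exact: Ck_cst.
by apply: Ck_prod => // i; exact: Ck_coord.
Qed.

Lemma Ck_inv V k (A : set V) (a : V -> R^o) : open A ->
  (forall x, A x -> a x != 0) -> Ck k A a -> Ck k A (fun x => (a x)^-1 : R^o).
Proof.
move=> oA a0; elim: k a a0 => [|k IH] a a0.
  by move=> ca x Ax; apply: cvgV; [exact: a0|exact: ca].
move=> Ca; have [da Da] := Ca; split=> [x Ax|v].
  by apply: differentiableV; [exact: da|exact: a0].
have Ci := IH a a0 (Ck_pred Ca).
apply: Ck_eq (Ck_opp oA (Ck_mul oA (Ck_mul oA Ci Ci) (Da v))) => // x.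
rewrite inE => Ax; rewrite deriveV //; first last.
- exact/diff_derivable/da.
- exact: a0.
by rewrite scaleNr -exprVn expr2.
Qed.

Lemma Ck_invmx V n k (A : set V) (M : V -> 'M[R]_n) : open A ->
  (forall x, A x -> M x \in unitmx) -> Ck k A M -> Ck k A (fun x => invmx (M x)).
Proof.
move=> oA uM CM.
have CA : Ck k A (fun x => (\det (M x))^-1 *: \adj (M x)).
  apply: Ck_scale => //.
    apply: Ck_inv => //; last exact: Ck_det.
    by move=> x /uM; rewrite unitmxE unitfE.
  apply: Ck_mx => // i j; under eq_fun do rewrite mxE /cofactor.
  apply: Ck_mul => //; first exact: Ck_cst.
  apply: Ck_det => //; apply: Ck_mx => // i' j'.
  by under eq_fun do rewrite !mxE; exact: Ck_coord.
by apply: Ck_eq CA => // x; rewrite inE => /uM Mu; rewrite /invmx Mu.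
Qed.

Lemma Ck_trmx V p q k (A : set V) (M : V -> 'M[R]_(p, q)) : open A ->
  Ck k A M -> Ck k A (fun x => (M x)^T).
Proof.
move=> oA CM; apply: Ck_mx => // i j.
by under eq_fun do rewrite mxE; exact: Ck_coord.
Qed.

(** By linearity the derivative in the variable direction [q x] is a combination
    of the derivatives in finitely many fixed directions. *)
Lemma Ck_derive_along U V W k (A : set V) (B : set U) (f : V -> W) (p q : U -> V) :
  finite_dim V -> open B -> (forall x, B x -> A (p x)) ->
  (forall v, Ck k B (fun x => 'D_v f (p x))) ->
  (forall x, A x -> differentiable f x) ->
  Ck k B q -> Ck k B (fun x => 'D_(q x) f (p x)).
Proof.
move=> [n [e [c [cc ce]]]] oB BA Df df Cq.
have CS : Ck k B (fun x => \sum_i (c i (q x) : R^o) *: 'D_(e i) f (p x)).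
  apply: Ck_sum => // i _; apply: Ck_scale => //.
  exact: (Ck_linear_comp oB (cc i)).
apply: Ck_eq CS => // x; rewrite inE => Bx.
rewrite [in RHS]deriveE; last exact/df/BA.
rewrite [in RHS](ce (q x)) linear_sum; apply: eq_bigr => i _.
by rewrite linearZ deriveE //; exact/df/BA.
Qed.

Lemma Ck_comp U V W k (A : set V) (B : set U) (f : V -> W) (g : U -> V) :
  finite_dim V -> open B -> (forall x, B x -> A (g x)) ->
  Ck k A f -> Ck k B g -> Ck k B (f \o g).
Proof.
move=> fV oB BA; elim: k f g BA => [|k IH] f g BA.
  by move=> cf cg x Bx; apply: continuous_comp; [exact: cg|exact/cf/BA].
move=> Cf Cg; have [df Df] := Cf; have [dg Dg] := Cg; split=> [x Bx|v].
  by apply: differentiable_comp; [exact: dg|exact/df/BA].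
have CD : Ck k B (fun x => 'D_('D_v g x) f (g x)).
  apply: (@Ck_derive_along _ _ _ k A) => //.
    by move=> w; apply: IH (Df w) (Ck_pred Cg).
  exact: Dg.
apply: Ck_eq CD => // x; rewrite inE => Bx.
have dfx := df _ (BA _ Bx); have dgx := dg _ Bx.
rewrite [in RHS]deriveE; last exact: differentiable_comp.
by rewrite diff_comp //= !deriveE.
Qed.

End CkCalculus.

Section Schwarz.
Context {R : realType} {V : normedModType R}.

Lemma is_derive_line (f : V -> R^o) (y a : V) (t : R) :
  differentiable f (t *: a + y) ->
  is_derive t (1 : R) (fun s : R => f (s *: a + y)) ('D_a f (t *: a + y)).
Proof.
move=> df.
have E : (fun h => h^-1 *: (((fun s : R => f (s *: a + y)) \o shift t) (h *: (1 : R))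
                            - f (t *: a + y))) =
         (fun h : R => h^-1 *: ((f \o shift (t *: a + y)) (h *: a) - f (t *: a + y))).
  by apply/funext => h /=; rewrite [h *: 1]mulr1 scalerDl addrA.
split; first by rewrite /derivable E; exact: diff_derivable.
by rewrite /derive E.
Qed.

(** By the mean value theorem the second difference is [h] times an increment of
    [D_a f], which the differentiability of [D_a f] at [x] estimates. *)
Lemma second_difference (f : V -> R^o) (x a b : V) (e : R) : 0 < e ->
  (\near x, differentiable f x) -> differentiable ('D_a f) x ->
  \forall h \near (0 : R)^'+,
    `|f (h *: a + h *: b + x) - f (h *: a + x) - f (h *: b + x) + f x
      - h ^+ 2 * 'D_b ('D_a f) x| <= e * h ^+ 2.
Proof.
move=> e0 nf dg; set g := 'D_a f.
(* [h * N] bounds the sum of the norms of the two increments of the argument of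
   [g] in the estimate [c2]; the term 1 makes [N] positive. *)
pose N := 2 * `|a| + `|b| + 1.
have N0 : 0 < N by rewrite /N -addrA; apply: ltr_wpDl; rewrite ?mulr_ge0 ?ltr_wpDl.
have eN0 : 0 < e / N by rewrite divr_gt0.
have /eqaddoP /(_ _ eN0) gE := diff_locally dg.
have nf0 : \forall v \near (0 : V), differentiable f (v + x).
  by move: nf; rewrite (near_shift 0 x) /=; under [X in X _ -> _]eq_fun do rewrite subr0.
have [r /= r0 rP] : exists2 r : R, 0 < r & forall v : V, `|v| < r ->
    differentiable f (v + x) /\ `|g (v + x) - g x - 'd g x v| <= e / N * `|v|.
  have nb : \forall v \near (0 : V), differentiable f (v + x) /\
      `|('D_a f \o shift x - (cst ('D_a f x) + 'd ('D_a f) x)) v| <= e / N * `|v|.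
    exact: filterI nf0 gE.
  have /nbhs_ballP[r /= r0 rP] := nb.
  exists r => // v vr; have [|? gv] := rP v; first by rewrite -ball_normE /= sub0r normrN.
  by split=> //; move: gv; rewrite !fctE /= opprD addrA.
near=> h.
have h0 : 0 < h by [].
have small (t s : R) : 0 <= t <= h -> 0 <= s <= h -> `|t *: a + s *: b| < r.
  move=> /andP[t0 th] /andP[s0 sh]; apply: (le_lt_trans (ler_normD _ _)).
  rewrite !normrZ (ger0_norm t0) (ger0_norm s0).
  have hN : h * N < r by rewrite -ltr_pdivlMr //; near: h; apply: nbhs_right_lt; exact: divr_gt0.
  apply: le_lt_trans hN.
  have := ler_wpM2r (normr_ge0 a) th; have := ler_wpM2r (normr_ge0 b) sh.
  have := mulr_ge0 (ltW h0) (normr_ge0 a).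
  have -> : h * N = 2 * (h * `|a|) + h * `|b| + h by rewrite /N; ring.
  by move=> ha sb ta; move: h0 ha sb ta; lra.
pose phi (t : R) : R := f (t *: a + (h *: b + x)) - f (t *: a + x).
pose dphi (t : R) : R := g (t *: a + (h *: b + x)) - g (t *: a + x).
have D (t : R) : 0 <= t <= h -> is_derive t (1 : R) phi (dphi t).
  move=> th; apply: is_deriveB; apply: is_derive_line.
    by rewrite addrA; apply: (rP _ (small t h th _)).1; rewrite lexx ltW.
  by rewrite -[t *: a]addr0 -(scale0r b); apply: (rP _ (small t 0 th _)).1; rewrite lexx ltW.
have [||c ch phiE] := @MVT R phi dphi 0 h h0.
- move=> t; rewrite in_itv /= => /andP[t0 th]; apply: D; rewrite !ltW //.
- apply: continuous_in_subspaceT => t; rewrite inE /= in_itv /= => th.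
  by have [dt _] := D t th; apply/differentiable_continuous/derivable1_diffP.
move: ch; rewrite in_itv /= subr0 in phiE * => /andP[c0 ch].
have c1 : 0 <= c <= h by rewrite !ltW.
have -> : f (h *: a + h *: b + x) - f (h *: a + x) - f (h *: b + x) + f x = dphi c * h.
  by rewrite -phiE /phi scale0r !add0r addrA opprB addrA addrAC.
have c2 : `|dphi c - h * 'D_b g x| <= e * h.
  have hh : 0 <= h <= h by rewrite lexx ltW.
  have h00 : 0 <= (0 : R) <= h by rewrite lexx ltW.
  move: (rP _ (small c h c1 hh)).2 (rP _ (small c 0 c1 h00)).2.
  rewrite scale0r !addr0 => P1 P2.
  have -> : dphi c - h * 'D_b g x =
      (g (c *: a + h *: b + x) - g x - 'd g x (c *: a + h *: b))
      - (g (c *: a + x) - g x - 'd g x (c *: a)).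
    have -> : 'd g x (c *: a + h *: b) = 'd g x (c *: a) + h * 'd g x b.
      by rewrite linearD [in X in _ + X]linearZ.
    rewrite /dphi addrA (deriveE b dg).
    have alg (g1 g2 g3 d1 d2 k : R) :
        g1 - g2 - k * d1 = g1 - g3 - (d2 + k * d1) - (g2 - g3 - d2) by ring.
    exact: alg.
  apply: (le_trans (ler_normB _ _)); apply: (le_trans (lerD P1 P2)).
  rewrite -mulrDr mulrAC ler_pdivrMr // mulrAC -[leRHS]mulrA ler_pM2l //.
  apply: (le_trans (lerD (ler_normD _ _) (lexx _))); rewrite !normrZ (gtr0_norm h0).
  rewrite (ger0_norm (ltW c0)).
  have := ler_wpM2r (normr_ge0 a) (ltW ch).
  by rewrite /N; move: (h) h0 => h' h'0; nra.
rewrite expr2 -mulrA [h * (h * _)]mulrC [e * (h * h)]mulrA -mulrBl normrM (gtr0_norm h0).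
by rewrite ler_pM2r.
Unshelve. all: by end_near.
Qed.

(** The second difference is symmetric in [a] and [b]. *)
Lemma schwarz (f : V -> R^o) (x a b : V) :
  (\near x, differentiable f x) -> differentiable ('D_a f) x ->
  differentiable ('D_b f) x -> 'D_b ('D_a f) x = 'D_a ('D_b f) x.
Proof.
move=> nf da db; apply/eqP; rewrite -subr_eq0 -normr_le0.
apply/ler_addgt0Pl => e e0; rewrite addr0.
have e2 : 0 < e / 2 by rewrite divr_gt0.
have S1 := second_difference b e2 nf da.
have S2 := second_difference a e2 nf db.
have [h [h0 [H1 H2]]] := filter_ex (filterI (nbhs_right_gt (0 : R)) (filterI S1 S2)).
rewrite [h *: b + h *: a]addrC in H2.
have h2 : 0 < h ^+ 2 by rewrite exprn_gt0.
rewrite -(ler_pM2r h2) -{1}(gtr0_norm h2) -normrM.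
move: H1 H2; clear -h2.
generalize ('D_b ('D_a f) x : R) ('D_a ('D_b f) x : R) (f (h *: a + h *: b + x) : R)
  (f (h *: a + x) : R) (f (h *: b + x) : R) (f x : R) => D1 D2 f1 f2 f3 f4.
rewrite !ler_norml.
move=> /andP[? ?] /andP[? ?]; apply/andP; split; lra.
Qed.

End Schwarz.

#[local] Opaque derive diff.

Section Smoothness.
Context {R : realType}.
Implicit Types U V W : normedModType R.

Lemma derive_comp U V W (f : U -> V) (g : V -> W) u a :
  differentiable f u -> differentiable g (f u) ->
  'D_a (g \o f) u = 'D_('D_a f u) g (f u).
Proof.
by move=> df dg; rewrite !deriveE //; [rewrite diff_comp | exact: differentiable_comp].
Qed.

Lemma smooth_differentiable V W (A : set V) (f : V -> W) x :
  smooth A f -> A x -> differentiable f x.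
Proof. by move=> sf; have [df _] := sf 1%N; exact: df. Qed.

Lemma smooth_near V W (A : set V) (f : V -> W) x : open A ->
  smooth A f -> A x -> \near x, differentiable f x.
Proof.
move=> oA sf Ax; near=> y; apply: smooth_differentiable sf _.
by near: y; exact: open_nbhs_nbhs.
Unshelve. all: by end_near.
Qed.

Lemma smooth_continuous V W (A : set V) (f : V -> W) x :
  smooth A f -> A x -> {for x, continuous f}.
Proof. by move=> sf Ax; exact: differentiable_continuous (smooth_differentiable sf Ax). Qed.

Lemma smooth_derive V W (A : set V) (f : V -> W) v :
  smooth A f -> smooth A ('D_v f).
Proof. by move=> sf k; have [_ Df] := sf k.+1; exact: Df. Qed.

Lemma smooth_sub V W (A B : set V) (f : V -> W) :
  B `<=` A -> smooth A f -> smooth B f.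
Proof. by move=> BA sf k; exact: Ck_sub (sf k). Qed.

Lemma Ck_linear_mx V W p q k (A : set V) (L : {linear 'M[R]_(p, q) -> W})
    (M : V -> 'M[R]_(p, q)) :
  open A -> Ck k A M -> Ck k A (fun x => L (M x)).
Proof.
move=> oA.
exact: (@Ck_linear_comp _ _ _ _ k A L M oA (finite_dim_continuous (finite_dim_mx p q))).
Qed.

Lemma Ck_row_mx V p q r k (A : set V) (M : V -> 'M[R]_(p, q)) (N : V -> 'M[R]_(p, r)) :
  open A -> Ck k A M -> Ck k A N -> Ck k A (fun x => row_mx (M x) (N x)).
Proof.
move=> oA CM CN; apply: Ck_mx => // i j; under eq_fun do rewrite mxE.
by case: (fintype.split j) => j'; exact: Ck_coord.
Qed.

Lemma Ck_col_mx V p q r k (A : set V) (M : V -> 'M[R]_(p, r)) (N : V -> 'M[R]_(q, r)) :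
  open A -> Ck k A M -> Ck k A N -> Ck k A (fun x => col_mx (M x) (N x)).
Proof.
move=> oA CM CN; apply: Ck_mx => // i j; under eq_fun do rewrite mxE.
by case: (fintype.split i) => i'; exact: Ck_coord.
Qed.

Lemma jacobianE p q (f : 'rV[R]_p -> 'rV[R]_q) u a :
  differentiable f u -> a *m jacobian f u = 'D_a f u.
Proof. by move=> df; rewrite -deriveEjacobian. Qed.

Lemma row_jacobian p q (f : 'rV[R]_p -> 'rV[R]_q) u i :
  differentiable f u -> row i (jacobian f u) = 'D_(delta_mx 0 i) f u.
Proof. by move=> df; rewrite rowE jacobianE. Qed.

Lemma Ck_jacobian p q k (A : set 'rV[R]_p) (f : 'rV[R]_p -> 'rV[R]_q) : open A ->
  Ck k.+1 A f -> Ck k A (jacobian f).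
Proof.
move=> oA [df Df]; apply: Ck_mx => // i j.
apply: Ck_eq (Ck_coord 0 j oA (Df (delta_mx 0 i))) => // x; rewrite inE => Ax.
by rewrite -row_jacobian ?mxE //; exact: df.
Qed.

Lemma smooth_jacobian p q (A : set 'rV[R]_p) (f : 'rV[R]_p -> 'rV[R]_q) : open A ->
  smooth A f -> smooth A (jacobian f).
Proof. by move=> oA sf k; exact: Ck_jacobian. Qed.

Lemma smooth_jet p q j (A : set 'rV[R]_p) (f : 'rV[R]_p -> 'rV[R]_q) : open A ->
  smooth A f -> smooth A (jet j f).
Proof.
move=> oA sf; elim: j => [//|j IH] k; apply: Ck_row_mx => //.
by apply: Ck_linear_mx => //; exact: smooth_jacobian.
Qed.

Lemma smooth_comp U V W (A : set V) (B : set U) (f : V -> W) (g : U -> V) :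
  finite_dim V -> open B -> (forall x, B x -> A (g x)) ->
  smooth A f -> smooth B g -> smooth B (f \o g).
Proof. by move=> fV oB BA sf sg k; exact: Ck_comp (sf k) (sg k). Qed.

Lemma schwarz_mx V p q (f : V -> 'M[R]_(p, q)) (A : set V) x a b : open A ->
  smooth A f -> A x -> 'D_b ('D_a f) x = 'D_a ('D_b f) x.
Proof.
move=> oA sf Ax; apply/matrixP => i j.
have derive_ij (g : V -> 'M[R]_(p, q)) y v : differentiable g y ->
    'D_v g y i j = 'D_v (fun x => g x i j : R^o) y.
  move=> dg; rewrite -[RHS]/('D_v (mx_coord i j \o g) y) derive_linear_comp //.
  exact: mx_coord_continuous.
have coordD v : \near x, 'D_v f x i j = 'D_v (fun x => f x i j : R^o) x.
  near=> y; apply: derive_ij; apply: smooth_differentiable sf _.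
  by near: y; exact: open_nbhs_nbhs.
have sij : smooth A (fun x => f x i j : R^o) by move=> k; exact: Ck_coord.
have dD v : differentiable ('D_v f) x.
  by apply: smooth_differentiable Ax; exact: smooth_derive.
apply: (etrans (derive_ij _ x b (dD a))); apply: (etrans (near_eq_derive b (coordD a))).
apply/esym; apply: (etrans (derive_ij _ x a (dD b))).
apply: (etrans (near_eq_derive a (coordD b))); apply/esym.
apply: (@schwarz _ _ _ x a b (smooth_near oA sij Ax)).
  by apply: smooth_differentiable Ax; exact: smooth_derive.
by apply: smooth_differentiable Ax; exact: smooth_derive.
Unshelve. all: by end_near.
Qed.

End Smoothness.

Section Components.
Context {R : realType}.
Implicit Types U V W : normedModType R.

Lemma smooth_fst U V W (A : set U) (f : U -> (V * W)%type) : open A ->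
  smooth A f -> smooth A (fun x => (f x).1).
Proof.
move=> oA sf k; apply: (@Ck_linear_comp _ _ _ _ k A (fst : {linear (V * W)%type -> V})) => //.
by move=> z; exact: cvg_fst.
Qed.

Lemma smooth_snd U V W (A : set U) (f : U -> (V * W)%type) : open A ->
  smooth A f -> smooth A (fun x => (f x).2).
Proof.
move=> oA sf k; apply: (@Ck_linear_comp _ _ _ _ k A (snd : {linear (V * W)%type -> W})) => //.
by move=> z; exact: cvg_snd.
Qed.

Lemma open_preimage_in (V W : topologicalType) (A : set V) (B : set W) (f : V -> W) :
  open A -> open B -> (forall x, A x -> {for x, continuous f}) ->
  open (A `&` f @^-1` B).
Proof.
rewrite !openE => oA oB cf x [Ax Bfx]; apply: filterI; first exact: oA.
by apply: cf => //; exact: oB.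
Qed.

Lemma open_nonzero V (A : set V) (f : V -> R^o) : open A -> smooth A f ->
  open (A `&` [set x | f x != 0]).
Proof.
move=> oA sf; apply: (@open_preimage_in _ _ _ [set z : R^o | z != 0]) ; first exact: oA.
  exact: open_neq.
by move=> x; exact: smooth_continuous.
Qed.

End Components.

Section DerivativeRules.
Context {R : realType}.
Implicit Types U V W : normedModType R.

Lemma Ck_pair U V W k (A : set U) (f : U -> V) (g : U -> W) : open A ->
  Ck k A f -> Ck k A g -> Ck k A (fun x => (f x, g x)).
Proof.
move=> oA; elim: k f g => [|k IH] f g.
  by move=> cf cg x Ax; apply: cvg_pair; [exact: cf|exact: cg].
move=> [df Df] [dg Dg]; split=> [x Ax|v].
  by apply: differentiable_pair; [exact: df|exact: dg].
apply: Ck_eq (IH _ _ (Df v) (Dg v)) => // x; rewrite inE => Ax.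
have dfx := df x Ax; have dgx := dg x Ax.
by rewrite [RHS]deriveE ?diff_pair // ?deriveE //; exact: differentiable_pair.
Qed.

Lemma derive_pair U V W (f : U -> V) (g : U -> W) u a :
  differentiable f u -> differentiable g u ->
  'D_a (fun x => (f x, g x)) u = ('D_a f u, 'D_a g u).
Proof.
move=> df dg; rewrite deriveE ?diff_pair // ?deriveE //.
exact: differentiable_pair.
Qed.

Lemma derive_linear_mx V W p q (L : {linear 'M[R]_(p, q) -> W}) (M : V -> 'M[R]_(p, q)) x v :
  differentiable M x -> 'D_v (fun x => L (M x)) x = L ('D_v M x).
Proof. exact: (derive_linear_comp _ (finite_dim_continuous (finite_dim_mx p q))). Qed.

Lemma differentiable_linear_mx V W p q (L : {linear 'M[R]_(p, q) -> W})
    (M : V -> 'M[R]_(p, q)) x :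
  differentiable M x -> differentiable (fun x => L (M x)) x.
Proof.
move=> dM; apply: (differentiable_comp dM); apply: linear_differentiable.
exact: (finite_dim_continuous (finite_dim_mx p q)).
Qed.

Lemma derive_linear V W (f : V -> W) x a u v : differentiable f x ->
  'D_(a *: u + v) f x = a *: 'D_u f x + 'D_v f x.
Proof. by move=> df; rewrite !deriveE // linearP. Qed.

Lemma derive_ln V (k : V -> R^o) x v : differentiable k x -> k x != 0 ->
  'D_v (fun x => ln `|k x| : R^o) x = 'D_v k x / k x.
Proof.
move=> dk k0; pose s := Num.sg (k x).
have s0 : 0 < s * k x by rewrite /s -normrEsg normr_gt0.
have dsk : differentiable (s *: k) x by exact: differentiableZ.
have near_s : \near x, ln `|k x| = (@ln R \o (s *: k)) x.
  have : \near x, 0 < s * k x.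
    have cs : {for x, continuous (s *: k)} by exact: differentiable_continuous.
    have nb : nbhs ((s *: k) x) [set z : R | 0 < z].
      by apply: open_nbhs_nbhs; split; [exact: open_gt|exact: s0].
    exact: cs _ nb.
  apply: filterS => y /= sk0; congr ln; rewrite -[LHS](ger0_norm (normr_ge0 _)).
  have s1 : `|s| = 1 by rewrite /s normr_sg k0.
  by rewrite -[RHS]gtr0_norm // normrM s1 mul1r normr_id.
have dln : is_derive (s * k x) (1 : R) (@ln R) (s * k x)^-1 by exact: is_derive1_ln.
have dln' : differentiable (@ln R : R -> R^o) (s * k x).
  by apply/derivable1_diffP; case: dln.
rewrite (near_eq_derive _ near_s) (derive_comp v dsk dln').
rewrite deriveE // -[X in 'd _ _ X]mulr1 [LHS]linearZ -deriveE //.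
rewrite (@derive_val _ _ _ _ _ _ _ dln) deriveZ; last exact: diff_derivable.
have sn0 : s != 0 by rewrite /s sgr_eq0.
have alg (d t l : R) : t != 0 -> l != 0 -> t * d * (t * l)^-1 = d / l.
  by move=> t0 l0; field; rewrite t0 l0.
exact: alg.
Qed.

End DerivativeRules.

(** * The Levi-Civita connection *)

Section LeviCivita.
Context {R : realType} {m : nat}.
Local Notation n := (1 + m + 1)%N.
Implicit Types G : 'rV[R]_n -> 'M[R]_n.

(** The metric at [y] together with the behaviour near [y] on which its
    Christoffel symbols depend. *)
Definition metric_at G (y : 'rV[R]_n) : Prop :=
  [/\ differentiable G y, \near y, (G y)^T = G y & G y \in unitmx].

Definition dmetric G (y : 'rV[R]_n) (l i j : 'I_n) : R :=
  'D_(delta_mx 0 l) (fun z => G z i j : R^o) y.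

Lemma dmetric_sym G y l i j : metric_at G y -> dmetric G y l i j = dmetric G y l j i.
Proof.
case=> _ sG _; apply: near_eq_derive; near=> z.
have sGz : (G z)^T = G z by near: z.
by rewrite -{1}sGz mxE.
Unshelve. all: by end_near.
Qed.

Lemma derive_metric G y v i j : differentiable G y ->
  'D_v G y i j = \sum_l v 0 l * dmetric G y l i j.
Proof.
move=> dG; rewrite derive_mx ?mxE; last exact: diff_derivable.
have dGij : differentiable (fun z => G z i j : R^o) y.
  exact: (differentiable_comp dG (differentiable_coord _ i j)).
rewrite deriveE // {1}(row_sum_delta v) linear_sum.
by apply: eq_bigr => l _; rewrite linearZ -deriveE.
Qed.

Lemma christoffel_sym G y k i j : metric_at G y ->
  christoffel G y k i j = christoffel G y k j i.
Proof.
move=> Gy; congr (_ * _); apply: eq_bigr => l _; congr (_ * _).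
rewrite -!/(dmetric _ _ _ _ _) (dmetric_sym l i j Gy); ring.
Qed.

Lemma connection_mx_linear G y (a : R) v w :
  connection_mx G y (a *: v + w) = a *: connection_mx G y v + connection_mx G y w.
Proof.
apply/matrixP => j k; rewrite !mxE mulr_sumr -big_split /=.
by apply: eq_bigr => i _; rewrite !mxE; ring.
Qed.

Lemma connection_mx_sym G y v w : metric_at G y ->
  w *m connection_mx G y v = v *m connection_mx G y w.
Proof.
move=> Gy; apply/rowP => k; rewrite !mxE.
under eq_bigr do rewrite mxE mulr_sumr.
under [RHS]eq_bigr do rewrite mxE mulr_sumr.
rewrite exchange_big; apply: eq_bigr => i _; apply: eq_bigr => j _.
by rewrite (christoffel_sym k i j Gy); ring.
Qed.

(** Lowering the index of the Christoffel symbols cancels the inverse metric. *)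
Lemma connection_mx_lower G y v j l : metric_at G y ->
  (connection_mx G y v *m G y) j l = 2^-1 * \sum_i v 0 i *
    (dmetric G y i j l + dmetric G y j i l - dmetric G y l i j).
Proof.
move=> Gy; have [_ sG uG] := Gy.
have sym : (G y)^T = G y := nbhs_singleton sG.
pose t := \matrix_(j, l) (2^-1 * \sum_i v 0 i *
    (dmetric G y i j l + dmetric G y j i l - dmetric G y l i j)) : 'M[R]_n.
have -> : connection_mx G y v = t *m (invmx (G y))^T.
  apply/matrixP => j' k; rewrite !mxE.
  under [RHS]eq_bigr do rewrite !mxE mulr_sumr mulr_suml.
  rewrite exchange_big; apply: eq_bigr => i _.
  rewrite /christoffel !mulr_sumr; apply: eq_bigr => l' _.
  by rewrite -!/(dmetric _ _ _ _ _); ring.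
by rewrite trmx_inv sym -mulmxA mulVmx // mulmx1 mxE.
Qed.

(** Symmetrizing [connection_mx_lower] in [j] and [l] leaves one derivative of the
    metric. *)
Lemma metric_compatible G y v : metric_at G y ->
  'D_v G y = connection_mx G y v *m G y + (connection_mx G y v *m G y)^T.
Proof.
move=> Gy; have [dG _ _] := Gy; apply/matrixP => j l.
rewrite derive_metric // [RHS]mxE [(_^T) _ _]mxE !connection_mx_lower //.
rewrite -mulrDr -big_split mulr_sumr; apply: eq_bigr => i _ /=.
rewrite (dmetric_sym i l j Gy) (dmetric_sym l i j Gy) (dmetric_sym j i l Gy).
by field.
Qed.

Section Covariant.
Context {V : normedModType R}.
Implicit Types (r : V -> 'rV[R]_n) (u a : V).

(** The covariant derivative in the direction [a] of fields of vectors along the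
    map [r], given by the rows of [X]. *)
Definition covariant p G r (X : V -> 'M[R]_(p, n)) u a : 'M[R]_(p, n) :=
  'D_a X u + X u *m connection_mx G (r u) ('D_a r u).

Lemma derive_inner p q G r (X : V -> 'M[R]_(p, n)) (Y : V -> 'M[R]_(q, n)) u a :
  metric_at G (r u) -> differentiable r u -> differentiable X u -> differentiable Y u ->
  'D_a (fun u => X u *m G (r u) *m (Y u)^T) u =
    covariant G r X u a *m G (r u) *m (Y u)^T +
    X u *m G (r u) *m (covariant G r Y u a)^T.
Proof.
move=> Gu dr dX dY; have [dG sG _] := Gu.
have trc : continuous (trmx : 'M[R]_(q, n) -> _).
  exact: (finite_dim_continuous (finite_dim_mx _ _)).
have dYT : differentiable (fun u => (Y u)^T) u.
  exact: (differentiable_comp dY (linear_differentiable _ trc)).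
have dGr : differentiable (G \o r) u by exact: differentiable_comp.
rewrite derive_mulmx //; last exact: (differentiable_mulmx dX dGr).
rewrite (derive_mulmx _ dX dGr) (derive_comp a dr dG).
rewrite -[fun x => (Y x)^T]/(trmx \o Y) derive_linear_comp //=.
rewrite metric_compatible // [(_ *m G _)^T]trmx_mul (nbhs_singleton sG).
rewrite /covariant [(_ + _)^T]linearD /= trmx_mul !(mulmxDl, mulmxDr) !mulmxA.
by rewrite -!addrA; congr (_ + (_ + _)); rewrite addrC.
Qed.

(** The connection has no torsion, and the second derivatives of [r] commute. *)
Lemma covariant_sym G r (A : set V) u a b : metric_at G (r u) -> open A ->
  smooth A r -> A u -> covariant G r ('D_b r) u a = covariant G r ('D_a r) u b.
Proof.
move=> Gu oA sr Au; rewrite /covariant (schwarz_mx _ _ oA sr Au).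
by rewrite (connection_mx_sym _ _ Gu).
Qed.

Lemma covariant_linear p G r (X : V -> 'M[R]_(p, n)) u (a : R) v w :
  differentiable r u -> differentiable X u ->
  covariant G r X u (a *: v + w) = a *: covariant G r X u v + covariant G r X u w.
Proof.
move=> dr dX; rewrite /covariant !derive_linear // connection_mx_linear.
by rewrite mulmxDr -scalemxAr scalerDr addrACA.
Qed.

Lemma covariant_near p G r s (X Y : V -> 'M[R]_(p, n)) u a :
  (\near u, r u = s u) -> (\near u, X u = Y u) ->
  covariant G r X u a = covariant G s Y u a.
Proof.
move=> rs XY; rewrite /covariant (near_eq_derive a rs) (near_eq_derive a XY).
by rewrite (nbhs_singleton rs) (nbhs_singleton XY).
Qed.

End Covariant.

(** A trilinear form symmetric in its first two arguments and skew in its last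
    two vanishes: the uniqueness half of the fundamental theorem of Riemannian
    geometry. *)
Lemma koszul_unique (S : 'rV[R]_n -> 'M[R]_n) :
  (forall v w, w *m S v = v *m S w) -> (forall v, S v + (S v)^T = 0) ->
  forall v, S v = 0.
Proof.
move=> symS skewS v.
pose s (v w z : 'rV[R]_n) : R := (w *m S v *m z^T) 0 0.
have s12 u w z : s u w z = s w u z by rewrite /s symS.
have s23 u w z : s u w z = - s u z w.
  have skew : (S u)^T = - S u by apply/eqP; rewrite -addr_eq0 addrC skewS.
  have tr11 (B : 'M[R]_1) : B 0 0 = B^T 0 0 by rewrite mxE.
  by rewrite /s tr11 !trmx_mul trmxK skew mulmxA mulmxN mulNmx mxE.
have s0 u w z : s u w z = 0.
  have E : s u w z = - s u w z.
    by rewrite {1}s12 s23 s12 s23 opprK s12 s23.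
  by apply/eqP; rewrite -[_ == 0](mulrn_eq0 _ 2) mulr2n {1}E addNr.
apply/matrixP => i j; rewrite mxE; have := s0 v (delta_mx 0 i) (delta_mx 0 j).
by rewrite /s -rowE trmx_delta -colE !mxE.
Qed.

(** The transformation law of the Levi-Civita connection. The difference [T] of
    the two sides, with its last index lowered by the metric, is symmetric in its
    first two arguments because both connections are without torsion, and skew in
    its last two because both are compatible with the metrics. *)
Lemma connection_mx_isometry G G' (phi : 'rV[R]_n -> 'rV[R]_n) (A : set 'rV[R]_n) y v :
  open A -> A y -> smooth A phi ->
  (forall z, A z -> G z = jacobian phi z *m G' (phi z) *m (jacobian phi z)^T) ->
  metric_at G y -> metric_at G' (phi y) ->
  covariant G' phi (jacobian phi) y v = connection_mx G y v *m jacobian phi y.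
Proof.
move=> oA Ay sphi isoG Gy Gy'; set P := jacobian phi.
have sP : smooth A P by exact: smooth_jacobian.
have dP : differentiable P y := smooth_differentiable sP Ay.
have dphi : differentiable phi y := smooth_differentiable sphi Ay.
have [_ /nbhs_singleton symG uG] := Gy; have [_ /nbhs_singleton symG' uG'] := Gy'.
have uP : P y \in unitmx.
  by move: uG; rewrite (isoG _ Ay) -mulmxA unitmx_mul => /andP[].
pose N w := covariant G' phi P y w.
pose T w := N w - connection_mx G y w *m P y.
have mulN u w : u *m N w = covariant G' phi ('D_u phi) y w.
  have uP' : \near y, u *m P y = 'D_u phi y.
    near=> z; apply: jacobianE; apply: smooth_differentiable sphi _.
    by near: z; exact: open_nbhs_nbhs.
  rewrite /N /covariant mulmxDr mulmxA (nbhs_singleton uP'); congr (_ + _).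
  rewrite -(near_eq_derive w uP') (derive_mulmx _ (differentiable_cst u y) dP).
  by rewrite derive_cst mul0mx add0r.
have dG w : 'D_w G y = N w *m G' (phi y) *m (P y)^T + P y *m G' (phi y) *m (N w)^T.
  rewrite -(derive_inner (V := 'rV[R]_n) w Gy' dphi dP dP).
  apply: near_eq_derive; near=> z; apply: isoG.
  by near: z; exact: open_nbhs_nbhs.
have T0 w : T w *m G' (phi y) *m (P y)^T = 0.
  pose S w := T w *m G' (phi y) *m (P y)^T.
  have SE u : S u = N u *m G' (phi y) *m (P y)^T - connection_mx G y u *m G y.
    by rewrite /S /T !mulmxBl (isoG _ Ay) !mulmxA.
  apply: (@koszul_unique S) => [u z|u].
    have E : z *m T u = u *m T z.
      rewrite /T !mulmxBr !mulmxA !mulN (connection_mx_sym u z Gy).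
      by rewrite (covariant_sym z u Gy' oA sphi Ay).
    by rewrite /S !mulmxA E.
  rewrite SE [(_ - _)^T]linearB /= addrACA -opprD -metric_compatible // dG.
  by rewrite !trmx_mul trmxK symG' !mulmxA subrr.
apply/eqP; rewrite -subr_eq0 -/(N v) -/(T v); apply/eqP.
have := T0 v; rewrite -mulmxA => /(congr1 (mulmx^~ (invmx (G' (phi y) *m (P y)^T)))).
by rewrite mulmxK ?mul0mx // unitmx_mul uG' unitmx_tr.
Unshelve. all: by end_near.
Qed.

(** The chain rule and the product rule reduce this to [connection_mx_isometry]. *)
Lemma covariant_isometry (V : normedModType R) p G G' (phi : 'rV[R]_n -> 'rV[R]_n)
    (A : set 'rV[R]_n) (r : V -> 'rV[R]_n) (X : V -> 'M[R]_(p, n)) u a :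
  open A -> A (r u) -> smooth A phi ->
  (forall z, A z -> G z = jacobian phi z *m G' (phi z) *m (jacobian phi z)^T) ->
  metric_at G (r u) -> metric_at G' (phi (r u)) ->
  differentiable r u -> differentiable X u ->
  covariant G' (phi \o r) (fun w => X w *m jacobian phi (r w)) u a =
    covariant G r X u a *m jacobian phi (r u).
Proof.
move=> oA Au sphi isoG Gu Gu' dr dX.
have dphi := smooth_differentiable sphi Au.
have dP := smooth_differentiable (smooth_jacobian oA sphi) Au.
have dPr : differentiable (jacobian phi \o r) u by exact: differentiable_comp.
rewrite /covariant (derive_mulmx _ dX dPr) (derive_comp a dr dP) (derive_comp a dr dphi) /=.
rewrite mulmxDl -(mulmxA _ (connection_mx _ _ _)).
rewrite -(connection_mx_isometry _ oA Au sphi isoG Gu Gu').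
by rewrite /covariant mulmxDr !mulmxA !addrA.
Qed.

Lemma covariant_reparam (U V : normedModType R) p G (psi : U -> V)
    (r : V -> 'rV[R]_n) (X : V -> 'M[R]_(p, n)) u a :
  differentiable psi u -> differentiable r (psi u) -> differentiable X (psi u) ->
  covariant G (r \o psi) (X \o psi) u a = covariant G r X (psi u) ('D_a psi u).
Proof.
by move=> dpsi dr dX; rewrite /covariant (derive_comp a dpsi dr) (derive_comp a dpsi dX).
Qed.

End LeviCivita.

(** * Lightlike hyperplanes of a Lorentzian vector space *)

Section Euclidean.
Context {R : realType}.

Lemma sqnormE n (v : 'rV[R]_n) : (v *m v^T) 0 0 = \sum_i v 0 i ^+ 2.
Proof. by rewrite mxE; apply: eq_bigr => i _; rewrite mxE expr2. Qed.

Lemma sqnorm_gt0 n (v : 'rV[R]_n) : v != 0 -> 0 < (v *m v^T) 0 0.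
Proof.
move=> v0; rewrite sqnormE lt_def sumr_ge0 ?andbT => [|i _]; last exact: sqr_ge0.
apply: contra v0 => /eqP s0; apply/eqP/rowP => i; rewrite mxE.
have /allP/(_ i) : all (fun i => v 0 i ^+ 2 == 0) (index_enum 'I_n).
  by rewrite -(@psumr_eq0 R _ _ predT) ?s0 // => j _; exact: sqr_ge0.
by rewrite mem_index_enum sqrf_eq0 => /(_ isT)/eqP.
Qed.

Lemma sqnorm_neq0 n (v : 'rV[R]_n) : v != 0 -> (v *m v^T) 0 0 != 0.
Proof. by move=> /sqnorm_gt0 v0; rewrite gt_eqF. Qed.

(** The coordinate inner product, unlike the metric, is definite on every
    subspace; so it gives smooth formulas for the coordinates in a basis. *)
Lemma gram_unit p n (T : 'M[R]_(p, n)) : row_free T -> T *m T^T \in unitmx.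
Proof.
move=> fT; rewrite -row_free_unit -kermx_eq0; apply/eqP/row_matrixP => i.
rewrite row0; set x := row i _.
have xT : x *m (T *m T^T) = 0 by rewrite /x -row_mul mulmx_ker row0.
have xT0 : x *m T == 0.
  apply: contraT => /sqnorm_gt0.
  by rewrite trmx_mul !mulmxA -(mulmxA x) xT mul0mx mxE ltxx.
by apply: (row_free_inj fT); rewrite (eqP xT0) mul0mx.
Qed.

(** The least squares solution [a] of [a *m T = v]: the coordinates of [v] in the
    basis [T] when there are such. *)
Definition pull p n (T : 'M[R]_(p, n)) (v : 'rV[R]_n) : 'rV[R]_p :=
  v *m T^T *m invmx (T *m T^T).

Lemma pull_mulmx p n (T : 'M[R]_(p, n)) a : row_free T -> pull T (a *m T) = a.
Proof. by move=> fT; rewrite /pull -(mulmxA a) mulmxK // gram_unit. Qed.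

Lemma mulmx_pull p n (T : 'M[R]_(p, n)) v : row_free T -> (v <= T)%MS ->
  pull T v *m T = v.
Proof. by move=> fT /submxP[a ->]; rewrite pull_mulmx. Qed.

End Euclidean.

Section InnerProduct.
Context {R : realType} {k : nat}.
Implicit Types (G : 'M[R]_k) (u v w : 'rV[R]_k).

Lemma ipDl G u v w : ip G (u + v) w = ip G u w + ip G v w.
Proof. by rewrite /ip !mulmxDl mxE. Qed.

Lemma ipZl G a v w : ip G (a *: v) w = a * ip G v w.
Proof. by rewrite /ip -!scalemxAl mxE. Qed.

Lemma ipDr G u v w : ip G w (u + v) = ip G w u + ip G w v.
Proof. by rewrite /ip linearD /= mulmxDr mxE. Qed.

Lemma ipZr G a v w : ip G w (a *: v) = a * ip G w v.
Proof. by rewrite /ip linearZ /= -scalemxAr mxE. Qed.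

Lemma tr_scalar11 (B : 'M[R]_1) : B^T = B.
Proof. by apply/matrixP => i j; rewrite mxE !ord1. Qed.

Lemma ipC G v w : G^T = G -> ip G v w = ip G w v.
Proof.
by move=> sG; rewrite /ip -[v *m G *m w^T]tr_scalar11 !trmx_mul trmxK sG mulmxA.
Qed.

End InnerProduct.

Section Lorentz.
Context {R : realType} {m : nat}.
Local Notation n := (1 + m + 1)%N.
Implicit Types (G : 'M[R]_n) (v w e : 'rV[R]_n).

Lemma lorentzianP G : lorentzian G -> exists2 P : 'M[R]_n, P \in unitmx &
  forall v w, ip G v w =
    (lsubmx (v *m P) *m (lsubmx (w *m P))^T) 0 0 - rsubmx (v *m P) 0 0 * rsubmx (w *m P) 0 0.
Proof.
case=> Q uQ QG; exists (invmx Q); first by rewrite unitmx_inv.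
move=> v w.
have -> : G = invmx Q *m block_mx (1%:M : 'M[R]_(1 + m)) 0 0 (-1)%:M *m (invmx Q)^T.
  by rewrite -QG !mulmxA mulVmx // mul1mx -mulmxA trmx_inv mulmxV ?unitmx_tr // mulmx1.
rewrite /ip !mulmxA -[_ *m w^T]mulmxA -trmx_mul.
set a := v *m _; set b := w *m _.
rewrite -{1}(hsubmxK a) -{1}(hsubmxK b) tr_row_mx mul_row_block !mulmx0 addr0 add0r.
rewrite mulmx1 mul_row_col mxE; congr (_ + _).
by rewrite mul_mx_scalar scaleN1r mulNmx mxE [_ *m _]mx11_scalar !mxE big_ord1 !mxE mulr1n.
Qed.

Lemma lorentzian_unit G : lorentzian G -> G \in unitmx.
Proof.
case=> P uP PG.
have : P *m G *m P^T \in unitmx.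
  rewrite PG unitmxE det_ublock det1 mul1r det_scalar expr1 unitfE.
  by rewrite oppr_eq0 oner_eq0.
by rewrite !unitmx_mul => /andP[/andP[]].
Qed.

Lemma lorentzian_sym G : lorentzian G -> G^T = G.
Proof.
case=> P uP PG; have E : (P *m G *m P^T)^T = P *m G *m P^T.
  by rewrite PG tr_block_mx !tr_scalar_mx !trmx0.
move: E; rewrite !trmx_mul trmxK mulmxA => /(can_inj (mulmxK _)).
rewrite unitmx_tr => /(_ uP) /(congr1 (mulmx (invmx P))).
by rewrite !mulKmx.
Qed.

(** A vector orthogonal to a null vector is spacelike or proportional to it:
    subtracting the multiple of the null vector with the same time component
    does not change its square and makes it purely spatial. *)
Lemma lorentzian_orthogonal G e v : lorentzian G -> e != 0 ->
  ip G e e = 0 -> ip G e v = 0 -> (exists k, v = k *: e) \/ 0 < ip G v v.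
Proof.
move=> lG e0 ee ev; have sG := lorentzian_sym lG.
have [P uP ipE] := lorentzianP lG.
have inj x : lsubmx (x *m P) = 0 -> rsubmx (x *m P) = 0 -> x = 0.
  move=> xl xr; have : x *m P = 0 by rewrite -[x *m P]hsubmxK xl xr row_mx0.
  by move=> /(congr1 (mulmx^~ (invmx P))); rewrite mulmxK // mul0mx.
pose s := rsubmx (e *m P) 0 0.
have s0 : s != 0.
  apply: contra e0 => /eqP s0; apply/eqP/inj.
    apply/eqP; apply: contraT => /sqnorm_gt0; have := ee.
    by rewrite ipE -/s s0 mulr0 subr0 => ->; rewrite ltxx.
  by rewrite [rsubmx _]mx11_scalar -/s s0 -scalemx1 scale0r.
pose k := rsubmx (v *m P) 0 0 / s; pose w := v - k *: e.
have wt : rsubmx (w *m P) = 0.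
  rewrite /w mulmxBl -scalemxAl linearB linearZ /= [rsubmx (v *m P)]mx11_scalar.
  rewrite [rsubmx (e *m P)]mx11_scalar -/s scale_scalar_mx /k divfK // subrr.
  by [].
have ww : ip G w w = ip G v v.
  rewrite /w -scaleNr ipDl !ipDr !ipZl !ipZr (ipC v e sG) ee ev; ring.
have := ipE w w; rewrite wt ww [X in _ - X * _]mxE mul0r subr0 => vv.
have [w0|w0] := eqVneq (lsubmx (w *m P)) 0.
  by left; exists k; apply/eqP; rewrite -subr_eq0 -/w; apply/eqP; exact: inj.
by right; rewrite vv; exact: sqnorm_gt0.
Qed.

(** The data of a lightlike hypersurface at a point: the metric and a basis
    of the tangent space, on which the metric degenerates. *)
Definition lightlike_at G (T : 'M[R]_(1 + m, n)) : Prop :=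
  [/\ lorentzian G, \rank T = (1 + m)%N & \rank (T *m G *m T^T) = m].

Definition null_tangent G (T : 'M[R]_(1 + m, n)) e : Prop :=
  [/\ e != 0, (e <= T)%MS & ip G e e = 0].

Lemma lightlike_row_free G T : lightlike_at G T -> row_free T.
Proof. by case=> _ rT _; rewrite /row_free rT. Qed.

(** The kernel of the degenerate metric on the tangent space contains a vector
    [f], which is null; a null tangent vector, being orthogonal to [f], is
    proportional to it. *)
Lemma null_tangent_orthogonal G T e : lightlike_at G T -> null_tangent G T e ->
  T *m G *m e^T = 0.
Proof.
move=> GT [e0 eT ee]; have [lG rT rG] := GT; have sG := lorentzian_sym lG.
have [f f0 [fT fTG]] : exists2 f : 'rV[R]_n, f != 0 & (f <= T)%MS /\ T *m G *m f^T = 0.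
  have : kermx (T *m G *m T^T) != 0.
    by rewrite -mxrank_eq0 mxrank_ker rG addnK.
  move=> /rowV0Pn[a /sub_kermxP aK a0]; exists (a *m T).
    by rewrite mulmx_free_eq0 ?(lightlike_row_free GT).
  split; first exact: submxMl.
  apply: trmx_inj; rewrite trmx_mul trmxK trmx_mul sG trmx0.
  by move: aK; rewrite !mulmxA.
have perp v : (v <= T)%MS -> ip G v f = 0.
  by move=> /submxP[a ->]; rewrite /ip -!mulmxA (mulmxA T) fTG mulmx0 mxE.
have fe : ip G f e = 0 by rewrite (ipC _ _ sG); exact: perp.
have [[k ek]|] := lorentzian_orthogonal lG f0 (perp _ fT) fe.
  by rewrite ek linearZ /= -scalemxAr fTG scaler0.
by rewrite ee ltxx.
Qed.

(** The orthogonal complement of a hyperplane is a line. *)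
Lemma orthogonal_null_tangent G T e v : lightlike_at G T -> null_tangent G T e ->
  T *m G *m v^T = 0 -> exists k, v = k *: e.
Proof.
move=> GT eG; have Te := null_tangent_orthogonal GT eG; case: eG => e0 _ _.
have [lG rT _] := GT; have sG := lorentzian_sym lG.
have kerP w : T *m G *m w^T = 0 -> (w <= kermx (G *m T^T))%MS.
  move=> Tw; apply/sub_kermxP; have := congr1 trmx Tw.
  by rewrite !trmx_mul trmxK sG trmx0 mulmxA => <-.
move=> Tv; apply/sub_rVP; apply: submx_trans (kerP _ Tv) _.
have rk : \rank (kermx (G *m T^T)) = 1%N.
  rewrite mxrank_ker -mxrank_tr trmx_mul trmxK sG.
  by rewrite mxrankMfree ?rT ?addKn ?row_free_unit ?lorentzian_unit.
by rewrite -(mxrank_leqif_sup (kerP _ Te)) rk rank_rV e0.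
Qed.

Lemma null_tangent_unique G T e f : lightlike_at G T -> null_tangent G T e ->
  null_tangent G T f -> exists2 k, k != 0 & f = k *: e.
Proof.
move=> GT eG fG; have [k fe] := orthogonal_null_tangent GT eG (null_tangent_orthogonal GT fG).
exists k => //; case: fG => f0 _ _; apply: contra f0 => /eqP k0.
by rewrite fe k0 scale0r.
Qed.

Lemma null_tangent_scale G T e k : k != 0 -> null_tangent G T e ->
  null_tangent G T (k *: e).
Proof.
move=> k0 [e0 eT ee]; split; first by rewrite scaler_eq0 negb_or k0.
  exact: scalemx_sub.
by rewrite ipZl ipZr ee !mulr0.
Qed.

End Lorentz.

(** * The null field of an invariant of weight 1 *)

Section Charts.
Context {R : realType}.

Context {p q : nat} (M : manifold R p) (N : manifold R q) (f : M -> N)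
  (b : chart R M p) (c : chart R N q).

Lemma local_domP u : local_dom f b c u ->
  [/\ cdom b (cinv b u), cdom c (f (cinv b u)) & cmap b (cinv b u) = u].
Proof. by case=> x [bx cfx] <-; rewrite cmapK. Qed.

Lemma local_dom_cmap x : cdom b x -> cdom c (f x) -> local_dom f b c (cmap b x).
Proof. by move=> bx cfx; exists x. Qed.

Lemma local_dom_open : continuous f -> open (local_dom f b c).
Proof.
move=> cf.
have -> : local_dom f b c =
    (cmap b @` cdom b) `&` cinv b @^-1` (cdom b `&` f @^-1` cdom c).
  apply/seteqP; split=> [_ [x [bx cfx] <-]|u [[x bx <-]]] /=.
    by rewrite cmapK //; split=> //; exists x.
  by rewrite cmapK // => -[_ cfx]; exists x.
apply: open_preimage_in => [||_ [x bx <-]]; first exact: cimg_open.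
  apply: openI; first exact: cdom_open.
  by apply: open_comp; [move=> x _; exact: cf|exact: cdom_open].
exact: cinv_continuous.
Qed.

End Charts.

Section Hypersurface.
Context {R : realType} {m : nat}.
Implicit Types H : lightlike R m.
Local Notation n := (1 + m + 1)%N.
Local Notation hchart H := (chart R (hyp H) (1 + m)).
Local Notation achart H := (chart R (amb H) n).

Definition dom H (b : hchart H) (c : achart H) : set 'rV[R]_(1 + m) :=
  local_dom (@imm _ _ H) b c.

Lemma dom_open H (b : hchart H) (c : achart H) : open (dom b c).
Proof. by apply: local_dom_open; have [] := imm_smooth H. Qed.

Context (H : lightlike R m) (b : hchart H) (c : achart H).
Hypotheses (hb : atlas b) (hc : atlas c).

Lemma coords_dom x : coords x b c -> dom b c (cmap b x).
Proof. by case=> -[_ bx] [_ cx]; exact: local_dom_cmap. Qed.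

Lemma dom_coords u : dom b c u -> coords (cinv b u) b c.
Proof. by move=> /local_domP[bu cu _]; split; split. Qed.

Lemma dom_cmap u : dom b c u -> cmap b (cinv b u) = u.
Proof. by case/local_domP. Qed.

Lemma param_smooth : smooth (dom b c) (param b c).
Proof. by have [_ sm] := imm_smooth H; exact: sm. Qed.

Lemma param_dom u : dom b c u -> (cmap c @` cdom c) (param b c u).
Proof. by move=> /local_domP[_ cu _]; exists (imm (cinv b u)). Qed.

Lemma gmx_metric_at y : (cmap c @` cdom c) y -> metric_at (gmx (met H) c) y.
Proof.
move=> [z cz zy]; split; last 1 first.
- by rewrite -zy; apply/lorentzian_unit/gmx_lorentz.
- by apply: smooth_differentiable (gmx_smooth (met H) hc) _; exists z.
near=> w; have [z' cz' <-] : (cmap c @` cdom c) w.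
  near: w; apply: open_nbhs_nbhs; split; first exact: cimg_open.
  by exists z.
exact: gmx_sym.
Unshelve. all: by end_near.
Qed.

Lemma dom_metric_at u : dom b c u -> metric_at (gmx (met H) c) (param b c u).
Proof. by move=> /param_dom/gmx_metric_at. Qed.

Lemma dom_lightlike_at u : dom b c u -> lightlike_at (gram b c u) (tanmx b c u).
Proof.
move=> du; have [bx cx] := dom_coords du; have E := dom_cmap du.
split; first exact: gmx_lorentz cx.
  by rewrite /tanmx -E; exact: imm_immersion.
by have := imm_lightlike bx cx; rewrite E.
Qed.

Lemma dom_near u : dom b c u -> \near u, dom b c u.
Proof. by move=> du; apply: open_nbhs_nbhs; split=> //; exact: dom_open. Qed.

Lemma tanmxE u a : dom b c u -> a *m tanmx b c u = 'D_a (param b c) u.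
Proof.
by move=> du; apply: jacobianE; apply: smooth_differentiable du; exact: param_smooth.
Qed.

(** For an invariant of weight 1 that does not vanish, [e / I e] does not depend on
    the choice of the null vector [e]. *)
Definition null_field (I : scalar_rule R m) u : 'rV[R]_n :=
  let e := xget 0 (isotropic_tangent b c u) in (I H (cinv b u) c e)^-1 *: e.

Context (I : scalar_rule R m).
Hypotheses (relI : relative_invariant1 I) (nvI : nonvanishing I H).

Lemma null_fieldE u e : dom b c u -> isotropic_tangent b c u e ->
  null_field I u = (@I H (cinv b u) c e)^-1 *: e.
Proof.
move=> du ue; have lu := dom_lightlike_at du.
rewrite /null_field; case: xgetP => [f fE uf|/(_ e)//].
have [k k0 ->] := null_tangent_unique lu ue uf.
rewrite (relI (b := b)) ?dom_cmap //; last exact: dom_coords.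
rewrite invfM scalerA mulrAC mulVf ?mul1r //.
Qed.

Lemma null_field_null u e : dom b c u -> isotropic_tangent b c u e ->
  isotropic_tangent b c u (null_field I u).
Proof.
move=> du ue; rewrite (null_fieldE du ue); apply: null_tangent_scale (ue).
have := @nvI (cinv b u) b c e (dom_coords du); rewrite dom_cmap // => /(_ ue).
by rewrite invr_eq0.
Qed.

End Hypersurface.

Section NullFieldOrder.
Context {R : realType} {m : nat}.
Implicit Types H : lightlike R m.
Local Notation n := (1 + m + 1)%N.
Local Notation hchart H := (chart R (hyp H) (1 + m)).
Local Notation achart H := (chart R (amb H) n).

Definition hyp_jet k H (b : hchart H) (c : achart H) u :=
  (jet k (param b c) u,
   jet k.-1 (fun y => mxvec (gmx (met H) c y)) (param b c u)).

(** An invariant is represented in [scalar_order] by a null vector and the value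
    on it; the quotient of the two is the null field. *)
Lemma null_field_order (I : scalar_rule R m) H (x : hyp H) (b : hchart H) (c : achart H) :
  relative_invariant1 I -> nonvanishing I H -> scalar_order 2 I H -> coords x b c ->
  exists O (F : _ -> 'rV[R]_n),
    [/\ open O, O (@hyp_jet 2 H b c (cmap b x)), smooth O F
      & forall H' (b' : hchart H') (c' : achart H') u, atlas b' -> atlas c' -> dom b' c' u ->
          nonvanishing I H' -> O (@hyp_jet 2 H' b' c' u) ->
          isotropic_tangent b' c' u (null_field b' c' I u) /\
          null_field b' c' I u = F (@hyp_jet 2 H' b' c' u)].
Proof.
move=> relI nvI ordI xbc; have [Oj [F [oO Ox sF FP]]] := ordI x b c xbc.
have [iF1 IF1] := FP H x b c Logic.I xbc Ox.
have sF1 := smooth_fst oO sF; have sF2 := smooth_snd oO sF.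
have oO' := open_nonzero oO sF2.
exists (Oj `&` [set J | (F J).2 != 0]), (fun J => (F J).2^-1 *: (F J).1); split=> //.
- split=> //=; rewrite -IF1; exact: nvI iF1.
- move=> k; apply: Ck_scale => //.
    apply: Ck_inv => //; first by move=> J [].
    by apply: Ck_sub (sF2 k) => J [].
  by apply: Ck_sub (sF1 k) => J [].
move=> H' b' c' u hb' hc' du nvI' [Ou _].
have bc' := dom_coords hb' hc' du.
have := FP H' (cinv b' u) b' c' Logic.I bc'; rewrite (dom_cmap du) => /(_ Ou)[iFu IFu].
split; first exact: null_field_null iFu.
by rewrite (null_fieldE hb' hc' relI du iFu) IFu.
Qed.

End NullFieldOrder.

(** * The shape operator of the null field, and its expression in a frame *)

Section Shape.
Context {R : realType} {m : nat}.
Local Notation n := (1 + m + 1)%N.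

(** Operators on the tangent space are given by the images [W] of the basis [T].
    This is the eigenvalue of [W] on [xi], if [xi] is an eigenvector. *)
Definition null_eigenvalue (T W : 'M[R]_(1 + m, n)) (xi : 'rV[R]_n) : R :=
  (pull T xi *m W *m xi^T) 0 0 / (xi *m xi^T) 0 0.

(** This operator kills [xi], if [xi] is an eigenvector of [W]; so its image has
    at most the dimension of a screen. *)
Definition screen_mx (T W : 'M[R]_(1 + m, n)) (xi : 'rV[R]_n) : 'M[R]_(1 + m, n) :=
  W - null_eigenvalue T W xi *: T.

Context (H : lightlike R m) (b : chart R (hyp H) (1 + m)) (c : chart R (amb H) n).
Hypotheses (hb : atlas b) (hc : atlas c).
Context (I : scalar_rule R m).
Hypotheses (relI : relative_invariant1 I) (nvI : nonvanishing I H).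
Hypothesis ordI : scalar_order 2 I H.
Local Notation xi := (null_field b c I).
Local Notation T := (tanmx b c).
Local Notation r := (param b c).
Local Notation g := (gmx (met H) c).

Lemma hyp_jet_smooth k : smooth (dom b c) (@hyp_jet R m k H b c).
Proof.
rewrite /hyp_jet => j; apply: Ck_pair; first exact: dom_open.
  by apply: smooth_jet; [exact: dom_open|exact: param_smooth].
apply: (@Ck_comp _ _ _ _ _ (cmap c @` cdom c)).
- exact: finite_dim_mx.
- exact: dom_open.
- by move=> u; exact: param_dom.
- apply: smooth_jet; first exact: cimg_open.
  move=> i; apply: Ck_linear_mx; first exact: cimg_open.
  exact: gmx_smooth.
- exact: param_smooth.
Qed.

#[local] Opaque jet jdim hyp_jet.

Lemma null_field_near u : dom b c u -> exists U : set 'rV[R]_(1 + m),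
  [/\ open U, U u, U `<=` dom b c, smooth U xi
    & forall w, U w -> isotropic_tangent b c w (xi w)].
Proof.
move=> du; have bc := dom_coords hb hc du.
have [Oj [F [oO Ou sF FP]]] := null_field_order relI nvI ordI bc.
rewrite (dom_cmap du) in Ou.
have cJ : forall x, dom b c x -> {for x, continuous (@hyp_jet R m 2 H b c)}.
  by move=> w dw; exact: smooth_continuous (@hyp_jet_smooth 2) dw.
pose U := dom b c `&` (@hyp_jet R m 2 H b c) @^-1` Oj.
have oU : open U by apply: open_preimage_in => //; exact: dom_open.
exists U; split=> //.
- by move=> w [].
- have sFJ : smooth U (F \o (@hyp_jet R m 2 H b c)).
    have fd := finite_dim_prod (finite_dim_mx 1 (jdim (1 + m) n 2))
      (finite_dim_mx 1 (jdim n (n * n) 1)).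
    have UO x : U x -> Oj (@hyp_jet R m 2 H b c x) by case.
    have sJ : smooth U (@hyp_jet R m 2 H b c).
      by apply: smooth_sub (@hyp_jet_smooth 2) => w [].
    exact: (smooth_comp (fd R) oU UO sF sJ).
  move=> k; apply: Ck_eq (sFJ k) => // w; rewrite inE => -[dw Ow].
  by have [_ ->] := FP H b c w hb hc dw nvI Ow.
- by move=> w [dw Ow]; have [] := FP H b c w hb hc dw nvI Ow.
Qed.

Lemma null_field_isotropic u : dom b c u -> isotropic_tangent b c u (xi u).
Proof. by move=> /null_field_near[U [_ Uu _ _]]; exact. Qed.

Lemma null_field_differentiable u : dom b c u -> differentiable xi u.
Proof. by move=> /null_field_near[U [_ Uu _ sU _]]; exact: smooth_differentiable sU Uu. Qed.

Lemma param_differentiable u : dom b c u -> differentiable r u.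
Proof. by move=> du; apply: smooth_differentiable du; exact: param_smooth. Qed.

(** The operator [v |-> D_v xi], on the basis of coordinate vectors. *)
Definition shape_mx u : 'M[R]_(1 + m, n) :=
  \matrix_i covariant g r xi u (delta_mx 0 i).

Definition screen_field u : 'M[R]_(1 + m, n) := screen_mx (T u) (shape_mx u) (xi u).

Lemma shapeE u a : dom b c u -> a *m shape_mx u = covariant g r xi u a.
Proof.
move=> du; have lin := covariant_linear g _ _ _ (param_differentiable du)
  (null_field_differentiable du).
pose L : {linear 'rV[R]_(1 + m) -> 'rV[R]_n} :=
  HB.pack (covariant g r xi u) (GRing.isLinear.Build _ _ _ _ _ lin).
rewrite -[RHS]/(L a) {2}(row_sum_delta a) linear_sum mulmx_sum_row.
by apply: eq_bigr => i _; rewrite linearZ /= rowK.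
Qed.

Lemma derive_null_inner p (Y : 'rV[R]_(1 + m) -> 'M[R]_(p, n)) u a :
  dom b c u -> differentiable Y u -> (\near u, xi u *m gram b c u *m (Y u)^T = 0) ->
  covariant g r xi u a *m gram b c u *m (Y u)^T =
    - (xi u *m gram b c u *m (covariant g r Y u a)^T).
Proof.
move=> du dY Y0; apply/eqP; rewrite -addr_eq0; apply/eqP.
rewrite -(derive_inner (V := 'rV[R]_(1 + m)) a (dom_metric_at hc du)
  (param_differentiable du) (null_field_differentiable du) dY).
by rewrite (near_eq_derive (g := cst 0)) ?derive_cst.
Qed.

Lemma null_field_orthogonal u : dom b c u -> xi u *m gram b c u *m (T u)^T = 0.
Proof.
move=> du; have := null_tangent_orthogonal (dom_lightlike_at hb hc du)
  (null_field_isotropic du).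
have [lG _ _] := dom_lightlike_at hb hc du.
by move=> /(congr1 trmx); rewrite !trmx_mul trmxK (lorentzian_sym lG) trmx0 mulmxA.
Qed.

Lemma covariant_null_orthogonal u a : dom b c u ->
  covariant g r xi u a *m gram b c u *m (xi u)^T = 0.
Proof.
move=> du; have [lG _ _] := dom_lightlike_at hb hc du.
have E := derive_null_inner a du (null_field_differentiable du) _.
have {}E : covariant g r xi u a *m gram b c u *m (xi u)^T =
    - (xi u *m gram b c u *m (covariant g r xi u a)^T).
  apply: E; near=> w.
  have dw : dom b c w by near: w; exact: dom_near.
  have [_ _] := null_field_isotropic dw; rewrite /ip => E.
  by rewrite [LHS]mx11_scalar E -scalemx1 scale0r.
set Z := _ *m _ *m _ in E *; set Z' := _ *m _ *m _ in E.
have ZZ' : Z' = Z.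
  by rewrite -[Z']tr_scalar11 /Z' !trmx_mul trmxK (lorentzian_sym lG) mulmxA.
have /eqP : (2 : R) *: Z = 0 by rewrite scaler_nat mulr2n {1}E ZZ' addNr.
by rewrite scaler_eq0 pnatr_eq0 => /eqP.
Unshelve. all: by end_near.
Qed.

(** The null curves of the hypersurface are geodesics. Let [a] be the coordinates
    of [xi u], extended as a constant, so that [D_a r] is a tangent field equal to
    [xi] at [u]. As [xi] is orthogonal to all tangent fields,
    [(D_a xi, D_i r) = - (xi, D_a D_i r) = - (xi, D_i D_a r) = (D_i xi, xi) = 0],
    and only multiples of [xi] are orthogonal to all [D_i r]. *)
Lemma shape_null u : dom b c u ->
  pull (T u) (xi u) *m shape_mx u = null_eigenvalue (T u) (shape_mx u) (xi u) *: xi u.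
Proof.
move=> du; have lu := dom_lightlike_at hb hc du; have [lG _ _] := lu.
have xu := null_field_isotropic du; have [x0 xT _] := xu.
have fT := lightlike_row_free lu.
set a := pull _ _; have aT : a *m T u = xi u := mulmx_pull fT xT.
have sr := param_smooth hb hc.
have dD v : differentiable ('D_v r) u.
  by apply: smooth_differentiable du; exact: smooth_derive.
have perp v : \near u, xi u *m gram b c u *m ('D_v r u)^T = 0.
  near=> w; have dw : dom b c w by near: w; exact: dom_near.
  by rewrite -tanmxE // trmx_mul mulmxA null_field_orthogonal // mul0mx.
have key i : covariant g r xi u a *m gram b c u *m ('D_(delta_mx 0 i) r u)^T = 0.
  rewrite (derive_null_inner a du (dD _) (perp _)).
  rewrite (covariant_sym _ _ (dom_metric_at hc du) (@dom_open _ _ H b c) sr du).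
  rewrite -(derive_null_inner _ du (dD _) (perp _)) -tanmxE // aT.
  exact: covariant_null_orthogonal.
have [k kE] : exists k, a *m shape_mx u = k *: xi u.
  apply: (orthogonal_null_tangent lu xu); rewrite shapeE //.
  apply/row_matrixP => i; rewrite row0 !row_mul rowE tanmxE //.
  apply: trmx_inj; rewrite !trmx_mul !trmxK trmx0 (lorentzian_sym lG) mulmxA.
  exact: key.
have xx : (xi u *m (xi u)^T) 0 0 != 0 by rewrite sqnorm_neq0.
by rewrite kE /null_eigenvalue -/a kE -scalemxAl mxE mulfK.
Unshelve. all: by end_near.
Qed.

Lemma frame1_mx (X : 'M[R]_n) : row_mx (row_mx 1%:M 0) 0 *m X = frame1 X.
Proof.
rewrite -[in LHS](vsubmxK X) -[in LHS](vsubmxK (usubmx X)).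
by rewrite !mul_row_col !mul0mx !addr0 mul1mx.
Qed.

Section Frame.
Context (U : set 'rV[R]_(1 + m)) (E : 'rV[R]_(1 + m) -> 'M[R]_n).
Hypothesis fE : isotropic_frame_field b c U E.
Local Notation e1 := (fun w => frame1 (E w)).
Local Notation es := (fun w => frames (E w)).
Local Notation en := (fun w => framen (E w)).
Local Notation k := (fun w => I (cinv b w) c (frame1 (E w)) : R^o).

Fact frame_dom u : U u -> dom b c u.
Proof. by move=> Uu; have [_ Ud _ _] := fE; exact: Ud. Qed.

Fact frame_near u : U u -> \near u, U u.
Proof. by move=> Uu; have [oU _ _ _] := fE; exact: open_nbhs_nbhs. Qed.

Fact frame_differentiable u : U u -> differentiable E u.
Proof. by move=> Uu; have [_ _ sE _] := fE; exact: smooth_differentiable sE Uu. Qed.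

Lemma frame1_null u : U u -> isotropic_tangent b c u (e1 u).
Proof.
move=> Uu; have [_ _ _ /(_ _ Uu)[[uE ET] [[e11 _ _] _]]] := fE.
split=> //; last first.
  rewrite -(eqmxP ET); apply/submxP; exists (row_mx 1%:M 0).
  by rewrite -[in RHS](vsubmxK (usubmx (E u))) mul_row_col mul1mx mul0mx addr0.
pose p1 : 'rV[R]_n := row_mx (row_mx 1%:M 0) 0.
have p1E : p1 *m E u = frame1 (E u) := frame1_mx _.
apply/eqP => e0; have : p1 = 0 by rewrite -(mulmxK uE p1) p1E e0 mul0mx.
move=> /(congr1 (fun v : 'rV_n => lsubmx (lsubmx v : 'rV_(1 + m)))).
rewrite /p1 !row_mxKl !linear0 => /matrixP/(_ 0 0)/eqP; rewrite !mxE.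
by rewrite oner_eq0.
Qed.

Lemma frame1E u : U u -> e1 u = k u *: xi u.
Proof.
move=> Uu; rewrite (null_fieldE hb hc relI (frame_dom Uu) (frame1_null Uu)).
rewrite scalerA mulfV ?scale1r //.
have := @nvI _ b c (e1 u) (dom_coords hb hc (frame_dom Uu)).
by rewrite (dom_cmap (frame_dom Uu)) => /(_ (frame1_null Uu)).
Qed.

Lemma frame_factor_neq0 u : U u -> k u != 0.
Proof.
move=> Uu; have := @nvI _ b c (e1 u) (dom_coords hb hc (frame_dom Uu)).
by rewrite (dom_cmap (frame_dom Uu)) => /(_ (frame1_null Uu)).
Qed.

Lemma frame1_differentiable u : U u -> differentiable e1 u.
Proof.
move=> Uu; apply: (differentiable_linear_mx (usubmx : {linear 'M[R]_(1 + m, n) -> 'rV[R]_n})).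
apply: (differentiable_linear_mx (usubmx : {linear 'M[R]_(1 + m + 1, n) -> 'M[R]_(1 + m, n)})).
exact: frame_differentiable.
Qed.

Lemma frames_differentiable u : U u -> differentiable es u.
Proof.
move=> Uu; apply: (differentiable_linear_mx (dsubmx : {linear 'M[R]_(1 + m, n) -> 'M[R]_(m, n)})).
apply: (differentiable_linear_mx (usubmx : {linear 'M[R]_(1 + m + 1, n) -> 'M[R]_(1 + m, n)})).
exact: frame_differentiable.
Qed.

Lemma frame_factor_differentiable u : U u -> differentiable k u.
Proof.
move=> Uu; have du := frame_dom Uu; have dx := null_field_differentiable du.
have de := frame1_differentiable Uu.
have xx w : U w -> (xi w *m (xi w)^T) 0 0 != 0.
  by move=> /frame_dom/null_field_isotropic[x0 _ _]; rewrite sqnorm_neq0.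
have inner (X Y : 'rV[R]_(1 + m) -> 'rV[R]_n) : differentiable X u -> differentiable Y u ->
    differentiable (fun w => (X w *m (Y w)^T) 0 0 : R^o) u.
  move=> dX dY; apply: (differentiable_linear_mx (mx_coord (0 : 'I_1) (0 : 'I_1))).
  apply: differentiable_mulmx => //.
  exact: (differentiable_linear_mx (trmx : {linear 'rV[R]_n -> 'cV[R]_n})).
have dq : differentiable (fun w => (e1 w *m (xi w)^T) 0 0 * ((xi w *m (xi w)^T) 0 0)^-1 : R^o) u.
  apply: differentiableM; first exact: inner.
  by apply: differentiableV; [exact: inner|exact: xx].
apply: near_eq_differentiable dq; near=> w.
have Uw : U w by near: w; exact: frame_near.
by rewrite {1}(frame1E Uw) -scalemxAl mxE mulfK // xx.
Unshelve. all: by end_near.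
Qed.

Lemma covariant_frame1 u a : U u ->
  covariant g r e1 u a = 'D_a k u *: xi u + k u *: (a *m shape_mx u).
Proof.
move=> Uu; have du := frame_dom Uu; rewrite shapeE // /covariant.
have near_e1 : \near u, e1 u = k u *: xi u.
  by near=> w; apply: frame1E; near: w; exact: frame_near.
rewrite (near_eq_derive a near_e1) derive_scale; last 2 first.
- exact: frame_factor_differentiable.
- exact: null_field_differentiable.
set Gam := connection_mx _ _ _.
have -> : e1 u *m Gam = k u *: (xi u *m Gam) by rewrite {1}(frame1E Uu) -scalemxAl.
by rewrite scalerDr addrA.
Unshelve. all: by end_near.
Qed.

Lemma connection_form_frame u a : U u ->
  connection_form b c E u a *m E u = covariant g r E u a.
Proof.
move=> Uu; have [_ _ _ /(_ _ Uu)[[uE _] _]] := fE.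
rewrite /connection_form mulmxKV // /covariant.
by rewrite (deriveE a (param_differentiable (frame_dom Uu))).
Qed.

(** The rows are the values of the forms [(omega^1, omega^a)] on the coordinate
    vectors; [omega^n] vanishes on the hypersurface. *)
Definition coframe_mx u : 'M[R]_(1 + m) := lsubmx (T u *m invmx (E u)).

Lemma coframe_mxP u : U u ->
  T u *m invmx (E u) = row_mx (coframe_mx u) 0 /\ coframe_mx u \in unitmx.
Proof.
move=> Uu; have [_ _ _ /(_ _ Uu)[[uE ET] _]] := fE.
have [_ rT _] := dom_lightlike_at hb hc (frame_dom Uu).
have /submxP[D TD] : (T u <= usubmx (E u))%MS by rewrite (eqmxP ET).
have uE1 : usubmx (E u) *m invmx (E u) = row_mx 1%:M 0.
  by rewrite mul_usub_mx mulmxV // (@scalar_mx_block _ (1 + m) 1) /block_mx col_mxKu.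
have TE : T u *m invmx (E u) = row_mx D 0.
  by rewrite TD -mulmxA uE1 mul_mx_row mulmx1 mulmx0.
have -> : coframe_mx u = D by rewrite /coframe_mx TE row_mxKl.
split=> //; rewrite -row_free_unit -row_leq_rank -{1}rT TD.
exact: mxrankM_maxl.
Qed.

Lemma coframe_lsubmx u a : U u -> lsubmx (coframe b c E u a) = a *m coframe_mx u.
Proof.
move=> Uu; have [TE _] := coframe_mxP Uu.
rewrite /coframe -(deriveE a (param_differentiable (frame_dom Uu))).
rewrite -(tanmxE hb hc _ (frame_dom Uu)).
by rewrite -mulmxA TE mul_mx_row row_mxKl.
Qed.

Lemma omegasE u a : U u -> omegas b c E u a = a *m rsubmx (coframe_mx u).
Proof. by move=> Uu; rewrite /omegas coframe_lsubmx // mulmx_rsub. Qed.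

Lemma omega1E u a : U u -> omega1 b c E u a = (a *m lsubmx (coframe_mx u)) 0 0.
Proof.
by move=> Uu; rewrite /omega1 coframe_lsubmx // [in RHS]mulmx_lsub; congr (_ _ _).
Qed.

Lemma tangent_coframe u a : U u ->
  a *m T u = omega1 b c E u a *: e1 u + omegas b c E u a *m es u.
Proof.
move=> Uu; have [TE _] := coframe_mxP Uu; have [_ _ _ /(_ _ Uu)[[uE _] _]] := fE.
rewrite -{1}(mulmxKV uE (T u)) TE -{1}(vsubmxK (E u)) mul_row_col mul0mx addr0.
rewrite mulmxA -(hsubmxK (a *m coframe_mx u)) -{1}(vsubmxK (usubmx (E u))) mul_row_col.
rewrite -mulmx_lsub -mulmx_rsub omegasE // omega1E //; congr (_ + _).
by rewrite [X in X *m _]mx11_scalar mul_scalar_mx.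
Qed.

Lemma mul_row_frame p q (A : 'M[R]_(p, 1)) (B : 'M[R]_(p, m)) (C : 'M[R]_(p, 1))
    (X G : 'M[R]_n) (Y : 'M[R]_(n, q)) :
  row_mx (row_mx A B) C *m X *m G *m Y = A *m (frame1 X *m G *m Y) +
    B *m (frames X *m G *m Y) + C *m (framen X *m G *m Y).
Proof.
rewrite -[X in LHS](vsubmxK X) -[usubmx X in LHS](vsubmxK (usubmx X)) !mul_row_col.
by rewrite !mulmxDl !mulmxA.
Qed.

Lemma derive_frame1 u a : U u -> 'D_a e1 u = frame1 ('D_a E u).
Proof.
move=> Uu; have dE := frame_differentiable Uu.
have dE' := differentiable_linear_mx
  (usubmx : {linear 'M[R]_(1 + m + 1, n) -> 'M[R]_(1 + m, n)}) dE.
rewrite (derive_linear_mx (usubmx : {linear 'M[R]_(1 + m, n) -> 'rV[R]_n}) a dE').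
by rewrite (derive_linear_mx (usubmx : {linear 'M[R]_(1 + m + 1, n) -> 'M[R]_(1 + m, n)}) a dE).
Qed.

Lemma derive_frames u a : U u -> 'D_a es u = frames ('D_a E u).
Proof.
move=> Uu; have dE := frame_differentiable Uu.
have dE' := differentiable_linear_mx
  (usubmx : {linear 'M[R]_(1 + m + 1, n) -> 'M[R]_(1 + m, n)}) dE.
rewrite (derive_linear_mx (dsubmx : {linear 'M[R]_(1 + m, n) -> 'M[R]_(m, n)}) a dE').
by rewrite (derive_linear_mx (usubmx : {linear 'M[R]_(1 + m + 1, n) -> 'M[R]_(1 + m, n)}) a dE).
Qed.

Lemma connection_form_frame1 u a : U u ->
  usubmx (usubmx (connection_form b c E u a)) *m E u = covariant g r e1 u a.
Proof.
move=> Uu; rewrite !mul_usub_mx connection_form_frame // /covariant !linearD /=.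
by rewrite derive_frame1 // [in RHS]/frame1 !mul_usub_mx.
Qed.

Lemma connection_form_frames u a : U u ->
  dsubmx (usubmx (connection_form b c E u a)) *m E u = covariant g r es u a.
Proof.
move=> Uu; rewrite mul_dsub_mx mul_usub_mx connection_form_frame // /covariant !linearD /=.
by rewrite derive_frames // [in RHS]/frames mul_dsub_mx mul_usub_mx.
Qed.

Lemma omega11_frame u a : U u ->
  omega11 b c E u a = - (covariant g r e1 u a *m gram b c u *m (en u)^T) 0 0.
Proof.
move=> Uu; have [_ _ _ /(_ _ Uu)[_ [_ [enn e1n esn]]]] := fE.
rewrite -connection_form_frame1 //; set Cf := connection_form _ _ _ _ _.
rewrite -[usubmx (usubmx Cf)]hsubmxK -[lsubmx (usubmx (usubmx Cf))]hsubmxK mul_row_frame.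
have -> : e1 u *m gram b c u *m (en u)^T = (-1)%:M by rewrite [LHS]mx11_scalar -/(ip _ _ _) e1n.
have -> : en u *m gram b c u *m (en u)^T = 0.
  by rewrite [LHS]mx11_scalar -/(ip _ _ _) enn -scalemx1 scale0r.
rewrite esn !mulmx0 !addr0 mul_mx_scalar scaleN1r mxE opprK /omega11 -/Cf.
by rewrite /ulsubmx !mxE.
Qed.

Lemma omegasn_frame u a : U u ->
  (omegasn b c E u a)^T = covariant g r e1 u a *m gram b c u *m (es u)^T.
Proof.
move=> Uu; have du := frame_dom Uu; have [_ _ _ fEU] := fE.
have [_ [[e11 es1 _] [_ e1n _]]] := fEU _ Uu.
have [lG _ _] := dom_lightlike_at hb hc du; have sG := lorentzian_sym lG.
have near0 : \near u, e1 u *m gram b c u *m (es u)^T = 0.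
  near=> w; have Uw : U w by near: w; exact: frame_near.
  have [lGw _ _] := dom_lightlike_at hb hc (frame_dom Uw).
  have [_ [[_ + _] _]] := fEU _ Uw; move=> /(congr1 trmx).
  by rewrite !trmx_mul trmxK (lorentzian_sym lGw) trmx0 mulmxA.
have : covariant g r e1 u a *m gram b c u *m (es u)^T =
    - (e1 u *m gram b c u *m (covariant g r es u a)^T).
  apply/eqP; rewrite -addr_eq0; apply/eqP.
  rewrite -(derive_inner (V := 'rV[R]_(1 + m)) a (dom_metric_at hc du)
    (param_differentiable du) (frame1_differentiable Uu) (frames_differentiable Uu)).
  by rewrite (near_eq_derive (g := cst 0)) ?derive_cst.
move=> ->; apply: trmx_inj; rewrite trmxK [RHS]linearN /= !trmx_mul !trmxK sG mulmxA.
rewrite -connection_form_frames //; set Cf := connection_form _ _ _ _ _.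
rewrite -[dsubmx (usubmx Cf)]hsubmxK -[lsubmx (dsubmx (usubmx Cf))]hsubmxK mul_row_frame.
have -> : e1 u *m gram b c u *m (e1 u)^T = 0.
  by rewrite [LHS]mx11_scalar -/(ip _ _ _) e11 -scalemx1 scale0r.
have -> : en u *m gram b c u *m (e1 u)^T = (-1)%:M.
  by rewrite [LHS]mx11_scalar -/(ip _ _ _) (ipC _ _ sG) e1n.
rewrite es1 !mulmx0 !add0r mul_mx_scalar scaleN1r opprK /omegasn -/Cf.
by apply/matrixP => i j; rewrite /ursubmx !mxE.
Unshelve. all: by end_near.
Qed.

Lemma null_field_frames u : U u -> xi u *m gram b c u *m (es u)^T = 0.
Proof.
move=> Uu; have [_ _ _ /(_ _ Uu)[[_ ET] _]] := fE.
have /submxP[D ->] : (es u <= T u)%MS.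
  rewrite -(eqmxP ET); apply/submxP; exists (row_mx 0 1%:M).
  by rewrite -[in RHS](vsubmxK (usubmx (E u))) mul_row_col mul1mx mul0mx add0r.
by rewrite trmx_mul mulmxA null_field_orthogonal ?mul0mx //; exact: frame_dom.
Qed.

Lemma null_field_framen u : U u -> k u *: (xi u *m gram b c u *m (en u)^T) = (-1)%:M.
Proof.
move=> Uu; rewrite !scalemxAl -(frame1E Uu).
have [_ _ _ /(_ _ Uu)[_ [_ [_ e1n _]]]] := fE.
by rewrite [LHS]mx11_scalar -/(ip _ _ _) e1n.
Qed.

Fact scale_inner p q (s t : R) (X Y : 'M[R]_(p, n)) (G : 'M[R]_n) (Z : 'M[R]_(n, q)) :
  (s *: X + t *: Y) *m G *m Z = s *: (X *m G *m Z) + t *: (Y *m G *m Z).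
Proof. by rewrite !mulmxDl -!scalemxAl. Qed.

Lemma omegasn_shape u a : U u ->
  (omegasn b c E u a)^T = k u *: (a *m shape_mx u *m gram b c u *m (es u)^T).
Proof.
move=> Uu; rewrite omegasn_frame // covariant_frame1 // scale_inner.
by rewrite null_field_frames // scaler0 add0r.
Qed.

(** As [e_1 = k xi], the terms with [dk] in [d ln |k|] and in [omega_1^1] cancel;
    what is left is the inner product of [k D xi] with [e_n], that is, minus its
    [e_1] component. *)
Lemma dln_invariant u a : U u ->
  'D_a (fun w => ln `|k w| : R^o) u - omega11 b c E u a =
    k u * (a *m shape_mx u *m gram b c u *m (en u)^T) 0 0.
Proof.
move=> Uu; have k0 := frame_factor_neq0 Uu.
rewrite derive_ln //; last exact: frame_factor_differentiable.
rewrite omega11_frame // opprK covariant_frame1 // scale_inner.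
have := congr1 (fun B : 'M[R]_1 => B 0 0) (null_field_framen Uu).
have ZD (s t : R) (A B : 'M[R]_1) : (s *: A + t *: B) 0 0 = s * A 0 0 + t * B 0 0.
  by rewrite !mxE.
have Z1 (s : R) (A : 'M[R]_1) : (s *: A) 0 0 = s * A 0 0 by rewrite mxE.
rewrite ZD Z1 [X in _ = X -> _]mxE mulr1n.
have alg (d l x y : R) : l != 0 -> l * x = -1 -> d / l + (d * x + l * y) = l * y.
  move=> l0 lx; have -> : x = - l^-1 by apply: (mulfI l0); rewrite lx mulrN mulfV.
  by rewrite mulrN addrA subrr add0r.
exact: alg.
Qed.

Lemma screen_gram_unit u : U u -> screen_gram b c u (E u) \in unitmx.
Proof.
move=> Uu; have [_ _ _ /(_ _ Uu)[_ [[_ _ pos] _]]] := fE.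
rewrite -row_free_unit -kermx_eq0; apply/eqP/row_matrixP => i; rewrite row0.
set v := row i _; apply/eqP; apply: contraT => /pos.
by rewrite /ip /v -row_mul mulmx_ker row0 mul0mx mxE ltxx.
Qed.

Lemma frame_orthogonal0 u (v : 'rV[R]_n) : U u ->
  v *m gram b c u *m (e1 u)^T = 0 -> v *m gram b c u *m (es u)^T = 0 ->
  v *m gram b c u *m (en u)^T = 0 -> v = 0.
Proof.
move=> Uu v1 vs vn; have [_ _ _ /(_ _ Uu)[[uE _] _]] := fE.
have [lG _ _] := dom_lightlike_at hb hc (frame_dom Uu).
have uGE : gram b c u *m (E u)^T \in unitmx.
  by rewrite unitmx_mul lorentzian_unit // unitmx_tr.
rewrite -(mulmxK uGE v) mulmxA -[E u]vsubmxK -[usubmx (E u)]vsubmxK !tr_col_mx !mul_mx_row.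
rewrite -/(frame1 (E u)) -/(frames (E u)) -/(framen (E u)) v1 vs vn.
by rewrite !row_mx0 mul0mx.
Qed.

Lemma null_coframe u : U u ->
  pull (T u) (xi u) *m coframe_mx u = row_mx (k u)^-1%:M 0.
Proof.
move=> Uu; have du := frame_dom Uu; have [TE _] := coframe_mxP Uu.
have [_ _ _ /(_ _ Uu)[[uE _] _]] := fE; have k0 := frame_factor_neq0 Uu.
have fT := lightlike_row_free (dom_lightlike_at hb hc du).
have [_ xT _] := null_field_isotropic du.
have xE : xi u *m invmx (E u) = (k u)^-1 *: row_mx (row_mx 1%:M 0) 0.
  have -> : xi u = (k u)^-1 *: e1 u by rewrite {2}(frame1E Uu) scalerA mulVf // scale1r.
  by rewrite -scalemxAl -frame1_mx mulmxK.
have := mulmx_pull fT xT => /(congr1 (mulmx^~ (invmx (E u)))).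
rewrite xE -mulmxA TE mul_mx_row mulmx0 scale_row_mx => /eq_row_mx[-> _].
by rewrite scale_row_mx scaler0 scalemx1.
Qed.

(** The forms [omega_a^n] have no [omega^1] term, because [D xi] is proportional to
    [xi] in the direction of [xi]. *)
Lemma frame_coefficients_exist u : U u -> exists K Ks lam,
  invariant_coefficients I b c E u K Ks /\ second_form b c E u lam.
Proof.
move=> Uu; have du := frame_dom Uu; have [_ uTh] := coframe_mxP Uu.
set Th := coframe_mx u in uTh.
pose t := invmx Th *m (k u *: (shape_mx u *m gram b c u *m (en u)^T)).
pose N := invmx Th *m (k u *: (shape_mx u *m gram b c u *m (es u)^T)).
have decomp p (a : 'rV[R]_(1 + m)) (X : 'M[R]_(1 + m, p)) :
    a *m X = (a *m lsubmx Th) *m usubmx (invmx Th *m X) +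
             (a *m rsubmx Th) *m dsubmx (invmx Th *m X).
  have -> : a *m X = (a *m Th) *m (invmx Th *m X) by rewrite mulmxA mulmxK.
  rewrite -[a *m Th]hsubmxK.
  by rewrite -[in LHS](vsubmxK (invmx Th *m X)) mul_row_col -mulmx_lsub -mulmx_rsub.
have N0 : usubmx N = 0.
  have k0 := frame_factor_neq0 Uu.
  have : pull (T u) (xi u) *m (k u *: (shape_mx u *m gram b c u *m (es u)^T)) = 0.
    rewrite -scalemxAr !mulmxA shape_null // -2!scalemxAl null_field_frames //.
    by rewrite !scaler0.
  rewrite decomp mulmx_lsub mulmx_rsub null_coframe // row_mxKl row_mxKr mul0mx addr0.
  rewrite mul_scalar_mx => /eqP; rewrite scaler_eq0 invr_eq0 (negbTE k0) => /eqP.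
  by [].
exists (- usubmx t 0 0), (- (dsubmx t)^T), (dsubmx N)^T; split=> a.
  rewrite dln_invariant // omega1E // omegasE // -/Th.
  have -> : k u * (a *m shape_mx u *m gram b c u *m (en u)^T) 0 0 =
      (a *m (k u *: (shape_mx u *m gram b c u *m (en u)^T))) 0 0.
    by rewrite -scalemxAr [in RHS]mxE !mulmxA.
  have ZD (A B : 'M[R]_1) : (A + B) 0 0 = A 0 0 + B 0 0 by rewrite mxE.
  have ZN (A : 'M[R]_1) : (- A) 0 0 = - A 0 0 by rewrite mxE.
  have ZM (A B : 'M[R]_1) : (A *m B) 0 0 = A 0 0 * B 0 0 by rewrite mxE big_ord1.
  rewrite (decomp _ a (k u *: (shape_mx u *m gram b c u *m (en u)^T))) -/t ZD ZM.
  rewrite mulNr opprK mulNmx ZN opprK [usubmx t 0 0 * _]mulrC.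
  by rewrite -trmx_mul [X in _ = _ + X]mxE.
apply: trmx_inj; rewrite omegasn_shape // trmx_mul !trmxK omegasE // -/Th.
have -> : k u *: (a *m shape_mx u *m gram b c u *m (es u)^T) =
    a *m (k u *: (shape_mx u *m gram b c u *m (es u)^T)).
  by rewrite -scalemxAr !mulmxA.
by rewrite (decomp _ a (k u *: (shape_mx u *m gram b c u *m (es u)^T))) -/N N0 mulmx0 add0r.
Qed.

(** Let [W] be the operator [shape_mx]. Its components in the frame are
    [k W = (K omega^1 + K_a omega^a) e_1 + lambda^a_b omega^b e_a]. On [xi] this
    reads [k kap = K], so that in [k (W - kap)] the terms with [omega^1] cancel,
    and the [omega^b] are independent. *)
Lemma screen_field_frame u K Ks lam : U u ->
  invariant_coefficients I b c E u K Ks -> second_form b c E u lam ->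
  (screen_field u :=:
     (Ks^T *m e1 u + (affinor b c E u lam - K%:M)^T *m es u)%R)%MS.
Proof.
move=> Uu cK clam; have du := frame_dom Uu; have [_ uTh] := coframe_mxP Uu.
have k0 := frame_factor_neq0 Uu.
have [_ _ _ /(_ _ Uu)[_ [[e11 es1 _] [_ e1n esn]]]] := fE.
have [lG _ _] := dom_lightlike_at hb hc du; have sG := lorentzian_sym lG.
set kap := null_eigenvalue (T u) (shape_mx u) (xi u).
have Z1 (s : R) (A : 'M[R]_1) : (s *: A) 0 0 = s * A 0 0 by rewrite mxE.
have Z0 : (0 : 'M[R]_1) 0 0 = 0 by rewrite mxE.
have ZS (s : R) : (s%:M : 'M[R]_1) 0 0 = s by rewrite mxE mulr1n.
have KE : K = k u * kap.
  have := cK (pull (T u) (xi u)); rewrite dln_invariant // omega1E // omegasE //.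
  rewrite mulmx_lsub mulmx_rsub null_coframe // row_mxKl row_mxKr trmx0 mulmx0.
  rewrite shape_null // -2!scalemxAl -/kap Z1 Z0 ZS subr0.
  have := congr1 (fun B : 'M[R]_1 => B 0 0) (null_field_framen Uu); rewrite Z1 ZS.
  have alg (l y : R) : l != 0 -> l * y = -1 -> l * (kap * y) = - (K * l^-1) -> K = l * kap.
    move=> l0 ly; rewrite mulrCA ly mulrN1 => /oppr_inj ->.
    by rewrite mulrC divfK.
  exact: alg.
have shapeC a : k u *: (a *m shape_mx u) =
    (K * omega1 b c E u a + (Ks *m (omegas b c E u a)^T) 0 0) *: e1 u
    + omegas b c E u a *m (affinor b c E u lam)^T *m es u.
  apply/eqP; rewrite -subr_eq0; apply/eqP; set x := K * _ + _; set om := omegas _ _ _ _ _.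
  have inner q (Z : 'M[R]_(n, q)) :
      (k u *: (a *m shape_mx u) - (x *: e1 u + om *m (affinor b c E u lam)^T *m es u))
        *m gram b c u *m Z =
      k u *: (a *m shape_mx u *m gram b c u *m Z)
      - (x *: (e1 u *m gram b c u *m Z)
         + om *m (affinor b c E u lam)^T *m (es u *m gram b c u *m Z)).
    by rewrite !mulmxBl !mulmxDl -!scalemxAl !mulmxA.
  apply: (frame_orthogonal0 Uu); rewrite inner.
  - rewrite es1 mulmx0 addr0 [e1 u *m _ *m _]mx11_scalar -/(ip _ _ _) e11.
    rewrite -scalemx1 scale0r scaler0 subr0 {2}(frame1E Uu) linearZ /= -scalemxAr.
    by rewrite shapeE // covariant_null_orthogonal // !scaler0.
  - rewrite -omegasn_shape // clam trmx_mul trmxK -/om.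
    have -> : e1 u *m gram b c u *m (es u)^T = 0.
      by apply: trmx_inj; rewrite !trmx_mul trmxK sG trmx0 mulmxA es1.
    have gs : (screen_gram b c u (E u))^T = screen_gram b c u (E u).
      by rewrite /screen_gram !trmx_mul trmxK sG mulmxA.
    rewrite scaler0 add0r /affinor -/(screen_gram b c u (E u)) trmx_mul trmx_inv gs.
    by rewrite -!mulmxA mulVmx ?mulmx1 ?subrr //; exact: screen_gram_unit.
  - rewrite esn mulmx0 addr0 [e1 u *m _ *m _]mx11_scalar -/(ip _ _ _) e1n.
    rewrite [a *m shape_mx u *m _ *m _]mx11_scalar !scale_scalar_mx -dln_invariant // cK.
    by rewrite mulrN1 -opprD -/om -/x subrr.
have key a : a *m (k u *: screen_field u) =
    omegas b c E u a *m (Ks^T *m e1 u + (affinor b c E u lam - K%:M)^T *m es u).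
  rewrite -scalemxAr /screen_field /screen_mx -/kap mulmxBr scalerBr shapeC.
  rewrite -scalemxAr scalerA -KE tangent_coframe //; set om := omegas _ _ _ _ _.
  rewrite scalerDr scalerA mulmxDr [(_ - _)^T]linearB /= tr_scalar_mx mulmxBl mulmxBr.
  rewrite mul_scalar_mx -scalemxAr scalerDl !mulmxA.
  have -> : (Ks *m om^T) 0 0 *: e1 u = om *m Ks^T *m e1 u.
    rewrite -[om *m Ks^T]tr_scalar11 trmx_mul trmxK.
    by rewrite [X in _ = X *m _]mx11_scalar mul_scalar_mx.
  have alg (Z : zmodType) (x y z w : Z) : x + y + z - (x + w) = y + (z - w).
    by rewrite -[x + y + z]addrA opprD addrACA subrr add0r addrA.
  exact: alg.
set C := _ + _ *m _ in key *.
have kS : k u *: screen_field u = rsubmx (coframe_mx u) *m C.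
  by apply/row_matrixP => i; rewrite row_mul !rowE key omegasE.
have full : row_full (rsubmx (coframe_mx u)).
  apply/row_fullP; exists (dsubmx (invmx (coframe_mx u))).
  rewrite mul_dsub_mx mulmx_rsub mulVmx // (@scalar_mx_block _ 1 m).
  rewrite -[RHS](block_mxKdr (1%:M : 'M[R]_1) 0 0).
  by apply/matrixP => i j; rewrite /drsubmx !mxE.
apply: eqmx_trans (eqmx_sym (eqmx_scale _ k0)) _.
by rewrite kS; exact: (eqmxMfull C full).
Qed.

End Frame.

End Shape.

(** * The screen in a frame, and the existence of frames *)

Section Normalization.
Context {R : realType} {m : nat}.
#[local] Opaque jet jdim hyp_jet.
Local Notation n := (1 + m + 1)%N.

(** For this [L], the vectors [K_b e_1 + (A - K)^a_b e_a] are the combinations with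
    coefficients [A - K] of the vectors [e_a + L_a e_1]. *)
Definition normalization (A : 'M[R]_m) (K : R) (Ks : 'rV[R]_m) : 'rV[R]_m :=
  Ks *m invmx (A - K%:M).

Lemma screen_complement (E : 'M[R]_n) (T : 'M[R]_(1 + m, n)) (L : 'rV[R]_m) e k :
  E \in unitmx -> (usubmx E == T)%MS -> k != 0 -> e = k *: frame1 E ->
  let B := frames E + L^T *m frame1 E in
  \rank B = m /\ (e + B == T)%MS.
Proof.
move=> uE ET k0 -> B; split.
  have -> : B = row_mx (row_mx L^T 1%:M) 0 *m E.
    rewrite -[in RHS](vsubmxK E) -[in RHS](vsubmxK (usubmx E)).
    by rewrite !mul_row_col mul0mx addr0 mul1mx addrC.
  rewrite mxrankMfree ?row_free_unit //; apply/eqP/row_freeP.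
  exists (col_mx (col_mx 0 1%:M) 0).
  by rewrite !mul_row_col !mulmx0 addr0 add0r mulmx1.
have EX : usubmx E = col_mx (frame1 E) (frames E) by rewrite vsubmxK.
have sB : (B <= col_mx (frame1 E) (frames E))%MS.
  by apply/submxP; exists (row_mx L^T 1%:M); rewrite mul_row_col mul1mx addrC.
apply/eqmxP; apply: eqmx_trans _ (eqmxP ET); rewrite EX; apply/eqmxP/andP; split.
  rewrite addsmx_sub sB andbT scalemx_sub //.
  by apply/submxP; exists (row_mx 1%:M 0); rewrite mul_row_col mul1mx mul0mx addr0.
rewrite col_mx_sub; apply/andP; split.
  apply: submx_trans (addsmxSl _ _).
  by rewrite -{1}[frame1 E](scalerK k0) scalemx_sub.
have -> : frames E = B - (k^-1 *: L^T) *m (k *: frame1 E).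
  by rewrite -scalemxAl -scalemxAr scalerA mulVf // scale1r /B addrK.
apply: addmx_sub; first exact: addsmxSr.
rewrite eqmx_opp; apply: submx_trans (addsmxSl _ _); exact: submxMl.
Qed.

Lemma orthogonal_sym p q (G : 'M[R]_n) (A : 'M[R]_(p, n)) (B : 'M[R]_(q, n)) :
  G^T = G -> A *m G *m B^T = 0 -> B *m G *m A^T = 0.
Proof. by move=> sG /(congr1 trmx); rewrite !trmx_mul trmxK sG trmx0 mulmxA. Qed.

(** Adding a multiple of the null vector [x] to [v] makes it null and changes no
    inner product with vectors orthogonal to [x]. *)
Lemma null_completion (G : 'M[R]_n) (x v : 'rV[R]_n) :
  ip G x x = 0 -> ip G v x = -1 -> ip G x v = -1 ->
  let e := v + (2^-1 * ip G v v) *: x in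
  [/\ ip G e e = 0, ip G x e = -1
    & forall p (Y : 'M[R]_(p, n)), Y *m G *m v^T = 0 -> Y *m G *m x^T = 0 ->
        Y *m G *m e^T = 0].
Proof.
move=> xx vx xv e; split; rewrite /e.
- rewrite ipDl !ipDr !ipZl !ipZr xx vx xv; set q := ip _ _ _; by field.
- by rewrite ipDr ipZr xx mulr0 addr0.
- by move=> p Y Yv Yx; rewrite linearD linearZ /= mulmxDr -scalemxAr Yv Yx scaler0 addr0.
Qed.

Context (H : lightlike R m) (b : chart R (hyp H) (1 + m)) (c : chart R (amb H) n).
Hypotheses (hb : atlas b) (hc : atlas c).
Context (I : scalar_rule R m).
Hypotheses (relI : relative_invariant1 I) (nvI : nonvanishing I H).
Hypothesis ordI : scalar_order 2 I H.
Local Notation xi := (null_field b c I).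
Local Notation T := (tanmx b c).

Lemma screen_field_normalized U E u K Ks lam : isotropic_frame_field b c U E -> U u ->
  invariant_coefficients I b c E u K Ks -> second_form b c E u lam ->
  \det (affinor b c E u lam - K%:M) != 0 ->
  (screen_field b c I u :=:
    (frames (E u) + (normalization (affinor b c E u lam) K Ks)^T *m frame1 (E u))%R)%MS.
Proof.
move=> fE Uu cK clam dK.
apply: (eqmx_trans (screen_field_frame hb hc relI nvI ordI fE Uu cK clam)).
set A := affinor _ _ _ _ _ - _ in dK *.
have uA : A^T \in unitmx by rewrite unitmx_tr unitmxE unitfE.
have -> : Ks^T *m frame1 (E u) + A^T *m frames (E u) =
    A^T *m (frames (E u) + (normalization (affinor b c E u lam) K Ks)^T *m frame1 (E u)).
  by rewrite mulmxDr mulmxA trmx_mul trmx_inv mulmxA mulmxV // mul1mx addrC.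
by apply: eqmxMfull; rewrite row_full_unit.
Qed.

(** If the [i]-th entry of [a] is not zero, then the unit vectors other than the
    [i]-th complete [a] to a basis. *)
Lemma complete_row (a : 'rV[R]_(1 + m)) : a != 0 ->
  exists C : 'M[R]_(m, 1 + m), col_mx a C \in unitmx.
Proof.
case/rV0Pn=> i ai0; pose C : 'M[R]_(m, 1 + m) := row' i 1%:M; exists C.
have Ci (j : 'I_m) : C j i = 0 by rewrite !mxE eq_sym (negbTE (neq_lift i j)).
rewrite -row_free_unit -kermx_eq0; apply/eqP/row_matrixP => l; rewrite row0.
set x := row l _.
have : x *m col_mx a C = 0 by rewrite /x -row_mul mulmx_ker row0.
rewrite -[x]hsubmxK mul_row_col [lsubmx x]mx11_scalar mul_scalar_mx => xC.
have Cl (j j' : 'I_m) : C j' (lift i j) = (j' == j)%:R by rewrite !mxE (inj_eq lift_inj).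
have s0 : lsubmx x 0 0 = 0.
  have yC : (rsubmx x *m C) 0 i = 0 by rewrite mxE big1 // => j _; rewrite Ci mulr0.
  have /rowP/(_ i) := xC; rewrite mxE [X in X + _]mxE yC addr0 [RHS]mxE => /eqP.
  by rewrite mulf_eq0 (negbTE ai0) orbF => /eqP.
have y0 : rsubmx x = 0.
  move: xC; rewrite s0 scale0r add0r => xC; apply/rowP => j.
  have <- : (rsubmx x *m C) 0 (lift i j) = rsubmx x 0 j.
    rewrite mxE (bigD1 j) //= big1 => [|j' jj']; first by rewrite Cl eqxx mulr1 addr0.
    by rewrite Cl (negbTE jj') mulr0.
  by rewrite xC !mxE.
by rewrite s0 y0 -scalemx1 scale0r row_mx0.
Qed.

(** This makes a hypothesis on all frame fields usable at every point. The frame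
    begins with [xi]; then come constant combinations [C] of the coordinate
    vectors that are independent of [xi] at [u], hence near [u]; finally a vector
    [v] with the required inner products with these, corrected by
    [null_completion]. *)
Lemma frame_field_exists u : dom b c u -> exists U E,
  isotropic_frame_field b c U E /\ U u.
Proof.
move=> du; have [U0 [oU0 U0u U0d sxi xiU]] := null_field_near hb hc relI nvI ordI du.
have tU0 w : U0 w -> lightlike_at (gram b c w) (T w).
  by move=> /U0d; exact: dom_lightlike_at.
have sT : smooth U0 T.
  apply: smooth_sub U0d _; apply: smooth_jacobian; first exact: dom_open.
  exact: param_smooth.
have sG : smooth U0 (gram b c).
  apply: (@smooth_comp _ _ _ _ (cmap c @` cdom c)) => //.
  - exact: finite_dim_mx.
  - by move=> w /U0d/param_dom.
  - exact: gmx_smooth.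
  - by apply: smooth_sub U0d _; exact: param_smooth.
pose al w := pull (T w) (xi w).
have alT w : U0 w -> al w *m T w = xi w.
  move=> Uw; apply: mulmx_pull; first exact: lightlike_row_free (tU0 _ Uw).
  by case: (xiU w Uw).
have sal : smooth U0 al.
  move=> j; apply: Ck_mulmx => //.
    by apply: Ck_mulmx => //; apply: Ck_trmx.
  apply: Ck_invmx => //; first by move=> w /tU0/lightlike_row_free/gram_unit.
  by apply: Ck_mulmx => //; exact: Ck_trmx.
have [C uC] : exists C : 'M[R]_(m, 1 + m), col_mx (al u) C \in unitmx.
  apply: complete_row; apply/eqP => al0; have [x0 _ _] := xiU u U0u.
  by move: x0; rewrite -alT // al0 mul0mx eqxx.
pose dt w : R^o := \det (col_mx (al w) C).
have sdt : smooth U0 dt.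
  by move=> j; apply: Ck_det => //; apply: Ck_col_mx => //; exact: Ck_cst.
pose U := U0 `&` [set w | dt w != 0].
have oU : open U by exact: open_nonzero.
have UU0 : U `<=` U0 by move=> w [].
have Uunit w : U w -> col_mx (al w) C \in unitmx by case=> _; rewrite unitmxE unitfE.
pose M w : 'M[R]_(1 + m, n) := col_mx (al w) C *m T w.
have M1 w : U w -> M w = col_mx (xi w) (C *m T w).
  by move=> [Uw _]; rewrite /M mul_col_mx alT.
have fM w : U w -> row_free (M w).
  move=> Uw; rewrite /row_free /M mxrankMfree ?mxrank_unit ?Uunit //.
  exact/lightlike_row_free/tU0/UU0.
have sM : smooth U M.
  move=> j; apply: Ck_mulmx => //; last exact: Ck_sub UU0 (sT j).
  by apply: Ck_col_mx => //; [exact: Ck_sub UU0 (sal j)|exact: Ck_cst].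
pose v w : 'rV[R]_n := row_mx (-1)%:M 0 *m invmx (M w *m (M w)^T) *m M w *m invmx (gram b c w).
have vM w : U w -> v w *m gram b c w *m (M w)^T = row_mx (-1)%:M 0.
  move=> Uw; have [lG _ _] := tU0 _ (UU0 _ Uw).
  rewrite /v mulmxKV ?lorentzian_unit // -(mulmxA _ (M w)) mulmxKV //.
  by apply: gram_unit; exact: fM.
have sv : smooth U v.
  move=> j; have sMj := sM j; have sGj := Ck_sub UU0 (sG j).
  apply: Ck_mulmx => //; last first.
    by apply: Ck_invmx => // w /UU0/tU0[lG _ _]; exact: lorentzian_unit.
  apply: Ck_mulmx => //; apply: Ck_mulmx => //; first exact: Ck_cst.
  apply: Ck_invmx => //; first by move=> w Uw; exact/gram_unit/fM.
  by apply: Ck_mulmx => //; exact: Ck_trmx.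
pose en w : 'rV[R]_n := v w + (2^-1 * ip (gram b c w) (v w) (v w)) *: xi w.
have sen : smooth U en.
  move=> j; have svj := sv j; have sGj := Ck_sub UU0 (sG j).
  apply: Ck_add => //; apply: Ck_scale => //; last exact: Ck_sub UU0 (sxi j).
  apply: Ck_mul => //; first exact: Ck_cst.
  by apply: Ck_coord => //; apply: Ck_mulmx => //; [exact: Ck_mulmx|exact: Ck_trmx].
pose E w : 'M[R]_n := col_mx (M w) (en w).
exists U, E; split; last by split=> //; move: uC; rewrite unitmxE unitfE.
have E1 w : U w -> frame1 (E w) = xi w.
  by move=> Uw; rewrite /frame1 /E col_mxKu M1 // col_mxKu.
have Es w : U w -> frames (E w) = C *m T w.
  by move=> Uw; rewrite /frames /E col_mxKu M1 // col_mxKd.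
have En w : framen (E w) = en w by rewrite /framen /E col_mxKd.
split=> //.
- by move=> w /UU0/U0d.
- by move=> j; apply: Ck_col_mx.
move=> w Uw; have U0w := UU0 _ Uw; have lw := tU0 _ U0w; have [lG rT _] := lw.
have symG := lorentzian_sym lG; have xw := xiU w U0w; have [x0 xT xx] := xw.
have Tx := null_tangent_orthogonal lw xw.
have Mx : M w *m gram b c w *m (xi w)^T = 0 by rewrite /M -!mulmxA (mulmxA (T w)) Tx mulmx0.
have vx : ip (gram b c w) (v w) (xi w) = -1 /\ v w *m gram b c w *m (C *m T w)^T = 0.
  have := vM w Uw; rewrite M1 // tr_col_mx mul_mx_row => /eq_row_mx[vx ->].
  by rewrite /ip vx mxE.
have [vx1 vxs] := vx.
have xv : ip (gram b c w) (xi w) (v w) = -1 by rewrite (ipC _ _ symG).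
have xCT : xi w *m gram b c w *m (C *m T w)^T = 0.
  by apply: orthogonal_sym => //; rewrite -!mulmxA (mulmxA (T w)) Tx mulmx0.
have enx : en w *m gram b c w *m (xi w)^T = (-1)%:M.
  by rewrite [LHS]mx11_scalar -/(ip _ _ _) ipDl ipZl xx mulr0 addr0 vx1.
split; last split.
- split.
    rewrite -row_free_unit -kermx_eq0; apply/eqP/row_matrixP => l; rewrite row0.
    set x := row l _.
    have : x *m E w = 0 by rewrite /x -row_mul mulmx_ker row0.
    rewrite -[x]hsubmxK mul_row_col => xE.
    have y0 : rsubmx x = 0.
      have := congr1 (fun z => z *m gram b c w *m (xi w)^T) xE.
      have gen (A : 'rV[R]_(1 + m)) (B : 'rV[R]_1) (X : 'M[R]_(1 + m, n)) (Y : 'rV[R]_n)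
          (G : 'M[R]_n) (Z : 'cV[R]_n) :
          (A *m X + B *m Y) *m G *m Z = A *m (X *m G *m Z) + B *m (Y *m G *m Z).
        by rewrite !mulmxDl !mulmxA.
      rewrite gen Mx enx !mul0mx.
      by rewrite mulmx0 add0r mul_mx_scalar scaleN1r => /eqP; rewrite oppr_eq0 => /eqP.
    move: xE; rewrite y0 mul0mx addr0 -[RHS](mul0mx _ (M w)) => /(row_free_inj (fM w Uw)) ->.
    by rewrite row_mx0.
  rewrite /E col_mxKu; apply/eqmxP.
  by apply: eqmxMfull; rewrite row_full_unit Uunit.
- rewrite E1 // Es //; split=> //.
    by rewrite -!mulmxA (mulmxA (T w)) Tx mulmx0.
  move=> a a0; have -> : ip (screen_gram b c w (E w)) a a =
      ip (gram b c w) (a *m (C *m T w)) (a *m (C *m T w)).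
    by rewrite /ip /screen_gram Es // !trmx_mul !mulmxA.
  have [|[k ak]|//] := lorentzian_orthogonal (v := a *m (C *m T w)) lG x0 xx.
    by rewrite /ip trmx_mul mulmxA xCT mul0mx mxE.
  have : row_mx (- k%:M) a *m M w = 0.
    by rewrite M1 // mul_row_col mulNmx mul_scalar_mx ak addNr.
  rewrite -[RHS](mul0mx _ (M w)) => /(row_free_inj (fM w Uw)).
  by rewrite -[0 in RHS]row_mx0 => /eq_row_mx[_ a00]; rewrite a00 eqxx in a0.
- rewrite E1 // Es // En.
  have [een xen perp] := null_completion xx vx1 xv; split=> //.
  apply: perp; last by rewrite -!mulmxA (mulmxA (T w)) Tx mulmx0.
  exact: orthogonal_sym vxs.
Qed.

End Normalization.

(** * Naturality of the screen under isomorphisms *)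

Section Isomorphism.
Context {R : realType} {m : nat}.
#[local] Opaque jet jdim hyp_jet.
Local Notation n := (1 + m + 1)%N.

(** Although [null_eigenvalue] is computed with the coordinate inner product, on
    an eigenvector it depends on the operator only, and hence does not change with
    the tangent basis ([Q]) and the ambient coordinates ([P]). *)
Lemma screen_mx_natural (T W T' W' : 'M[R]_(1 + m, n)) (x x' : 'rV[R]_n)
    (Q : 'M[R]_(1 + m)) (P : 'M[R]_n) k :
  row_free T -> row_free T' -> P \in unitmx -> (x <= T)%MS -> x != 0 ->
  T *m P = Q *m T' -> W *m P = Q *m W' -> x' = x *m P ->
  pull T x *m W = k *: x -> (screen_mx T' W' x' :=: screen_mx T W x *m P)%MS.
Proof.
move=> fT fT' uP xT x0 TP WP -> xW.
have uQ : Q \in unitmx.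
  rewrite -row_free_unit -row_leq_rank; have := mxrankM_maxl Q T'.
  by rewrite -TP mxrankMfree ?(eqP fT) // row_free_unit.
have xQ : pull T' (x *m P) = pull T x *m Q.
  by rewrite -[in LHS](mulmx_pull fT xT) -mulmxA TP mulmxA pull_mulmx.
have xP0 : x *m P != 0 by rewrite mulmx_free_eq0 // row_free_unit.
have kE : null_eigenvalue T W x = k.
  by rewrite /null_eigenvalue xW -scalemxAl mxE mulfK // gt_eqF // sqnorm_gt0.
have kE' : null_eigenvalue T' W' (x *m P) = k.
  rewrite /null_eigenvalue xQ -(mulmxA _ Q) -WP mulmxA xW -!scalemxAl mxE mulfK //.
  by rewrite sqnorm_neq0.
rewrite /screen_mx kE kE' mulmxBl WP -scalemxAl TP scalemxAr -mulmxBr.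
by apply/eqmx_sym/eqmxMfull; rewrite row_full_unit.
Qed.

Context (I : scalar_rule R m) (H H' : lightlike R m).
Context (phi : amb H -> amb H') (psi : hyp H -> hyp H').
Context (b : chart R (hyp H) (1 + m)) (c : chart R (amb H) n).
Context (b' : chart R (hyp H') (1 + m)) (c' : chart R (amb H') n).
Hypotheses (relI : relative_invariant1 I) (intI : intrinsic_scalar I).
Hypotheses (nvI : nonvanishing I H) (nvI' : nonvanishing I H').
Hypotheses (ordI : scalar_order 2 I H) (ordI' : scalar_order 2 I H').
Hypothesis iso : isomorphism phi psi.
Hypotheses (hb : atlas b) (hc : atlas c) (hb' : atlas b') (hc' : atlas c').
Local Notation r := (param b c).
Local Notation r' := (param b' c').
Local Notation g := (gmx (met H) c).
Local Notation g' := (gmx (met H') c').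
Local Notation xi := (null_field b c I).
Local Notation xi' := (null_field b' c' I).
Local Notation f := (local_rep phi c c').
Local Notation h := (local_rep psi b b').
Local Notation P := (jacobian f).

Definition iso_dom : set 'rV[R]_(1 + m) :=
  (dom b c `&` local_dom psi b b') `&` r @^-1` local_dom phi c c'.

Lemma iso_dom_open : open iso_dom.
Proof.
have [[[cphi _] _] [[cpsi _] _] _ _] := iso.
apply: open_preimage_in; last 1 first.
- by move=> w [dw _]; apply: smooth_continuous dw; exact: param_smooth.
- by apply: openI; [exact: dom_open|exact: local_dom_open].
- exact: local_dom_open.
Qed.

Lemma iso_dom_near w : iso_dom w -> \near w, iso_dom w.
Proof. by move=> dw; apply: open_nbhs_nbhs; split=> //; exact: iso_dom_open. Qed.

Lemma local_rep_psi_smooth : smooth (local_dom psi b b') h.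
Proof. by have [_ [[_ sm] _] _ _] := iso; exact: sm. Qed.

Lemma local_rep_phi_smooth : smooth (local_dom phi c c') f.
Proof. by have [[[_ sm] _] _ _ _] := iso; exact: sm. Qed.

Lemma phi_dom_open : open (local_dom phi c c').
Proof. by have [[[cphi _] _] _ _ _] := iso; exact: local_dom_open. Qed.

Lemma iso_domP w : iso_dom w ->
  [/\ dom b c w, dom b' c' (h w), cinv b' (h w) = psi (cinv b w) & f (r w) = r' (h w)].
Proof.
have [_ _ comm _] := iso.
move=> [[dw /local_domP[bw b'w hw]] /local_domP[cw c'w _]].
have [_ cw2 _] := local_domP dw.
have E : cinv c (r w) = imm (cinv b w) by rewrite /param /local_rep /= cmapK.
rewrite E in cw c'w.
split=> //; first by apply: local_dom_cmap => //; rewrite -comm.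
  by rewrite /local_rep /= cmapK.
by rewrite {1}/local_rep /= E /param /local_rep /= cmapK // comm.
Qed.

Lemma metric_isomorphism z : local_dom phi c c' z -> g z = P z *m g' (f z) *m (P z)^T.
Proof.
have [_ _ _ isoG] := iso; move=> [y [cy c'y] <-].
have fy : f (cmap c y) = cmap c' (phi y) by rewrite /local_rep /= cmapK.
by rewrite fy; exact: isoG.
Qed.

Lemma jacobian_phi_unit w : iso_dom w -> P (r w) \in unitmx.
Proof.
move=> dw; have [dw1 _ _ _] := iso_domP dw; case: (dw) => _ /metric_isomorphism E.
have [lG _ _] := dom_lightlike_at hb hc dw1; have := lorentzian_unit lG.
by rewrite /gram E -mulmxA unitmx_mul => /andP[].
Qed.

Lemma tanmx_isomorphism w : iso_dom w ->
  tanmx b c w *m P (r w) = jacobian h w *m tanmx b' c' (h w).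
Proof.
move=> dw; have [dw1 dw' _ _] := iso_domP dw; have [[_ psw] phw] := dw.
have dh := smooth_differentiable local_rep_psi_smooth psw.
have df := smooth_differentiable local_rep_phi_smooth phw.
have dr := param_differentiable hb hc dw1.
have dr' := param_differentiable hb' hc' dw'.
have E : \near w, (f \o r) w = (r' \o h) w.
  near=> v; have dv : iso_dom v by near: v; exact: iso_dom_near.
  by have [_ _ _ rv] := iso_domP dv.
apply/row_matrixP => i; rewrite !row_mul !rowE (tanmxE hb hc _ dw1) (jacobianE _ dh).
rewrite (jacobianE _ df) (tanmxE hb' hc' _ dw') -(derive_comp _ dr df) -(derive_comp _ dh dr').
exact: near_eq_derive.
Unshelve. all: by end_near.
Qed.

Lemma null_field_isomorphism w : iso_dom w -> xi' (h w) = xi w *m P (r w).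
Proof.
move=> dw; have [dw1 dw' cE rE] := iso_domP dw.
have iw := null_field_isotropic hb hc relI nvI ordI dw1; have [x0 xT xx] := iw.
have uP := jacobian_phi_unit dw.
have iw' : isotropic_tangent b' c' (h w) (xi w *m P (r w)).
  split.
  - apply: contra x0 => /eqP xP; rewrite -(mulmxK uP (xi w)) xP mul0mx.
    by [].
  - have := submxMr (P (r w)) xT; rewrite (tanmx_isomorphism dw) => xTP.
    exact: submx_trans xTP (submxMl _ _).
  - by move: xx; rewrite /ip /gram -rE (metric_isomorphism dw.2) trmx_mul !mulmxA.
have bc := dom_coords hb hc dw1.
have cw : chart_at (phi (imm (cinv b w))) c'.
  by have [_ _ comm _] := iso; have [_] := dom_coords hb' hc' dw'; rewrite cE comm.
have := intI iso bc cw (e := xi w); rewrite (dom_cmap dw1) => /(_ iw) IE.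
rewrite (null_fieldE hb' hc' relI dw' iw') cE.
have rw : r w = cmap c (imm (cinv b w)) by [].
by rewrite rw -IE -rw scalemxAl -(null_fieldE hb hc relI dw1 iw).
Qed.

Lemma shape_isomorphism w : iso_dom w ->
  shape_mx b c I w *m P (r w) = jacobian h w *m shape_mx b' c' I (h w).
Proof.
move=> dw; have [dw1 dw' _ rE] := iso_domP dw; have [[_ psw] phw] := dw.
have dh := smooth_differentiable local_rep_psi_smooth psw.
have dr := param_differentiable hb hc dw1.
have dr' := param_differentiable hb' hc' dw'.
have dx := null_field_differentiable hb hc relI nvI ordI dw1.
have dx' := null_field_differentiable hb' hc' relI nvI' ordI' dw'.
have Gw' : metric_at g' (f (r w)) by rewrite rE; exact: dom_metric_at.
apply/row_matrixP => i; rewrite !row_mul !rowE.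
rewrite (shapeE hb hc relI nvI ordI _ dw1) (shapeE hb' hc' relI nvI' ordI' _ dw').
rewrite (jacobianE _ dh).
rewrite -(covariant_isometry _ phi_dom_open phw local_rep_phi_smooth metric_isomorphism
  (dom_metric_at hc dw1) Gw' dr dx).
rewrite -(covariant_reparam _ _ dh dr' dx').
apply: covariant_near; near=> v.
  have dv : iso_dom v by near: v; exact: iso_dom_near.
  by have [_ _ _ rv] := iso_domP dv.
have dv : iso_dom v by near: v; exact: iso_dom_near.
by rewrite /= (null_field_isomorphism dv).
Unshelve. all: by end_near.
Qed.

Lemma screen_field_isomorphism w : iso_dom w ->
  (screen_field b' c' I (h w) :=: screen_field b c I w *m P (r w))%MS.
Proof.
move=> dw; have [dw1 dw' _ _] := iso_domP dw.
have lw := dom_lightlike_at hb hc dw1; have lw' := dom_lightlike_at hb' hc' dw'.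
have [x0 xT _] := null_field_isotropic hb hc relI nvI ordI dw1.
exact: (screen_mx_natural (lightlike_row_free lw) (lightlike_row_free lw')
  (jacobian_phi_unit dw) xT x0 (tanmx_isomorphism dw) (shape_isomorphism dw)
  (null_field_isomorphism dw) (shape_null hb hc relI nvI ordI dw1)).
Qed.

End Isomorphism.

(** * The screen as a function of the 3-jet *)

Section JetCoordinates.
Context {R : realType}.

Definition jet_low p q k (j : 'rV[R]_(jdim p q k.+1)) : 'rV[R]_(jdim p q k) :=
  @lsubmx R 1 (jdim p q k) (p * jdim p q k) j.

Definition jet_der p q k (j : 'rV[R]_(jdim p q k.+1)) : 'M[R]_(p, jdim p q k) :=
  vec_mx (@rsubmx R 1 (jdim p q k) (p * jdim p q k) j).

Lemma jet_lowE p q k (f : 'rV[R]_p -> 'rV[R]_q) x :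
  jet_low (jet k.+1 f x) = jet k f x.
Proof. exact: row_mxKl. Qed.

Lemma jet_derE p q k (f : 'rV[R]_p -> 'rV[R]_q) x :
  jet_der (jet k.+1 f x) = jacobian (jet k f) x.
Proof. by rewrite /jet_der /= row_mxKr mxvecK. Qed.

Lemma Ck_jet_low (V : normedModType R) p q k i (A : set V)
    (J : V -> 'rV[R]_(jdim p q k.+1)) :
  open A -> Ck i A J -> Ck i A (fun x => jet_low (J x)).
Proof.
move=> oA; exact: (Ck_linear_mx (lsubmx : {linear 'M[R]_(1, jdim p q k + p * jdim p q k) -> _}) oA).
Qed.

Lemma Ck_jet_der (V : normedModType R) p q k i (A : set V)
    (J : V -> 'rV[R]_(jdim p q k.+1)) :
  open A -> Ck i A J -> Ck i A (fun x => jet_der (J x)).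
Proof.
move=> oA CJ; apply: (Ck_linear_mx vec_mx oA).
exact: (Ck_linear_mx (rsubmx : {linear 'M[R]_(1, jdim p q k + p * jdim p q k) -> _}) oA).
Qed.

(** Independence of the rows of [C *m M] is an open condition on [M], so a fixed
    [C] selects bases of the row spaces of all neighbouring matrices of rank
    [k]. *)
Lemma full_selection p q (M : 'M[R]_(p, q)) k : \rank M = k ->
  exists C : 'M[R]_(k, p), \rank (C *m M) = k.
Proof.
move=> <-; have /submxP[C CM] : (row_base M <= M)%MS by rewrite eq_row_base.
by exists C; rewrite -CM eq_row_base.
Qed.

Lemma row_free_det p q (M : 'M[R]_(p, q)) : \det (M *m M^T) != 0 -> row_free M.
Proof.
rewrite -unitfE -unitmxE -row_free_unit => /eqP fM; rewrite /row_free eqn_leq rank_leq_row.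
by rewrite -{1}fM mxrankM_maxl.
Qed.

End JetCoordinates.

Section OrderThree.
Context {R : realType} {m : nat}.
Local Notation n := (1 + m + 1)%N.
Local Notation p := (1 + m)%N.
Local Notation J2 := ('rV[R]_(jdim p n 2) * 'rV[R]_(jdim n (n * n) 1))%type.
Local Notation J3 := ('rV[R]_(jdim p n 3) * 'rV[R]_(jdim n (n * n) 2))%type.

(** [connection_mx] with the metric and its first derivatives as independent
    variables. *)
Definition jet_connection (g : 'M[R]_n) (dg : 'M[R]_(n, n * n)) (v : 'rV[R]_n) : 'M[R]_n :=
  let d l i j := dg l (mxvec_index i j) in
  \matrix_(j, k) \sum_i v 0 i *
    (2^-1 * \sum_l invmx g k l * (d i j l + d j i l - d l i j)).

Lemma jet_connectionE (G : 'rV[R]_n -> 'M[R]_n) y v : differentiable G y ->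
  connection_mx G y v = jet_connection (G y) (jacobian (fun z => mxvec (G z)) y) v.
Proof.
move=> dG; have dvG : differentiable (fun z => mxvec (G z)) y.
  exact: (differentiable_linear_mx mxvec).
have dE l i j : 'D_(delta_mx 0 l) (fun z => G z i j : R^o) y =
    jacobian (fun z => mxvec (G z)) y l (mxvec_index i j).
  have -> : jacobian (fun z => mxvec (G z)) y l (mxvec_index i j) =
      ('D_(delta_mx 0 l) (fun z => mxvec (G z)) y) 0 (mxvec_index i j).
    by rewrite -row_jacobian // [RHS]mxE.
  rewrite (derive_linear_mx mxvec _ dG) mxvecE.
  exact/(derive_linear_mx (mx_coord i j)).
apply/matrixP => j k; rewrite !mxE; apply: eq_bigr => i _; rewrite /christoffel.
by congr (_ * (_ * _)); apply: eq_bigr => l _; rewrite !dE.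
Qed.

Lemma Ck_jet_connection (V : normedModType R) i (A : set V) (g : V -> 'M[R]_n)
    (dg : V -> 'M[R]_(n, n * n)) (v : V -> 'rV[R]_n) :
  open A -> (forall x, A x -> g x \in unitmx) ->
  Ck i A g -> Ck i A dg -> Ck i A v -> Ck i A (fun x => jet_connection (g x) (dg x) (v x)).
Proof.
move=> oA ug Cg Cdg Cv; apply: Ck_mx => // j k; under eq_fun do rewrite mxE.
apply: Ck_sum => // l _; apply: Ck_mul => //; first exact: Ck_coord.
apply: Ck_mul => //; first exact: Ck_cst.
apply: Ck_sum => // l' _; apply: Ck_mul => //; first by apply: Ck_coord => //; exact: Ck_invmx.
by apply: Ck_sub_fun => //; [apply: Ck_add => //|]; exact: Ck_coord.
Qed.

Lemma Ck_screen_mx (V : normedModType R) i (A : set V) (T W : V -> 'M[R]_(1 + m, n))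
    (x : V -> 'rV[R]_n) : open A ->
  (forall z, A z -> T z *m (T z)^T \in unitmx) ->
  (forall z, A z -> (x z *m (x z)^T) 0 0 != 0) ->
  Ck i A T -> Ck i A W -> Ck i A x -> Ck i A (fun z => screen_mx (T z) (W z) (x z)).
Proof.
move=> oA uT x0 CT CW Cx; have CTt := Ck_trmx oA CT; have Cxt := Ck_trmx oA Cx.
apply: Ck_sub_fun => //; apply: Ck_scale => //; apply: Ck_mul => //.
  apply: Ck_coord => //; apply: Ck_mulmx => //; apply: Ck_mulmx => //.
  apply: Ck_mulmx => //; first exact: Ck_mulmx.
  by apply: Ck_invmx => //; exact: Ck_mulmx.
by apply: Ck_inv => //; apply: Ck_coord => //; exact: Ck_mulmx.
Qed.

Definition jet_tan (J : J3) : 'M[R]_(p, n) := jet_der (jet_low (jet_low J.1)).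

Definition jet_order2 (J : J3) : J2 := (jet_low J.1, jet_low J.2).

(** The derivative of the 2-jet along the [i]-th coordinate line of the
    hypersurface; for the jet of the metric this is a derivative along the map
    [param], whence the factor [jet_tan]. *)
Definition jet_direction (i : 'I_p) (J : J3) : J2 :=
  (row i (jet_der J.1), row i (jet_tan J) *m jet_der J.2).

Definition jet_metric (J : J3) : 'M[R]_n := vec_mx (jet_low (jet_low J.2)).

(** The chain rule for [D xi] when [xi] is the function [F] of the 2-jet. *)
Definition jet_shape (F : J2 -> 'rV[R]_n) (J : J3) : 'M[R]_(p, n) :=
  \matrix_i ('D_(jet_direction i J) F (jet_order2 J) +
    F (jet_order2 J) *m jet_connection (jet_metric J) (jet_der (jet_low J.2)) (row i (jet_tan J))).

Definition jet_screen (F : J2 -> 'rV[R]_n) (J : J3) : 'M[R]_(p, n) :=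
  screen_mx (jet_tan J) (jet_shape F J) (F (jet_order2 J)).

Lemma finite_dim_J2 : finite_dim J2.
Proof. by apply: finite_dim_prod; exact: finite_dim_mx. Qed.

Section Regular.
Context (O : set J2) (F : J2 -> 'rV[R]_n).
Hypotheses (oO : open O) (sF : smooth O F).

(** Where [F] is known to be smooth and the denominators of [jet_screen] do not
    vanish. *)
Definition jet_regular : set J3 :=
  [set J | [/\ O (jet_order2 J), \det (jet_metric J) != 0,
    \det (jet_tan J *m (jet_tan J)^T) != 0 &
    (F (jet_order2 J) *m (F (jet_order2 J))^T) 0 0 != 0]].

Lemma smooth_jet1 (A : set J3) : open A -> smooth A (fun J => J.1).
Proof.
by move=> oA; apply: smooth_fst => // k; apply: (@Ck_linear _ _ _ k A idfun) => x.
Qed.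

Lemma smooth_jet2 (A : set J3) : open A -> smooth A (fun J => J.2).
Proof.
by move=> oA; apply: smooth_snd => // k; apply: (@Ck_linear _ _ _ k A idfun) => x.
Qed.

Lemma smooth_jet_tan (A : set J3) : open A -> smooth A jet_tan.
Proof.
move=> oA k; apply: Ck_jet_der => //; apply: Ck_jet_low => //; apply: Ck_jet_low => //.
exact: smooth_jet1.
Qed.

Lemma smooth_jet_order2 (A : set J3) : open A -> smooth A jet_order2.
Proof.
move=> oA k; apply: Ck_pair => //; apply: Ck_jet_low => //.
  exact: smooth_jet1.
exact: smooth_jet2.
Qed.

Lemma smooth_jet_metric (A : set J3) : open A -> smooth A jet_metric.
Proof.
move=> oA k; apply: (Ck_linear_mx vec_mx oA); apply: Ck_jet_low => //.
apply: Ck_jet_low => //; exact: smooth_jet2.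
Qed.

Lemma smooth_jet_direction i (A : set J3) : open A -> smooth A (jet_direction i).
Proof.
move=> oA k; apply: Ck_pair => //.
  apply: (Ck_linear_mx (row i) oA); apply: Ck_jet_der => //; exact: smooth_jet1.
apply: Ck_mulmx => //; first by apply: (Ck_linear_mx (row i) oA); exact: smooth_jet_tan.
by apply: Ck_jet_der => //; exact: smooth_jet2.
Qed.

Lemma jet_regular_open : open jet_regular.
Proof.
pose A1 : set J3 := setT `&` jet_order2 @^-1` O.
have oT : open (@setT J3) := openT.
have oA1 : open A1.
  apply: open_preimage_in; [exact: oT|exact: oO|move=> J _].
  exact: smooth_continuous (smooth_jet_order2 oT) Logic.I.
have sx : smooth A1 (fun J => F (jet_order2 J)).
  by apply: (smooth_comp finite_dim_J2 oA1 _ sF (smooth_jet_order2 oA1)) => J [].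
have sT := smooth_jet_tan oA1; have sg := smooth_jet_metric oA1.
have oA2 : open (A1 `&` [set J | \det (jet_metric J) != 0]).
  by apply: (@open_nonzero _ _ _ (fun J => \det (jet_metric J) : R^o)) => // k; exact: Ck_det.
have oA3 : open (A1 `&` [set J | \det (jet_tan J *m (jet_tan J)^T) != 0]).
  apply: (@open_nonzero _ _ _ (fun J => \det (jet_tan J *m (jet_tan J)^T) : R^o)) => // k.
  by apply: Ck_det => //; apply: Ck_mulmx => //; exact: Ck_trmx.
have oA4 : open (A1 `&` [set J | (F (jet_order2 J) *m (F (jet_order2 J))^T) 0 0 != 0]).
  apply: (@open_nonzero _ _ _
    (fun J => (F (jet_order2 J) *m (F (jet_order2 J))^T) 0 0 : R^o)) => // k.
  by apply: Ck_coord => //; apply: Ck_mulmx => //; exact: Ck_trmx.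
have -> : jet_regular = (A1 `&` [set J | \det (jet_metric J) != 0]) `&`
    ((A1 `&` [set J | \det (jet_tan J *m (jet_tan J)^T) != 0]) `&`
     (A1 `&` [set J | (F (jet_order2 J) *m (F (jet_order2 J))^T) 0 0 != 0])).
  by apply/seteqP; split=> J; [case|case=> -[[_ ?] ?] [[_ ?] [_ ?]]].
by apply: openI => //; exact: openI.
Qed.

Lemma jet_screen_smooth : smooth jet_regular (jet_screen F).
Proof.
have oA := jet_regular_open.
have sx : smooth jet_regular (fun J => F (jet_order2 J)).
  by apply: (smooth_comp finite_dim_J2 oA _ sF (smooth_jet_order2 oA)) => J [].
move=> k; apply: Ck_screen_mx => //.
- by move=> J []; rewrite unitmxE unitfE.
- by move=> J [].
- exact: smooth_jet_tan.
apply: Ck_mx => // i j.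
have CD : Ck k jet_regular (fun J => 'D_(jet_direction i J) F (jet_order2 J)).
  apply: (@Ck_derive_along _ _ _ _ _ O).
  - exact: finite_dim_J2.
  - exact: oA.
  - by move=> J [].
  - move=> v; have RO J : jet_regular J -> O (jet_order2 J) by case.
    exact: (Ck_comp finite_dim_J2 oA RO (smooth_derive v sF k) (smooth_jet_order2 oA k)).
  - by move=> J; exact: smooth_differentiable.
  - exact: smooth_jet_direction.
have CC : Ck k jet_regular (fun J => F (jet_order2 J) *m
    jet_connection (jet_metric J) (jet_der (jet_low J.2)) (row i (jet_tan J))).
  apply: Ck_mulmx => //; apply: Ck_jet_connection => //.
  - by move=> J []; rewrite unitmxE unitfE.
  - exact: smooth_jet_metric.
  - by apply: Ck_jet_der => //; apply: Ck_jet_low => //; exact: smooth_jet2.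
  - by apply: (Ck_linear_mx (row i) oA); exact: smooth_jet_tan.
have := Ck_coord 0 j oA (Ck_add oA CD CC).
by apply: Ck_eq => // J _; rewrite [RHS]mxE.
Qed.

End Regular.

End OrderThree.

Section JetEvaluation.
Context {R : realType} {m : nat}.
Local Notation n := (1 + m + 1)%N.
Local Notation p := (1 + m)%N.

Context (H : lightlike R m) (b : chart R (hyp H) p) (c : chart R (amb H) n).
Hypotheses (hb : atlas b) (hc : atlas c).
Local Notation r := (param b c).
Local Notation g := (gmx (met H) c).
Local Notation mg := (fun y => mxvec (g y)).
Local Notation j3 := (@hyp_jet R m 3 H b c).

Lemma jet_order2E u : jet_order2 (j3 u) = @hyp_jet R m 2 H b c u.
Proof. by rewrite /jet_order2 /hyp_jet !jet_lowE. Qed.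

Lemma jet_tanE u : jet_tan (j3 u) = tanmx b c u.
Proof. by rewrite /jet_tan /hyp_jet !jet_lowE jet_derE. Qed.

Lemma jet_metricE u : jet_metric (j3 u) = gram b c u.
Proof. by rewrite /jet_metric /hyp_jet !jet_lowE mxvecK. Qed.

Lemma derive_hyp_jet i u : dom b c u ->
  'D_(delta_mx 0 i) (@hyp_jet R m 2 H b c) u = jet_direction i (j3 u).
Proof.
move=> du; have dr := param_differentiable hb hc du.
have oc : open (cmap c @` cdom c) by exact: cimg_open.
have sg : smooth (cmap c @` cdom c) mg.
  by move=> k; apply: Ck_linear_mx => //; exact: gmx_smooth.
have dg1 : differentiable (jet 1 mg) (r u).
  by apply: smooth_differentiable (param_dom du); exact: smooth_jet.
have dr2 : differentiable (jet 2 r) u.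
  apply: smooth_differentiable du; apply: smooth_jet; first exact: dom_open.
  exact: param_smooth.
have dgr : differentiable (jet 1 mg \o r) u by exact: differentiable_comp.
rewrite (derive_pair _ dr2 dgr) /jet_direction jet_tanE; congr (_, _).
  by rewrite jet_derE row_jacobian.
by rewrite jet_derE (derive_comp _ dr dg1) -(jacobianE _ dg1) -(row_jacobian _ dr).
Qed.

Context (I : scalar_rule R m).
Hypotheses (relI : relative_invariant1 I) (nvI : nonvanishing I H).
Hypothesis ordI : scalar_order 2 I H.
Local Notation J2 := ('rV[R]_(jdim p n 2) * 'rV[R]_(jdim n (n * n) 1))%type.
Context (O : set J2) (F : J2 -> 'rV[R]_n).
Hypotheses (oO : open O) (sF : smooth O F).
Hypothesis FP : forall u, dom b c u -> O (@hyp_jet R m 2 H b c u) ->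
  null_field b c I u = F (@hyp_jet R m 2 H b c u).

Lemma jet_shapeE u : dom b c u -> O (@hyp_jet R m 2 H b c u) ->
  jet_shape F (j3 u) = shape_mx b c I u.
Proof.
move=> du Ou; have dJ := smooth_differentiable (hyp_jet_smooth hb hc 2) du.
have near_xi : \near u, null_field b c I u = (F \o @hyp_jet R m 2 H b c) u.
  have dn := dom_near du.
  have On : \near u, O (@hyp_jet R m 2 H b c u).
    have : nbhs (@hyp_jet R m 2 H b c u) O by apply: open_nbhs_nbhs.
    exact: (differentiable_continuous dJ).
  by apply: filterS2 dn On => w dw Ow; exact: FP.
have dF := smooth_differentiable sF Ou.
apply/row_matrixP => i; rewrite !rowK /covariant.
rewrite (near_eq_derive _ near_xi) (derive_comp _ dJ dF) (derive_hyp_jet _ du).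
rewrite jet_order2E -(FP du Ou) jet_metricE jet_tanE.
rewrite (row_jacobian _ (param_differentiable hb hc du)).
have [dG _ _] := dom_metric_at hc du.
by rewrite (jet_connectionE _ dG) /hyp_jet jet_lowE jet_derE.
Qed.

Lemma jet_screenE u : dom b c u -> O (@hyp_jet R m 2 H b c u) ->
  jet_screen F (j3 u) = screen_field b c I u.
Proof.
move=> du Ou.
by rewrite /jet_screen jet_tanE (jet_shapeE du Ou) jet_order2E -(FP du Ou).
Qed.

Lemma hyp_jet_regular u : dom b c u -> O (@hyp_jet R m 2 H b c u) ->
  jet_regular O F (j3 u).
Proof.
move=> du Ou; have lu := dom_lightlike_at hb hc du; have [lG _ _] := lu.
split; rewrite ?jet_order2E ?jet_metricE ?jet_tanE -?(FP du Ou) //.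
- by rewrite -unitfE -unitmxE; exact: lorentzian_unit.
- by rewrite -unitfE -unitmxE; exact: gram_unit (lightlike_row_free lu).
- apply: sqnorm_neq0.
  by have [] := null_field_isotropic hb hc relI nvI ordI du.
Qed.

End JetEvaluation.

Section ScreenRank.
Context {R : realType} {m : nat}.
Local Notation n := (1 + m + 1)%N.
Context (I : scalar_rule R m) (relI : relative_invariant1 I).
Context (H : lightlike R m) (nvI : nonvanishing I H) (ordI : scalar_order 2 I H).
Hypothesis ncI : not_characteristic_root I H.
Context (b : chart R (hyp H) (1 + m)) (c : chart R (amb H) n).
Hypotheses (hb : atlas b) (hc : atlas c).

(** The screen is defined without frames, but the hypothesis that gives its
    dimension is on frames; so a frame is introduced to evaluate it. *)
Lemma screen_field_complement u : dom b c u -> \rank (screen_field b c I u) = m /\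
  forall e, isotropic_tangent b c u e -> (e + screen_field b c I u == tanmx b c u)%MS.
Proof.
move=> du; have lu := dom_lightlike_at hb hc du.
have [U [E [fE Uu]]] := frame_field_exists hb hc relI nvI ordI du.
have [K [Ks [lam [cK clam]]]] := frame_coefficients_exist hb hc relI nvI ordI fE Uu.
have /eqP dK := ncI hb hc fE Uu cK clam.
have SE := screen_field_normalized hb hc relI nvI ordI fE Uu cK clam dK.
have e1n := frame1_null fE Uu.
have [_ _ _ /(_ u Uu)[[uE ET] _]] := fE.
split.
  have [rk _] := screen_complement (normalization (affinor b c E u lam) K Ks) uE ET
    (oner_neq0 R) (esym (scale1r _)).
  by rewrite SE.
move=> e ie; have [k k0 ek] := null_tangent_unique lu e1n ie.
have [_ Te] := screen_complement (normalization (affinor b c E u lam) K Ks) uE ET k0 ek.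
apply/eqmxP; apply: eqmx_trans (eqmxP Te).
exact: adds_eqmx.
Qed.

End ScreenRank.

(** * The invariant screen distribution *)

Section RowSpaces.
Context {R : realType}.

Lemma row_space_inj p q n (A : 'M[R]_(p, n)) (B : 'M[R]_(q, n)) :
  [set v : 'rV_n | (v <= A)%MS] = [set v : 'rV_n | (v <= B)%MS] -> (A :=: B)%MS.
Proof.
move=> AB; apply/eqmxP/andP; split; apply/rV_subP => v vA.
  by have : [set v : 'rV_n | (v <= B)%MS] v by rewrite -AB.
by have : [set v : 'rV_n | (v <= A)%MS] v by rewrite AB.
Qed.

Lemma eqmx_row_space p q n (A : 'M[R]_(p, n)) (B : 'M[R]_(q, n)) : (A :=: B)%MS ->
  [set v : 'rV_n | (v <= A)%MS] = [set v : 'rV_n | (v <= B)%MS].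
Proof. by move=> AB; apply/seteqP; split=> v /=; rewrite AB. Qed.

Lemma row_space_image p n k (A : 'M[R]_(p, n)) (P : 'M[R]_(n, k)) :
  [set v *m P | v in [set v : 'rV_n | (v <= A)%MS]] = [set v | (v <= A *m P)%MS].
Proof.
apply/seteqP; split=> [_ [v vA <-]|v /submxP[a ->]] /=; first exact: submxMr.
by exists (a *m A); [exact: submxMl|rewrite mulmxA].
Qed.

End RowSpaces.

Section Screen.
Context {R : realType} {m : nat}.
Local Notation n := (1 + m + 1)%N.
Context (I : scalar_rule R m).
Hypotheses (relI : relative_invariant1 I) (intI : intrinsic_scalar I).
Implicit Types H : lightlike R m.

Definition regular H :=
  [/\ nonvanishing I H, scalar_order 2 I H & not_characteristic_root I H].

(** Any chart [b] of the hypersurface gives the same subspace: see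
    [screen_ruleE]. *)
Definition screen_rule : distribution_rule R m := fun H x c =>
  [set v | exists2 b, chart_at x b & (v <= screen_field b c I (cmap b x))%MS].

Lemma isomorphism_id H : isomorphism (H := H) (H' := H) id id.
Proof.
have diffeo_id p (M : manifold R p) : diffeomorphism (M := M) (N := M) id.
  have sm : smooth_map (M := M) (N := M) id.
    split=> [x|b c hb hc]; first exact: cvg_id.
    by have [] := atlas_compatible hb hc.
  by split=> //; exists id; split.
split=> // y c c' yc yc'; exact: gmx_tensor.
Qed.

Lemma jacobian_transition_id n' (M : manifold R n') (c : chart R M n') y :
  cdom c y -> jacobian (transition c c) (cmap c y) = 1%:M.
Proof.
move=> cy; have oc : open (cmap c @` cdom c) by exact: cimg_open.
have E : \forall z \near cmap c y, transition c c z = id z.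
  near=> z; have [w cw <-] : (cmap c @` cdom c) z.
    near: z; apply: open_nbhs_nbhs; split=> //; by exists y.
  by rewrite /transition /= cmapK.
have dE : differentiable (transition c c) (cmap c y).
  apply: (@near_eq_differentiable _ _ _ id).
    by near=> z; apply/esym; near: z.
  have idc : continuous (idfun : {linear 'rV[R]_n' -> 'rV[R]_n'}) by move=> z; exact: cvg_id.
  exact: linear_differentiable idc.
apply/row_matrixP => i; rewrite row_jacobian // (near_eq_derive _ E) derive_id.
by rewrite rowE mulmx1.
Unshelve. all: by end_near.
Qed.

Lemma screen_field_natural H H' (phi : amb H -> amb H') (psi : hyp H -> hyp H') x
    (b : chart R (hyp H) (1 + m)) (c : chart R (amb H) n)
    (b' : chart R (hyp H') (1 + m)) (c' : chart R (amb H') n) :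
  regular H -> regular H' -> isomorphism phi psi ->
  coords x b c -> chart_at (psi x) b' -> chart_at (phi (imm x)) c' ->
  (screen_field b' c' I (cmap b' (psi x)) :=: screen_field b c I (cmap b x) *m
     jacobian (local_rep phi c c') (cmap c (imm x)))%MS.
Proof.
move=> [nvI ordI _] [nvI' ordI' _] iso [[hb bx] [hc cx]] [hb' bx'] [hc' cx'].
have rx : param b c (cmap b x) = cmap c (imm x) by rewrite /param /local_rep /= cmapK.
have hx : local_rep psi b b' (cmap b x) = cmap b' (psi x) by rewrite /local_rep /= cmapK.
have dx : iso_dom phi psi b c b' c' (cmap b x).
  split; last by rewrite /= rx; exact: local_dom_cmap.
  by split; exact: local_dom_cmap.
have := screen_field_isomorphism relI intI nvI nvI' ordI ordI' iso hb hc hb' hc' dx.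
by rewrite rx hx.
Qed.

(** A change of charts is the identity isomorphism seen in two charts. *)
Lemma screen_ruleE H x (b : chart R (hyp H) (1 + m)) c : regular H -> coords x b c ->
  screen_rule x c = [set v | (v <= screen_field b c I (cmap b x))%MS].
Proof.
move=> rH xbc; have [xb xc] := xbc; apply/seteqP; split=> v /=; last by exists b.
case=> b' xb'.
have E : (screen_field b' c I (cmap b' x) :=: screen_field b c I (cmap b x) *m
    jacobian (transition c c) (cmap c (imm x)))%MS.
  exact: (screen_field_natural rH rH (isomorphism_id H) xbc xb' xc).
have mul1 (A B : 'M[R]_(1 + m, n)) (P : 'M[R]_n) : P = 1%:M -> (A <= B *m P)%MS -> (A <= B)%MS.
  by move=> ->; rewrite mulmx1.
move=> vS; apply: submx_trans vS _; apply: mul1 (jacobian_transition_id xc.2) _.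
by move/eqmxP: E => /andP[].
Qed.

Lemma screen_rule_intrinsic : intrinsic_distribution regular screen_rule.
Proof.
move=> H H' phi psi rH rH' iso x c c' xc xc'.
have [b hb bx] := atlas_cover x; have [b' hb' bx'] := atlas_cover (psi x).
have [_ _ comm _] := iso.
have xbc' : coords (psi x) b' c' by split=> //; rewrite -comm.
rewrite (screen_ruleE rH' xbc') (screen_ruleE (b := b) rH) //.
rewrite row_space_image; apply: eqmx_row_space.
exact: (screen_field_natural rH rH' iso).
Qed.

(** A matrix [C] that selects a basis of the screen of [H] at [x] also does so for
    the neighbouring jets, because the screens of all regular hypersurfaces have
    the same dimension. *)
Lemma screen_rule_order H : regular H -> distribution_order 3 regular screen_rule H.
Proof.
move=> rH J; have -> : J = @hyp_jet R m 3 by [].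
move=> {J} x b c xbc; have [nvI ordI ncI] := rH.
have [hb hc] : atlas b /\ atlas c by case: xbc => -[? _] [].
have dx := coords_dom xbc.
have [Oj [F [oO Ox sF FP]]] := null_field_order relI nvI ordI xbc.
have FPH H' (b' : chart R (hyp H') (1 + m)) (c' : chart R (amb H') n) u :
    atlas b' -> atlas c' -> nonvanishing I H' -> dom b' c' u ->
    Oj (@hyp_jet R m 2 H' b' c' u) -> null_field b' c' I u = F (@hyp_jet R m 2 H' b' c' u).
  by move=> hb' hc' nv' du Ou; have [] := FP H' b' c' u hb' hc' du nv' Ou.
have [rS _] := screen_field_complement relI nvI ordI ncI hb hc dx.
have [C rC] := full_selection rS.
pose B J := C *m jet_screen F J.
pose O3 := jet_regular Oj F `&` [set J | \det (B J *m (B J)^T) != 0].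
have oR := jet_regular_open oO sF.
have sB : smooth (jet_regular Oj F) B.
  move=> k; apply: Ck_mulmx => //; first exact: Ck_cst.
  exact: jet_screen_smooth.
exists O3, B; split.
- apply: (@open_nonzero _ _ _ (fun J => \det (B J *m (B J)^T) : R^o)) => // k.
  by apply: Ck_det => //; apply: Ck_mulmx => //; exact: Ck_trmx.
- have FP0 := fun u => @FPH H b c u hb hc nvI.
  split; first exact: (hyp_jet_regular hb hc relI nvI ordI FP0).
  rewrite /= -unitfE -unitmxE /B; apply: gram_unit.
  rewrite (jet_screenE hb hc oO sF FP0 dx Ox).
  by rewrite /row_free rC.
- by move=> k; apply: Ck_sub (sB k) => J [].
move=> H' x' b' c' rH' xbc' [regJ detJ]; have [nvI' ordI' ncI'] := rH'.
have [hb' hc'] : atlas b' /\ atlas c' by case: xbc' => -[? _] [].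
have dx' := coords_dom xbc'.
have FP' := fun u => @FPH H' b' c' u hb' hc' nvI'.
have Ox' : Oj (@hyp_jet R m 2 H' b' c' (cmap b' x')).
  by case: regJ; rewrite jet_order2E.
have JE := jet_screenE hb' hc' oO sF FP' dx' Ox'.
have [rS' _] := screen_field_complement relI nvI' ordI' ncI' hb' hc' dx'.
have /eqP fB := row_free_det detJ.
rewrite (screen_ruleE rH' xbc'); apply: eqmx_row_space; apply: eqmx_sym.
rewrite /B JE in fB *.
by apply/eqmxP; rewrite -(mxrank_leqif_eq (submxMl _ _)) fB rS'.
Qed.

(** The smooth local bases come from [screen_rule_order], applied to [H] itself at
    the points near [x]. *)
Lemma screen_rule_distribution H : regular H -> screen_distribution (@screen_rule H).
Proof.
move=> rH; have [nvI ordI ncI] := rH; split.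
  move=> x c c' xc xc'; exact: (screen_rule_intrinsic rH rH (isomorphism_id H)).
move=> x b c xbc.
have [hb hc] : atlas b /\ atlas c by case: xbc => -[? _] [].
have dx := coords_dom xbc.
have [Oj [F [oO Ox sF FP]]] := screen_rule_order rH xbc.
pose J := @hyp_jet R m 3 H b c.
have sJ := hyp_jet_smooth hb hc 3.
pose U := dom b c `&` J @^-1` Oj.
have oU : open U.
  apply: open_preimage_in; [exact: dom_open|exact: oO|].
  by move=> u du; exact: smooth_continuous sJ du.
exists U, (F \o J); split=> //.
- by move=> u [].
- apply: (smooth_comp _ oU _ sF).
  + by apply: finite_dim_prod; exact: finite_dim_mx.
  + by move=> u [].
  + by apply: smooth_sub sJ => u [].
move=> u [du Ou].
have ubc := dom_coords hb hc du; have uE := dom_cmap du.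
have SE := FP H (cinv b u) b c rH ubc.
rewrite uE in SE; move: (SE Ou) => {}SE.
have [rS cS] := screen_field_complement relI nvI ordI ncI hb hc du.
have BS : (F (J u) :=: screen_field b c I u)%MS.
  by apply: row_space_inj; rewrite -SE (screen_ruleE rH ubc) uE.
split; first exact: SE.
  by rewrite /= BS.
move=> e ie; apply/eqmxP; apply: eqmx_trans (eqmxP (cS e ie)).
exact: adds_eqmx.
Qed.

End Screen.

Unset Implicit Arguments.

Theorem theorem6 (R : realType) (m : nat) :
  exists L : 'M[R]_m -> R -> 'rV[R]_m -> 'rV[R]_m,
  forall I : scalar_rule R m,
  relative_invariant1 I -> intrinsic_scalar I ->
  let good (H : lightlike R m) :=
    [/\ nonvanishing I H, scalar_order 2 I H & not_characteristic_root I H] in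
  exists S : distribution_rule R m,
    [/\ forall H, good H ->
          screen_distribution (S H) /\
          (forall b c U E u K Ks lam, @atlas _ _ (hyp H) b -> atlas c ->
            isotropic_frame_field b c U E -> U u ->
            invariant_coefficients I b c E u K Ks -> second_form b c E u lam ->
            S H (cinv b u) c =
              [set v | (v <= (frames (E u)
                  + (L (affinor b c E u lam) K Ks)^T *m frame1 (E u))%R)%MS]),
        intrinsic_distribution good S
      & forall H, good H -> distribution_order 3 good S H].
Proof.
exists normalization => I relI intI good; exists (screen_rule I); split.
- move=> H rH; have [nvI ordI ncI] := rH; split; first exact: screen_rule_distribution.
  move=> b c U E u K Ks lam hb hc fE Uu cK clam.
  have du := frame_dom fE Uu; have ubc := dom_coords hb hc du.
  rewrite (screen_ruleE relI intI rH ubc) (dom_cmap du); apply: eqmx_row_space.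
  apply: (screen_field_normalized hb hc relI nvI ordI fE Uu cK clam).
  exact/eqP/(ncI _ _ _ _ _ _ _ _ hb hc fE Uu cK clam).
- exact: screen_rule_intrinsic.
- exact: screen_rule_order.
Qed.
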